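(* Let $\mathcal{N}_{A_1A_2\to B}$ be a quantum multiple access channel (with finite-dimensional systems). Define $\mathcal{R}_{\mathrm{QCL}}(\mathcal{N})$ as the union, over all finite alphabets $\mathcal{U},\mathcal{X}_1,\mathcal{X}_2$, all distributions $p_U(u)p_{X_1|U}(x_1|u)p_{X_2|U}(x_2|u)$ (so that $X_1 - U - X_2$ is a Markov chain), all collections of states $\{\theta_{A_1}^{x_1}\}_{x_1\in\mathcal{X}_1}$ and $\{\varphi_{A_2}^{x_2}\}_{x_2\in\mathcal{X}_2}$, and all quantum instruments $\Gamma_{B\to\bar{B}Z_1Z_2}$ with finite classical outcome registers $Z_1,Z_2$, of the set of rate pairs $(R_1,R_2)$ satisfying \[ R_1\le I(X_1;Z_2|UX_2)_\omega,\qquad R_2\le I(X_2;Z_1|UX_1)_\omega,\qquad R_1+R_2\le I(X_1X_2;\bar{B}Z_1Z_2)_\omega, \] where all quantities are evaluated on the classical-quantum state \[ \omega_{UX_1X_2\bar BZ_1Z_2}=\sum_{u,x_1,x_2}p_U(u)p_{X_1|U}(x_1|u)p_{X_2|U}(x_2|u)\,|u,x_1,x_2\rangle\langle u,x_1,x_2|\otimes(\Gamma_{B\to\bar BZ_1Z_2}\circ\mathcal{N}_{A_1A_2\to B})(\theta^{x_1}_{A_1}\otimes\varphi^{x_2}_{A_2}). \] Then the capacity region with classical feedback satisfies $\mathcal{C}_{\text{cl-fb}}(\mathcal{N})\supseteq\mathcal{R}_{\mathrm{QCL}}(\mathcal{N})$.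
   Context: A quantum instrument $\Gamma_{B\to\bar BZ}$ is a channel of the form $\Gamma(\rho)=\sum_z\Gamma_z(\rho)\otimes|z\rangle\langle z|_Z$ with $\{\Gamma_z\}$ completely positive trace-non-increasing maps summing to a trace-preserving map; here the outcome is a pair $z=(z_1,z_2)$ stored in classical registers $Z_1,Z_2$, and $\bar B$ is the post-measurement system. Mutual informations are quantum (von Neumann) mutual informations; those involving only classical registers reduce to classical mutual informations of the induced joint distribution. Code with classical feedback: a $(2^{nR_1},2^{nR_2},n)$ code for $\mathcal{N}_{A_1A_2\to B}$ consists of: message sets $\mathcal{M}_k=[1:2^{nR_k}]$, $k=1,2$; for each $k$ and $i\in[1:n]$ an encoding map $\mathcal{F}^{(k,i)}:\mathcal{M}_k\times\mathcal{Z}_k^{i-1}\to\mathfrak{D}(\mathcal{H}_{A_k}^{\otimes i})$ (strictly causal in the feedback) that is backward compatible, i.e. $\mathrm{Tr}_{A_{k,i}}\mathcal{F}^{(k,i)}(m_k,z_k^{i-1})=\mathcal{F}^{(k,i-1)}(m_k,z_k^{i-2})$; a sequence of feedback quantum instruments $\mathcal{D}^{(i)}_{B_i\bar B^{i-1}\to\bar B^iZ_{1,i}Z_{2,i}}$ applied by the receiver at time $i$ to the channel output $B_i$ and the stored post-measurement systems $\bar B^{i-1}$, with outcome $z_{k,i}$ sent noiselessly to transmitter $k$ and available to it from time $i+1$ on; and a decoding POVM $\{\Delta_{m_1,m_2|z_1^{n-1},z_2^{n-1}}\}$ on $\mathcal{H}_{\bar B}^{\otimes(n-1)}\otimes\mathcal{H}_B$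 applied to $\bar B^{n-1}B_n$. At time $i$ the channel acts on the $i$-th inputs $A_{1,i}A_{2,i}$. The average error probability is the probability, with messages uniform and feedback outcomes distributed according to the Born rule, that the decoded pair differs from $(m_1,m_2)$. A rate pair $(R_1,R_2)$ is achievable if for every $\varepsilon,\delta>0$ and all sufficiently large $n$ there is a $(2^{n(R_1-\delta)},2^{n(R_2-\delta)},n)$ code with average error probability at most $\varepsilon$. The capacity region $\mathcal{C}_{\text{cl-fb}}(\mathcal{N})$ is the closure of the set of achievable rate pairs. *)

(* Defs.v *)
From HB Require Import structures.
From mathcomp Require Import all_boot all_order all_algebra.
From mathcomp Require Import complex.
From mathcomp Require Import all_classical all_reals all_analysis.

Set Implicit Arguments.
Unset Strict Implicit.
Unset Printing Implicit Defensive.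

Import Order.TTheory GRing.Theory Num.Theory.
Import numFieldNormedType.Exports.
Local Open Scope ring_scope.

(* Scalars are C := R[i] for an         *)
(* arbitrary R : realType.  A finite-dimensional quantum system is a finite   *)
(* type I (an orthonormal basis), H = C^I; composite systems are product      *)
(* types.  Operators on H are op R I = I -> I -> C (matrix entries).          *)
(* Logarithms are base 2 (rates in bits, messages 2^{nR}).                    *)

Definition op (R : realType) (I : finType) := I -> I -> R[i].

Definition psd (R : realType) (I : finType) (X : op R I) : Prop :=
  forall v : I -> R[i], 0 <= \sum_i \sum_j conjc (v i) * X i j * v j.

Definition trace (R : realType) (I : finType) (X : op R I) : R[i] :=
  \sum_i X i i.

Definition qdensity (R : realType) (I : finType) (X : op R I) : Prop :=
  psd X /\ trace X = 1.

Definition tens (R : realType) (I J : finType) (X : op R I) (Y : op R J)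
  : op R (I * J)%type := fun a b => X a.1 b.1 * Y a.2 b.2.

Definition trR (R : realType) (I J : finType) (X : op R (I * J)%type) : op R I :=
  fun i i' => \sum_j X (i, j) (i', j).
Definition trL (R : realType) (I J : finType) (X : op R (I * J)%type) : op R J :=
  fun j j' => \sum_i X (i, j) (i, j').

Definition linear_map (R : realType) (I J : finType) (F : op R I -> op R J)
  : Prop :=
  forall (c : R[i]) (X Y : op R I),
    F (fun i i' => c * X i i' + Y i i') = (fun j j' => c * F X j j' + F Y j j').

Definition idL (R : realType) (K I J : finType) (F : op R I -> op R J)
  (X : op R (K * I)%type) : op R (K * J)%type :=
  fun a b => F (fun i i' => X (a.1, i) (b.1, i')) a.2 b.2.

Definition idR (R : realType) (I J K : finType) (F : op R I -> op R J)
  (X : op R (I * K)%type) : op R (J * K)%type :=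
  fun a b => F (fun i i' => X (i, a.2) (i', b.2)) a.1 b.1.

Definition positive_map (R : realType) (I J : finType) (F : op R I -> op R J)
  : Prop := forall X, psd X -> psd (F X).

Definition completely_positive (R : realType) (I J : finType)
  (F : op R I -> op R J) : Prop :=
  linear_map F /\ forall k : nat, positive_map (@idL R 'I_k I J F).

Definition trace_preserving (R : realType) (I J : finType)
  (F : op R I -> op R J) : Prop := forall X, trace (F X) = trace X.

Definition trace_nonincreasing (R : realType) (I J : finType)
  (F : op R I -> op R J) : Prop := forall X, psd X -> trace (F X) <= trace X.

Definition qchannel (R : realType) (I J : finType) (F : op R I -> op R J)
  : Prop := completely_positive F /\ trace_preserving F.

Definition qinstrument (R : realType) (Z I J : finType)
  (G : Z -> op R I -> op R J) : Prop :=
  (forall z, completely_positive (G z) /\ trace_nonincreasing (G z)) /\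
  trace_preserving (fun X j j' => \sum_z G z X j j').

Definition povm (R : realType) (K I : finType) (D : K -> op R I) : Prop :=
  (forall k, psd (D k)) /\ forall i i', \sum_k D k i i' = (i == i')%:R.

(* eigenvalues (with multiplicity) of the matrix of X in the basis I, via the
   spectral decomposition of MathComp's spectral.v (X is normal for states) *)
Definition spectrum (R : realType) (I : finType) (X : op R I) : 'rV[R[i]]_#|I| :=
  spectral_diag (\matrix_(i, j < #|I|) X (enum_val i) (enum_val j)).

Definition log2 (R : realType) (x : R) : R := ln x / ln 2.

(* von Neumann entropy  S(X) = - sum_lambda lambda log2 lambda  (0 log 0 = 0) *)
Definition vnS (R : realType) (I : finType) (X : op R I) : R :=
  - \sum_(k < #|I|) (complex.Re (spectrum X 0 k) *
                     log2 (complex.Re (spectrum X 0 k))).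

Definition qMI (R : realType) (I J : finType) (X : op R (I * J)%type) : R :=
  vnS (trR X) + vnS (trL X) - vnS X.

Definition shannon (R : realType) (T : finType) (P : T -> R) : R :=
  - \sum_t P t * log2 (P t).

Definition marg (R : realType) (T S : finType) (f : T -> S) (P : T -> R)
  : S -> R := fun s => \sum_(t | f t == s) P t.

Definition cCMI (R : realType) (T SX SY SW : finType) (P : T -> R)
  (fX : T -> SX) (fY : T -> SY) (fW : T -> SW) : R :=
  shannon (marg (fun t => (fX t, fW t)) P) + shannon (marg (fun t => (fY t, fW t)) P)
  - shannon (marg fW P) - shannon (marg (fun t => (fX t, fY t, fW t)) P).

Definition is_pmf (R : realType) (T : finType) (p : T -> R) : Prop :=
  (forall t, 0 <= p t) /\ \sum_t p t = 1.

Definition qcl_pmf (R : realType) (A1 A2 B Bb U X1 X2 Z1 Z2 : finType)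
  (N : op R (A1 * A2)%type -> op R B) (pU : U -> R) (pX1 : U -> X1 -> R)
  (pX2 : U -> X2 -> R) (th : X1 -> op R A1) (ph : X2 -> op R A2)
  (G : (Z1 * Z2)%type -> op R B -> op R Bb)
  (t : (U * X1 * X2 * Z1 * Z2)%type) : R :=
  let: (u, x1, x2, z1, z2) := t in
  pU u * pX1 u x1 * pX2 u x2 *
  complex.Re (trace (G (z1, z2) (N (tens (th x1) (ph x2))))).

Definition qcl_omega (R : realType) (A1 A2 B Bb U X1 X2 Z1 Z2 : finType)
  (N : op R (A1 * A2)%type -> op R B) (pU : U -> R) (pX1 : U -> X1 -> R)
  (pX2 : U -> X2 -> R) (th : X1 -> op R A1) (ph : X2 -> op R A2)
  (G : (Z1 * Z2)%type -> op R B -> op R Bb)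
  : op R ((U * (X1 * X2)) * (Bb * (Z1 * Z2)))%type :=
  fun a b =>
    let: (u, (x1, x2)) := a.1 in
    ((a.1 == b.1) && (a.2.2 == b.2.2))%:R *
    ((pU u * pX1 u x1 * pX2 u x2)%:C)%C *
    G a.2.2 (N (tens (th x1) (ph x2))) a.2.1 b.2.1.

Definition qcl_omega_noU (R : realType) (A1 A2 B Bb U X1 X2 Z1 Z2 : finType)
  (N : op R (A1 * A2)%type -> op R B) (pU : U -> R) (pX1 : U -> X1 -> R)
  (pX2 : U -> X2 -> R) (th : X1 -> op R A1) (ph : X2 -> op R A2)
  (G : (Z1 * Z2)%type -> op R B -> op R Bb)
  : op R ((X1 * X2) * (Bb * (Z1 * Z2)))%type :=
  fun a b => \sum_(u : U)
    qcl_omega N pU pX1 pX2 th ph G ((u, a.1), a.2) ((u, b.1), b.2).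

Definition qcl_rates (R : realType) (A1 A2 B Bb U X1 X2 Z1 Z2 : finType)
  (N : op R (A1 * A2)%type -> op R B) (pU : U -> R) (pX1 : U -> X1 -> R)
  (pX2 : U -> X2 -> R) (th : X1 -> op R A1) (ph : X2 -> op R A2)
  (G : (Z1 * Z2)%type -> op R B -> op R Bb) (R1 R2 : R) : Prop :=
  let P := qcl_pmf N pU pX1 pX2 th ph G in
  (R1 <= cCMI P (fun t : (U * X1 * X2 * Z1 * Z2)%type => t.1.1.1.2)  (* X1 *)
                   (fun t => t.2)                                (* Z2 *)
                   (fun t => (t.1.1.1.1, t.1.1.2))) /\          (* U X2 *)
      (R2 <= cCMI P (fun t : (U * X1 * X2 * Z1 * Z2)%type => t.1.1.2)    (* X2 *)
                   (fun t => t.1.2)                              (* Z1 *)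
                   (fun t => (t.1.1.1.1, t.1.1.1.2))) /\           (* U X1 *)
      (R1 + R2 <= qMI (qcl_omega_noU N pU pX1 pX2 th ph G)).

Definition snoc (A : finType) (t : nat) (a : {ffun 'I_t -> A}) (x : A)
  : {ffun 'I_t.+1 -> A} :=
  [ffun j => if unlift ord_max j is Some j' then a j' else x].
Definition tcons (A : finType) (t : nat) (x : A) (a : {ffun 'I_t -> A})
  : {ffun 'I_t.+1 -> A} :=
  [ffun j => if unlift ord0 j is Some j' then a j' else x].
Definition restr (Z : finType) (t : nat) (z : {ffun 'I_t.+1 -> Z})
  : {ffun 'I_t -> Z} := [ffun j => z (widen_ord (leqnSn t) j)].

Definition trlast (R : realType) (A : finType) (t : nat)
  (X : op R {ffun 'I_t.+1 -> A}) : op R {ffun 'I_t -> A} :=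
  fun a a' => \sum_x X (snoc a x) (snoc a' x).

(* n-fold tensor power of a linear map, as the linear extension of its action
   on product operators (expansion in matrix units) *)
Definition unitop (R : realType) (I : finType) (i i' : I) : op R I :=
  fun x y => ((x == i) && (y == i'))%:R.
Definition tpow_map (R : realType) (I J : finType) (n : nat)
  (F : op R I -> op R J) (X : op R {ffun 'I_n -> I}) : op R {ffun 'I_n -> J} :=
  fun b b' => \sum_a \sum_a' X a a' *
     \prod_(t < n) F (unitop R (a t) (a' t)) (b t) (b' t).

Definition join_inputs (R : realType) (A1 A2 : finType) (n : nat)
  (X1 : op R {ffun 'I_n -> A1}) (X2 : op R {ffun 'I_n -> A2})
  : op R {ffun 'I_n -> (A1 * A2)%type} :=
  fun a a' => X1 [ffun t => (a t).1] [ffun t => (a' t).1] *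
              X2 [ffun t => (a t).2] [ffun t => (a' t).2].

(* A code of block length n'.+1 (n' = number of feedback rounds) with message
   sets 'I_M1, 'I_M2, post-measurement system Bb and feedback alphabets Z1 Z2.
   Times are 0-based: at time t the encoders hold feedback z^t (t outcomes)
   and their state lives on A^{t+1}; the instrument at time t < n' acts on
   B_t Bb^t and outputs Bb^{t+1} and (z1_t, z2_t). *)
Record fb_code (R : realType) (A1 A2 B Bb Z1 Z2 : finType) (n' M1 M2 : nat) :=
  FbCode {
    enc1 : forall t : nat, 'I_M1 -> {ffun 'I_t -> Z1} -> op R {ffun 'I_t.+1 -> A1};
    enc2 : forall t : nat, 'I_M2 -> {ffun 'I_t -> Z2} -> op R {ffun 'I_t.+1 -> A2};
    inst : forall t : nat, (Z1 * Z2)%type ->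
             op R (B * {ffun 'I_t -> Bb})%type -> op R {ffun 'I_t.+1 -> Bb};
    dec : ('I_M1 * 'I_M2)%type -> {ffun 'I_n' -> Z1} -> {ffun 'I_n' -> Z2} ->
            op R ({ffun 'I_n' -> Bb} * B)%type
  }.

Arguments enc1 {R A1 A2 B Bb Z1 Z2 n' M1 M2} f t.
Arguments enc2 {R A1 A2 B Bb Z1 Z2 n' M1 M2} f t.
Arguments inst {R A1 A2 B Bb Z1 Z2 n' M1 M2} f t.
Arguments dec {R A1 A2 B Bb Z1 Z2 n' M1 M2} f.

Definition is_fb_code (R : realType) (A1 A2 B Bb Z1 Z2 : finType) (n' M1 M2 : nat)
  (c : fb_code R A1 A2 B Bb Z1 Z2 n' M1 M2) : Prop :=
  (forall t m z, (t <= n')%N -> qdensity (enc1 c t m z)) /\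
  (forall t m z, (t <= n')%N -> qdensity (enc2 c t m z)) /\
  (forall t m z, (t < n')%N -> trlast (enc1 c t.+1 m z) = enc1 c t m (restr z)) /\
  (forall t m z, (t < n')%N -> trlast (enc2 c t.+1 m z) = enc2 c t m (restr z)) /\
  (forall t, (t < n')%N -> qinstrument (inst c t)) /\
  (forall z1 z2, povm (fun m => dec c m z1 z2)).

Definition rstep (R : realType) (B Bb : finType) (t k : nat)
  (D : op R (B * {ffun 'I_t -> Bb})%type -> op R {ffun 'I_t.+1 -> Bb})
  (X : op R ({ffun 'I_t -> Bb} * {ffun 'I_k.+1 -> B})%type)
  : op R ({ffun 'I_t.+1 -> Bb} * {ffun 'I_k -> B})%type :=
  idR D (fun (a b : (B * {ffun 'I_t -> Bb}) * {ffun 'I_k -> B}) =>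
           X (a.1.2, tcons a.1.1 a.2) (b.1.2, tcons b.1.1 b.2)).

(* apply successively the instrument branches selected by the outcome list zs
   to the memory and the channel outputs, until only the last output B is left:
   the result is the (unnormalised) post-measurement state on Bb^{t+k} B *)
Fixpoint run (R : realType) (B Bb Z : finType)
  (D : forall t : nat, Z -> op R (B * {ffun 'I_t -> Bb})%type ->
                         op R {ffun 'I_t.+1 -> Bb})
  (k : nat) : forall t : nat, seq Z ->
      op R ({ffun 'I_t -> Bb} * {ffun 'I_k.+1 -> B})%type ->
      op R ({ffun 'I_(t + k) -> Bb} * B)%type :=
  match k return forall t : nat, seq Z ->
      op R ({ffun 'I_t -> Bb} * {ffun 'I_k.+1 -> B})%type ->
      op R ({ffun 'I_(t + k) -> Bb} * B)%type with
  | 0 => fun t zs X =>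
      ecast j (op R ({ffun 'I_j -> Bb} * B)%type) (esym (addn0 t))
        (fun a b => X (a.1, [ffun _ => a.2]) (b.1, [ffun _ => b.2]))
  | k'.+1 => fun t zs X =>
      match zs with
      | z :: zs' =>
          ecast j (op R ({ffun 'I_j -> Bb} * B)%type) (addSnnS t k')
            (@run R B Bb Z D k' t.+1 zs' (rstep (D t z) X))
      | [::] => fun _ _ => 0
      end
  end.

Definition fb_prob (R : realType) (A1 A2 B Bb Z1 Z2 : finType) (n' M1 M2 : nat)
  (N : op R (A1 * A2)%type -> op R B) (c : fb_code R A1 A2 B Bb Z1 Z2 n' M1 M2)
  (m mh : ('I_M1 * 'I_M2)%type) (z1 : {ffun 'I_n' -> Z1}) (z2 : {ffun 'I_n' -> Z2})
  : R :=
  let rho_in : op R {ffun 'I_n'.+1 -> B} :=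
    tpow_map N (join_inputs (enc1 c n' m.1 z1) (enc2 c n' m.2 z2)) in
  let zs := [seq (z1 t, z2 t) | t <- enum 'I_n'] in
  let sigma : op R ({ffun 'I_(0 + n') -> Bb} * B)%type :=
    @run R B Bb (Z1 * Z2)%type (inst c) n' 0 zs (fun a b => rho_in a.2 b.2) in
  complex.Re (\sum_a \sum_b dec c mh z1 z2 a b * sigma b a).

Definition fb_error (R : realType) (A1 A2 B Bb Z1 Z2 : finType) (n' M1 M2 : nat)
  (N : op R (A1 * A2)%type -> op R B) (c : fb_code R A1 A2 B Bb Z1 Z2 n' M1 M2)
  : R :=
  (M1 * M2)%:R^-1 * \sum_(m : ('I_M1 * 'I_M2)%type) \sum_z1 \sum_z2
     \sum_(mh | mh != m) fb_prob N c m mh z1 z2.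

Definition msize (R : realType) (n : nat) (r : R) : nat :=
  `|Num.ceil (2 `^ (n%:R * r))|%N.

Definition fb_achievable (R : realType) (A1 A2 B : finType)
  (N : op R (A1 * A2)%type -> op R B) (R1 R2 : R) : Prop :=
  forall eps delta : R, 0 < eps -> 0 < delta ->
  exists N0 : nat, forall n' : nat, (N0 <= n'.+1)%N ->
    exists (Bb Z1 Z2 : finType)
      (c : fb_code R A1 A2 B Bb Z1 Z2 n' (msize n'.+1 (R1 - delta))
                                         (msize n'.+1 (R2 - delta))),
      is_fb_code c /\ fb_error N c <= eps.

Definition cap_region_fb (R : realType) (A1 A2 B : finType)
  (N : op R (A1 * A2)%type -> op R B) : set (R * R)%type :=
  closure [set p : (R * R)%type | fb_achievable N p.1 p.2].

(* Main.v *)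
Require Import Defs.
From HB Require Import structures.
From mathcomp Require Import all_boot all_order all_algebra.
From mathcomp Require Import complex.
From mathcomp Require Import all_classical all_reals all_analysis.
From mathcomp Require Import ring lra.
Set Implicit Arguments.
Unset Strict Implicit.
Unset Printing Implicit Defensive.
Import Order.TTheory GRing.Theory Num.Theory.
Import numFieldNormedType.Exports.
Local Open Scope ring_scope.

(* Block Markov superposition coding with backward decoding.  In each block the
   codeword for [U] carries the pair of messages of the previous block, and the
   codewords for [X1], [X2] carry fresh messages on top of it.  The receiver
   applies the instrument to every channel output and feeds the outcomes back;
   after a block transmitter 2 decodes the fresh message of transmitter 1 from
   [Z2] given [U], [X2], and symmetrically, so both know the pair needed for the
   next [U]-codeword.  The receiver works backwards: knowing the fresh messages
   of a block, it only has to identify the pair indexing the [U]-codeword, which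
   is a point-to-point packing problem for the classical-quantum channel from
   [X1 X2] to the post-measurement system and the outcomes.

   That packing uses sequential projective measurements on typical subspaces,
   analysed with Gao's non-commutative union bound; typicality is only a
   one-sided condition on products of eigenvalues, so exponential tail bounds
   suffice.  The codebook is random and is fixed at the end by averaging. *)

(** * Sums over product alphabets and an exponential tail bound *)

(** The sum-rate bound carries no conditioning on [U] because every key owns an independent cluster
    of codewords: a wrong key yields an input pair independent of the sent one, drawn from the
    [U]-averaged law.

    The main obstacle is that feedback makes the inputs depend on the measurement outcomes, so the
    state held by the receiver is not a product. The actual run is therefore compared with one whose
    inputs depend on the messages alone. There the outcomes can be summed out, provided that the
    final measurement does not depend on them; this is why the outcomes are copied into the memory.

    One codebook serves all blocks. This is harmless, since the mean error is bounded for each pair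
    of key and fresh messages and only linearity of the mean is used.

    A wrong key may still agree with the true one in one component, and rates may be negative. The
    individual feedback informations must then be compared with the sum-rate information; this data
    processing inequality is derived from overlaps of eigenvectors.

    The number of blocks depends only on the rates and the allowed rate loss; the block length
    grows. Informations are in nats until the very end. *)

Lemma sum_ffun_prod (K : comNzRingType) (I J : finType) (F : I -> J -> K) :
  \sum_(f : {ffun I -> J}) \prod_i F i (f i) = \prod_i \sum_j F i j.
Proof. by rewrite bigA_distr_bigA. Qed.

Lemma sum_ffun_at_dep (K : comNzRingType) (I T : finType) (P : I -> T -> K)
  (P1 : forall i, \sum_t P i t = 1) (i0 : I) (g : T -> K) :
  \sum_(f : {ffun I -> T}) (\prod_i P i (f i)) * g (f i0) = \sum_t P i0 t * g t.
Proof.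
pose F i t := if i == i0 then P i t * g t else P i t.
transitivity (\sum_(f : {ffun I -> T}) \prod_i F i (f i)).
  apply: eq_bigr => f _; rewrite (bigD1 i0) //= [RHS](bigD1 i0) //= /F eqxx mulrAC.
  by congr (_ * _); apply: eq_bigr => i /negbTE ->.
rewrite sum_ffun_prod (bigD1 i0) //= /F eqxx [X in _ * X]big1 ?mulr1 // => i /negbTE ->.
exact: P1.
Qed.

Lemma sum_ffun_at (K : comNzRingType) (I T : finType) (P : T -> K)
  (P1 : \sum_t P t = 1) (i0 : I) (g : T -> K) :
  \sum_(f : {ffun I -> T}) (\prod_i P (f i)) * g (f i0) = \sum_t P t * g t.
Proof. exact: (sum_ffun_at_dep (P := fun=> P)). Qed.

(** Fixing the value at [i1] by an indicator leaves a product over the positions, so the sum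
    factorises. This is the pairwise independence of i.i.d. codewords. *)
Lemma sum_ffun_at2 (K : comNzRingType) (I T : finType) (P : T -> K)
  (P1 : \sum_t P t = 1) (i0 i1 : I) (g : T -> T -> K) : i0 != i1 ->
  \sum_(f : {ffun I -> T}) (\prod_i P (f i)) * g (f i0) (f i1) =
  \sum_s \sum_t P s * P t * g s t.
Proof.
move=> ne01; rewrite exchange_big /=.
transitivity (\sum_t \sum_(f : {ffun I -> T})
   (\prod_i P (f i)) * g (f i0) t * (f i1 == t)%:R).
  rewrite exchange_big /=; apply: eq_bigr => f _.
  rewrite (bigD1 (f i1)) //= eqxx mulr1 [X in _ + X]big1 ?addr0 // => t.
  by rewrite eq_sym => /negbTE ->; rewrite mulr0.
apply: eq_bigr => t _.
pose F i s := if i == i0 then P s * g s t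
              else if i == i1 then P s * (s == t)%:R else P s.
transitivity (\sum_(f : {ffun I -> T}) \prod_i F i (f i)).
  apply: eq_bigr => f _; rewrite (bigD1 i0) //= (bigD1 i1) /=; last by rewrite eq_sym.
  rewrite [RHS](bigD1 i0) //= [X in _ = _ * X](bigD1 i1) /=; last by rewrite eq_sym.
  rewrite /F !eqxx [i1 == i0]eq_sym (negbTE ne01).
  rewrite [in RHS](eq_bigr (fun i => P (f i))); first by ring.
  by move=> i /andP[/negbTE -> /negbTE ->].
rewrite sum_ffun_prod (bigD1 i0) //= (bigD1 i1) /=; last by rewrite eq_sym.
rewrite /F !eqxx [i1 == i0]eq_sym (negbTE ne01) [X in _ * (_ * X)]big1 ?mulr1; last first.
  by move=> i /andP[/negbTE -> /negbTE ->].
rewrite [X in _ * X](bigD1 t) //= eqxx mulr1 [X in _ * (_ + X)]big1; last first.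
  by move=> s /negbTE ->; rewrite mulr0.
by rewrite addr0 mulr_suml; apply: eq_bigr => s _; rewrite mulrAC.
Qed.

Lemma sum_ffun_pair (K : comNzRingType) (I A B : finType)
  (F : {ffun I -> A} -> {ffun I -> B} -> K) :
  \sum_(f : {ffun I -> (A * B)%type})
     F [ffun i => (f i).1] [ffun i => (f i).2] = \sum_a \sum_b F a b.
Proof.
rewrite pair_big /=.
pose h (p : {ffun I -> A} * {ffun I -> B}) : {ffun I -> A * B} :=
  [ffun i => (p.1 i, p.2 i)].
rewrite (reindex h) /=; last first.
  exists (fun f => ([ffun i => (f i).1], [ffun i => (f i).2])) => [[a b] _|f _].
    by congr (_, _); apply/ffunP => i; rewrite !ffunE.
  by apply/ffunP => i; rewrite !ffunE; case: (f i).
apply: eq_bigr => -[a b] _ /=.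
by congr (F _ _); apply/ffunP => i; rewrite !ffunE.
Qed.

(* [1 / (1 - x) <= 1 + x + 2 x^2] on this range, also for negative [x]. *)
Lemma expR_le_quad (R : realType) (x : R) :
  x <= 2^-1 -> expR x <= 1 + x + 2 * x ^+ 2.
Proof.
move=> x2; have x1 : 0 < 1 - x by lra.
have e1 : 1 - x <= expR (- x) by have := expR_ge1Dx (- x); lra.
rewrite -[expR x]invrK -expRN.
apply: (le_trans (y := (1 - x)^-1)); first by rewrite lef_pV2 ?posrE ?expR_gt0.
rewrite -div1r ler_pdivrMr //.
have -> : (1 + x + 2 * x ^+ 2) * (1 - x) = 1 + x ^+ 2 * (1 - 2 * x) by ring.
by rewrite lerDl mulr_ge0 ?sqr_ge0 //; lra.
Qed.

(** As a function of [s] the sum is 1 at [s = 0] with slope [- eta]; the quadratic bound on the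
    exponential keeps it below 1 for a small explicit [s]. *)
Lemma chernoff (R : realType) (T : finType) (P g : T -> R) (mu eta : R) :
  is_pmf P -> \sum_t P t * g t = mu -> 0 < eta ->
  exists s, 0 < s /\ \sum_t P t * expR (s * (g t - mu - eta)) < 1.
Proof.
move=> [P0 P1] gmu eta0.
pose h t := g t - mu - eta.
pose B := 1 + \sum_t `|h t|.
have hB t : `|h t| <= B.
  rewrite /B (bigD1 t) //= addrCA lerDl addr_ge0 ?sumr_ge0 // => i _; exact: normr_ge0.
have B0 : 0 < B by rewrite /B ltr_wpDr // sumr_ge0.
have Ph : \sum_t P t * h t = - eta.
  under eq_bigr do rewrite /h !mulrBr; rewrite !sumrB gmu -!mulr_suml P1; ring.
have etaB : eta <= B.
  have -> : eta = - \sum_t P t * h t by rewrite Ph opprK.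
  rewrite -sumrN -[B]mul1r -P1 mulr_suml; apply: ler_sum => t _.
  rewrite -mulrN ler_wpM2l // (le_trans _ (hB t)) // -normrN ler_norm //.
(* Minimiser of [- s * eta + 2 * (s * B) ^+ 2], where the value is [- eta ^+ 2 / (8 * B ^+ 2)];
   [eta <= B] keeps [s * B] within the range of [expR_le_quad]. *)
exists (eta / (4 * B ^+ 2)).
set s := eta / (4 * B ^+ 2).
have s0 : 0 < s by rewrite divr_gt0 // mulr_gt0 // exprn_gt0.
have sB : s * B = eta / (4 * B) by rewrite /s; field; rewrite gt_eqF.
have sB2 : s * B <= 2^-1.
  rewrite sB ler_pdivrMr ?mulr_gt0 //; lra.
split=> //.
apply: (@le_lt_trans _ _ (\sum_t (P t + s * (P t * h t) + P t * (2 * (s * B) ^+ 2)))).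
  apply: ler_sum => t _; rewrite -/(h t).
  have -> : P t + s * (P t * h t) + P t * (2 * (s * B) ^+ 2) =
            P t * (1 + s * h t + 2 * (s * B) ^+ 2) by ring.
  apply: ler_wpM2l => //; apply: (le_trans (expR_le_quad _)).
    apply: le_trans sB2; rewrite ler_pM2l // (le_trans _ (hB t)) // ler_norm //.
  rewrite lerD2l ler_pM2l // -[(s * h t) ^+ 2]real_normK ?num_real //.
  rewrite normrM (gtr0_norm s0) ler_sqr ?nnegrE; first by rewrite ler_pM2l.
    by apply: mulr_ge0 => //; exact: ltW.
  by apply: mulr_ge0; exact: ltW.
rewrite !big_split /= -mulr_sumr -mulr_suml P1 Ph mul1r.
rewrite -addrA gtrDl.
have -> : s * - eta + 2 * (s * B) ^+ 2 = - (eta ^+ 2 / (8 * B ^+ 2)).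
  by rewrite /s; field; rewrite gt_eqF.
by rewrite oppr_lt0 divr_gt0 // ?mulr_gt0 // exprn_gt0.
Qed.

(** * Operators, orthonormal bases and spectra *)

Lemma conjC_conjc (R : realType) (z : R[i]) : Num.conj z = conjc z.
Proof.
have [->|z0] := eqVneq z 0; first by rewrite rmorph0 conjc0.
by apply: (mulfI z0); rewrite -normCK sqr_normc.
Qed.

Lemma conjcM (R : realType) (x y : R[i]) : conjc (x * y) = conjc x * conjc y.
Proof. exact: rmorphM. Qed.

Lemma conjcD (R : realType) (x y : R[i]) : conjc (x + y) = conjc x + conjc y.
Proof. exact: rmorphD. Qed.

Lemma conjc_sum (R : realType) (I : finType) (P : pred I) (F : I -> R[i]) :
  conjc (\sum_(i | P i) F i) = \sum_(i | P i) conjc (F i).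
Proof. exact: rmorph_sum. Qed.

Lemma conjc_prod (R : realType) (I : finType) (F : I -> R[i]) :
  conjc (\prod_i F i) = \prod_i conjc (F i).
Proof. exact: rmorph_prod. Qed.

Lemma ReD (R : realType) (x y : R[i]) :
  complex.Re (x + y) = complex.Re x + complex.Re y.
Proof. by case: x; case: y. Qed.

Lemma ReN (R : realType) (x : R[i]) : complex.Re (- x) = - complex.Re x.
Proof. by case: x. Qed.

Lemma ReB (R : realType) (x y : R[i]) :
  complex.Re (x - y) = complex.Re x - complex.Re y.
Proof. by rewrite ReD ReN. Qed.

Lemma Re_sum (R : realType) (I : Type) (r : seq I) (P : pred I) (F : I -> R[i]) :
  complex.Re (\sum_(i <- r | P i) F i) = \sum_(i <- r | P i) complex.Re (F i).
Proof. by apply: (big_morph _ (@ReD R)). Qed.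

Lemma ReZ (R : realType) (a : R) (z : R[i]) :
  complex.Re ((a%:C)%C * z) = a * complex.Re z.
Proof. by case: z => x y /=; rewrite mul0r subr0. Qed.

Lemma ReK (R : realType) (z : R[i]) : 0 <= z -> ((complex.Re z)%:C)%C = z.
Proof. by move=> z0; rewrite RRe_real // ger0_real. Qed.

Lemma Re_ge0 (R : realType) (z : R[i]) : 0 <= z -> 0 <= complex.Re z.
Proof. by rewrite lecE => /andP[]. Qed.

Lemma rc_sum (R : realType) (I : finType) (P : pred I) (F : I -> R) :
  ((\sum_(i | P i) F i)%:C = \sum_(i | P i) (F i)%:C)%C.
Proof. exact: rmorph_sum. Qed.

Lemma rc_prod (R : realType) (I : finType) (F : I -> R) :
  ((\prod_i F i)%:C = \prod_i (F i)%:C)%C.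
Proof. exact: rmorph_prod. Qed.

Lemma rcB (R : realType) (x y : R) : ((x - y)%:C = x%:C - y%:C)%C.
Proof. exact: rmorphB. Qed.

Lemma rcM (R : realType) (x y : R) : ((x * y)%:C = x%:C * y%:C)%C.
Proof. exact: rmorphM. Qed.

Definition sqn (R : realType) (z : R[i]) : R := complex.Re (conjc z * z).

Lemma sqnE (R : realType) (z : R[i]) : ((sqn z)%:C)%C = conjc z * z.
Proof. by rewrite ReK // mulrC mulcJ_ge0. Qed.

Lemma sqn_ge0 (R : realType) (z : R[i]) : 0 <= sqn z.
Proof. by rewrite Re_ge0 // mulrC mulcJ_ge0. Qed.

Lemma sqn_conj (R : realType) (z : R[i]) : sqn (conjc z) = sqn z.
Proof. by rewrite /sqn conjcK mulrC. Qed.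

Definition dot (R : realType) (I : finType) (v w : I -> R[i]) : R[i] :=
  \sum_i conjc (v i) * w i.

Definition nrm2 (R : realType) (I : finType) (v : I -> R[i]) : R :=
  \sum_i sqn (v i).

Definition onb (R : realType) (I : finType) (w : I -> I -> R[i]) : Prop :=
  (forall k l, dot (w k) (w l) = (k == l)%:R) /\
  (forall i j, \sum_k w k i * conjc (w k j) = (i == j)%:R).

(** A relation instead of a chosen spectrum: products, direct sums and relabelings of
    eigendecompositions are again eigendecompositions, so the spectra of composite operators come
    explicitly. *)
Definition eigdec (R : realType) (I : finType) (X : op R I)
  (w : I -> I -> R[i]) (lam : I -> R) : Prop :=
  onb w /\ forall i j, X i j = \sum_k ((lam k)%:C)%C * (w k i * conjc (w k j)).

Definition app (R : realType) (I : finType) (X : op R I) (v : I -> R[i])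
  : I -> R[i] := fun i => \sum_j X i j * v j.

Section Vectors.
Context {R : realType} {I : finType}.
Implicit Types (v w : I -> R[i]) (X : op R I).

Lemma dot_conj v w : dot w v = conjc (dot v w).
Proof. by rewrite conjc_sum; apply: eq_bigr => i _; rewrite conjcM conjcK mulrC. Qed.

Lemma dot_self v : dot v v = ((nrm2 v)%:C)%C.
Proof. by rewrite rc_sum; apply: eq_bigr => i _; rewrite sqnE. Qed.

Lemma nrm2_ge0 v : 0 <= nrm2 v.
Proof. by rewrite sumr_ge0 // => i _; apply: sqn_ge0. Qed.

Lemma dot_sumr (T : finType) (P : pred T) v (w : T -> I -> R[i]) :
  dot v (fun i => \sum_(t | P t) w t i) = \sum_(t | P t) dot v (w t).
Proof. by rewrite exchange_big; apply: eq_bigr => i _; rewrite mulr_sumr. Qed.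

Lemma dotZr v (c : R[i]) w : dot v (fun i => c * w i) = c * dot v w.
Proof. by rewrite mulr_sumr; apply: eq_bigr => i _; rewrite mulrCA. Qed.

Lemma dotDr v w w' : dot v (fun i => w i + w' i) = dot v w + dot v w'.
Proof. by rewrite -big_split; apply: eq_bigr => i _; rewrite mulrDr. Qed.

Lemma eq_dot v v' w w' : v =1 v' -> w =1 w' -> dot v w = dot v' w'.
Proof. by move=> ev ew; apply: eq_bigr => i _; rewrite ev ew. Qed.

Lemma onb_expand (w : I -> I -> R[i]) v i : onb w ->
  v i = \sum_k dot (w k) v * w k i.
Proof.
move=> [_ wc]; transitivity (\sum_j (i == j)%:R * v j).
  by rewrite (bigD1 i) //= eqxx mul1r big1 ?addr0 // => j; rewrite eq_sym => /negbTE ->; rewrite mul0r.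
transitivity (\sum_j \sum_k w k i * conjc (w k j) * v j).
  by apply: eq_bigr => j _; rewrite -wc mulr_suml.
rewrite exchange_big; apply: eq_bigr => k _; rewrite /dot mulr_suml.
by apply: eq_bigr => j _; rewrite [RHS]mulrC mulrA.
Qed.

Lemma onb_dot (w : I -> I -> R[i]) v v' : onb w ->
  dot v v' = \sum_k conjc (dot (w k) v) * dot (w k) v'.
Proof.
move=> ow; transitivity (dot v (fun i => \sum_k dot (w k) v' * w k i)).
  by apply: eq_dot => // i; exact: onb_expand.
rewrite dot_sumr; apply: eq_bigr => k _.
by rewrite dotZr -dot_conj mulrC.
Qed.

Lemma parseval (w : I -> I -> R[i]) v : onb w ->
  nrm2 v = \sum_k sqn (dot (w k) v).
Proof.
move=> ow; apply: (@complexI R); rewrite -dot_self (onb_dot _ _ ow) rc_sum.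
by apply: eq_bigr => k _; rewrite -sqnE.
Qed.

Lemma onb_nrm2 (w : I -> I -> R[i]) k : onb w -> nrm2 (w k) = 1.
Proof. by move=> [ow _]; apply: (@complexI R); rewrite -dot_self ow eqxx. Qed.

Lemma eigdec_quad X (w : I -> I -> R[i]) lam v : eigdec X w lam ->
  dot v (app X v) = ((\sum_k lam k * sqn (dot (w k) v))%:C)%C.
Proof.
move=> [ow Xe].
transitivity (dot v (fun i => \sum_k ((lam k)%:C)%C * dot (w k) v * w k i)).
  apply: eq_dot => // i; rewrite /app; under eq_bigr do rewrite Xe mulr_suml.
  rewrite exchange_big; apply: eq_bigr => k _ /=.
  rewrite /dot mulr_sumr mulr_suml; apply: eq_bigr => j _; ring.
rewrite dot_sumr rc_sum; apply: eq_bigr => k _.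
by rewrite dotZr rcM sqnE (dot_conj (w k) v) -mulrA [_ * conjc _]mulrC.
Qed.

Lemma eigdec_app X (w : I -> I -> R[i]) lam k i : eigdec X w lam ->
  app X (w k) i = ((lam k)%:C)%C * w k i.
Proof.
move=> [[ow wc] Xe]; rewrite /app; under eq_bigr do rewrite Xe mulr_suml.
rewrite exchange_big (bigD1 k) //= [X in _ + X]big1 ?addr0.
  transitivity (((lam k)%:C)%C * w k i * dot (w k) (w k)).
    by rewrite /dot mulr_sumr; apply: eq_bigr => j _; ring.
  by rewrite ow eqxx mulr1.
move=> l lk; transitivity (((lam l)%:C)%C * w l i * dot (w l) (w k)).
  by rewrite /dot mulr_sumr; apply: eq_bigr => j _; ring.
by rewrite ow (negbTE lk) mulr0.
Qed.

Lemma eigdec_trace X (w : I -> I -> R[i]) lam : eigdec X w lam -> trace X = ((\sum_k lam k)%:C)%C.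
Proof.
move=> [[ow wc] Xe]; rewrite /trace; under eq_bigr do rewrite Xe.
rewrite exchange_big rc_sum; apply: eq_bigr => k _; rewrite -mulr_sumr.
transitivity (((lam k)%:C)%C * dot (w k) (w k)).
  by congr (_ * _); apply: eq_bigr => i _; rewrite mulrC.
by rewrite ow eqxx mulr1.
Qed.

(** Letting [X] act on either side of [dot (w k) (app X (w' l))] multiplies the overlap by [lam k]
    or by [lam' l]. *)
Lemma eigdec_overlap X (w w' : I -> I -> R[i]) lam lam' k l : eigdec X w lam -> eigdec X w' lam' ->
  sqn (dot (w k) (w' l)) != 0 -> lam k = lam' l.
Proof.
move=> e e' nz.
have Xd : dot (w k) (app X (w' l)) = ((lam' l)%:C)%C * dot (w k) (w' l).
  by rewrite -dotZr; apply: eq_dot => // i; exact: eigdec_app.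
have Xd' : dot (w k) (app X (w' l)) = ((lam k)%:C)%C * dot (w k) (w' l).
  rewrite (onb_dot _ _ e.1) (bigD1 k) //= [X in _ + X]big1 ?addr0; last first.
    by move=> j jk; rewrite e.1.1 (negbTE jk) conjc0 mul0r.
  rewrite e.1.1 eqxx conjc1 mul1r.
  transitivity (dot (app X (w k)) (w' l)).
    rewrite /dot /app.
    under eq_bigr do rewrite mulr_sumr; under [RHS]eq_bigr do rewrite conjc_sum mulr_suml.
    rewrite exchange_big; apply: eq_bigr => i _; apply: eq_bigr => j _ /=.
    rewrite conjcM !e.2 conjc_sum mulrA; congr (_ * _); rewrite mulrC; congr (_ * _).
    by apply: eq_bigr => m _; rewrite !conjcM conjcK conjc_real [conjc _ * _]mulrC.
  rewrite (eq_dot (v' := fun i => ((lam k)%:C)%C * w k i) (w' := w' l)) //; last first.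
    by move=> i; exact: eigdec_app.
  by rewrite /dot mulr_sumr; apply: eq_bigr => i _; rewrite conjcM conjc_real mulrA.
have d0 : dot (w k) (w' l) != 0.
  by apply: contraNneq nz => ->; rewrite /sqn mulr0.
by move: Xd; rewrite Xd' => /(mulIf d0) /complexI.
Qed.

(** The squared overlaps of two orthonormal bases form a doubly stochastic matrix, supported by
    [eigdec_overlap] where the eigenvalues agree. Hence entropies may be computed from any
    eigendecomposition. *)
Lemma eigdec_sum X (w w' : I -> I -> R[i]) lam lam' (f : R -> R) : eigdec X w lam -> eigdec X w' lam' ->
  \sum_k f (lam k) = \sum_k f (lam' k).
Proof.
move=> e e'.
transitivity (\sum_k \sum_l f (lam k) * sqn (dot (w k) (w' l))).
  apply: eq_bigr => k _; rewrite -mulr_sumr.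
  under eq_bigr do rewrite dot_conj sqn_conj.
  by rewrite -(parseval _ e'.1) (onb_nrm2 _ e.1) mulr1.
rewrite exchange_big; apply: eq_bigr => l _.
transitivity (\sum_k f (lam' l) * sqn (dot (w k) (w' l))).
  apply: eq_bigr => k _; have [->|nz] := eqVneq (sqn (dot (w k) (w' l))) 0.
    by rewrite !mulr0.
  by rewrite (eigdec_overlap e e' nz).
by rewrite -mulr_sumr -(parseval _ e.1) (onb_nrm2 _ e'.1) mulr1.
Qed.

Lemma psdP X : psd X <-> forall v, 0 <= dot v (app X v).
Proof.
split=> h v; have := h v; congr (0 <= _); apply: eq_bigr => i _;
  by rewrite /app mulr_sumr; apply: eq_bigr => j _; rewrite mulrA.
Qed.

Lemma eigdec_psd X (w : I -> I -> R[i]) lam : eigdec X w lam -> (forall k, 0 <= lam k) -> psd X.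
Proof.
move=> e l0; apply/psdP => v; rewrite (eigdec_quad _ e) ler0c sumr_ge0 // => k _.
by rewrite mulr_ge0 ?sqn_ge0.
Qed.

Lemma quad2 X (i j : I) (c : R[i]) : i != j ->
  dot (fun k => (k == i)%:R + c * (k == j)%:R)
      (app X (fun k => (k == i)%:R + c * (k == j)%:R)) =
  X i i + c * X i j + conjc c * X j i + conjc c * c * X j j.
Proof.
move=> ij.
have appE k : app X (fun k => (k == i)%:R + c * (k == j)%:R) k = X k i + c * X k j.
  rewrite /app (bigD1 i) //= (bigD1 j) /=; last by rewrite eq_sym.
  rewrite !eqxx (negbTE ij) [j == i]eq_sym (negbTE ij) [X in _ + (_ + X)]big1.
    by rewrite !mulr1n !mulr0n; ring.
  by move=> k' /andP[/negbTE -> /negbTE ->]; rewrite !mulr0n; ring.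
rewrite /dot (bigD1 i) //= (bigD1 j) /=; last by rewrite eq_sym.
rewrite !eqxx (negbTE ij) [j == i]eq_sym (negbTE ij) [X in _ + (_ + X)]big1.
  by rewrite !appE !mulr1n !mulr0n !conjcD !conjcM !conjc0 !conjc1; ring.
by move=> k' /andP[/negbTE -> /negbTE ->]; rewrite !mulr0n conjcD conjcM !conjc0; ring.
Qed.

(** In [R[i]], [0 <= z] forces [z] to be real. A form that is real on all vectors is hermitian:
    polarise with the coefficients [1] and [Complex 0 1]. *)
Lemma psd_herm X i j : psd X -> X j i = conjc (X i j).
Proof.
move=> /psdP pX.
have dr k : complex.Im (X k k) = 0.
  have := pX (fun m => (m == k)%:R).
  have -> : dot (fun m => (m == k)%:R) (app X (fun m => (m == k)%:R)) = X k k.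
    rewrite /dot (bigD1 k) //= eqxx conjc1 mul1r [X in _ + X]big1 ?addr0.
      rewrite /app (bigD1 k) //= eqxx mulr1 [X in _ + X]big1 ?addr0 //.
      by move=> m /negbTE ->; rewrite mulr0.
    by move=> m /negbTE ->; rewrite conjc0 mul0r.
  exact: ger0_Im.
have [<-|ij] := eqVneq i j.
  by move: (dr i); case: (X i i) => a b /= ->; rewrite oppr0.
have := ger0_Im (pX (fun k => (k == i)%:R + 1 * (k == j)%:R)).
have := ger0_Im (pX (fun k => (k == i)%:R + (Complex 0 1) * (k == j)%:R)).
rewrite !quad2 //; move: (dr i) (dr j).
case: (X i i) (X j j) (X i j) (X j i) => [a b] [a' b'] [x y] [x' y'] /= -> ->.
move=> h1 h2; congr Complex; lra.
Qed.

Lemma spectral_op X : psd X ->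
  exists (w : I -> I -> R[i]) lam, [/\ eigdec X w lam, forall k, 0 <= lam k &
    vnS X = - \sum_k lam k * log2 (lam k)].
Proof.
move=> pX; set A : 'M[R[i]]_#|I| := \matrix_(i, j) X (enum_val i) (enum_val j).
have hA : A \is hermsymmx.
  apply/is_hermitianmxP; rewrite expr0 scale1r; apply/matrixP => i j.
  by rewrite !mxE conjC_conjc -psd_herm.
have /orthomx_spectralP Ae := hermitian_normalmx hA.
set S := spectralmx A in Ae; set d := spectral_diag A in Ae.
have uS : S \is unitarymx := spectral_unitarymx A.
rewrite invmx_unitary // in Ae.
have dr k : ((complex.Re (d 0 k))%:C)%C = d 0 k.
  by rewrite RRe_real //; have /mxOverP := hermitian_spectral_diag_real hA; apply.
(* [Ae] expresses [A] as the adjoint of [S] times the diagonal of [d] times [S], so the eigenvectors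
   are the conjugated rows of [S]. *)
pose w (k i : I) := conjc (S (enum_rank k) (enum_rank i)).
pose lam k := complex.Re (d 0 (enum_rank k)).
have rk (K : nmodType) (F : 'I_#|I| -> K) : \sum_k F k = \sum_(k : I) F (enum_rank k).
  by rewrite (reindex _ (onW_bij _ (@enum_rank_bij I))).
have ow : onb w.
  split=> [k l|i j].
    move/unitarymxP/matrixP/(_ (enum_rank k) (enum_rank l)): uS.
    rewrite !mxE (inj_eq enum_rank_inj) => <-; rewrite rk; apply: eq_bigr => i _.
    by rewrite /w conjcK !mxE conjC_conjc.
  move: uS; rewrite -trmxC_unitary => /unitarymxP.
  rewrite trmxCK => /matrixP/(_ (enum_rank i) (enum_rank j)).
  rewrite !mxE (inj_eq enum_rank_inj) => <-; rewrite rk; apply: eq_bigr => k _.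
  by rewrite /w conjcK !mxE conjC_conjc.
have e : eigdec X w lam.
  split=> // i j.
  move/matrixP/(_ (enum_rank i) (enum_rank j)): Ae; rewrite mxE !enum_rankK => ->.
  rewrite !mxE rk; apply: eq_bigr => k _.
  rewrite !mxE (bigD1 (enum_rank k)) //= [X in _ + X]big1 ?addr0; last first.
    by move=> l lk; rewrite !mxE (negbTE lk) mulr0n mulr0.
  rewrite !mxE eqxx mulr1n /w conjcK conjC_conjc /lam dr; ring.
exists w, lam; split=> //.
  move=> k; have /psdP/(_ (w k)) := pX.
  rewrite (eigdec_quad _ e) ler0c (bigD1 k) //= big1 ?addr0.
    by rewrite e.1.1 eqxx /sqn conjc1 mulr1 mulr1.
  by move=> l lk; rewrite e.1.1 (negbTE lk) /sqn mulr0 mulr0.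
rewrite /vnS /spectrum -/A -/d; congr (- _).
by rewrite rk.
Qed.

Lemma vnS_eig X (w : I -> I -> R[i]) lam : eigdec X w lam -> (forall k, 0 <= lam k) ->
  vnS X = - \sum_k lam k * log2 (lam k).
Proof.
move=> e l0; have [w' [lam' [e' _ ->]]] := spectral_op (eigdec_psd e l0).
by congr (- _); apply: (eigdec_sum (fun x => x * log2 x) e' e).
Qed.

End Vectors.

(** * Sequential decoding *)

Definition projv (R : realType) (I : finType) (w : I -> I -> R[i]) (S : pred I)
  (v : I -> R[i]) : I -> R[i] := fun i => \sum_(k | S k) dot (w k) v * w k i.

Definition projop (R : realType) (I : finType) (w : I -> I -> R[i]) (S : pred I)
  (K : op R I) : op R I := fun i j => projv w S (fun l => K l j) i.

(** The adjoint of [K] times [K]: the POVM element belonging to the measurement operator [K]. *)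
Definition gram (R : realType) (I : finType) (K : op R I) : op R I :=
  fun i j => dot (fun l => K l i) (fun l => K l j).

(** The trace of the operator product of [D] and [X], that is, the Born rule. *)
Definition trm (R : realType) (I : finType) (D X : op R I) : R[i] :=
  \sum_a \sum_b D a b * X b a.

Definition idop (R : realType) (I : finType) : op R I := fun i j => (i == j)%:R.

Section Projections.
Context {R : realType} {I : finType}.
Implicit Types (v : I -> R[i]) (K X D : op R I) (w : I -> I -> R[i]) (S : pred I).

Lemma dot_projv w S v l : onb w ->
  dot (w l) (projv w S v) = (S l)%:R * dot (w l) v.
Proof.
move=> [ow _]; rewrite dot_sumr; under eq_bigr do rewrite dotZr ow.
case: (boolP (S l)) => Sl.
  rewrite (bigD1 l) //= eqxx mulr1 big1 ?addr0 ?mul1r // => k /andP[_ kl].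
  by rewrite eq_sym (negbTE kl) mulr0.
rewrite mul0r big1 // => k Sk; rewrite (_ : (l == k) = false) ?mulr0 //.
by apply: contraNF Sl => /eqP ->.
Qed.

Lemma projvC w S v i : onb w -> projv w S v i + projv w (predC S) v i = v i.
Proof.
by move=> ow; rewrite [RHS](onb_expand _ _ ow) [RHS](bigID S).
Qed.

Lemma nrm2_projv w S v : onb w ->
  nrm2 (projv w S v) = \sum_(k | S k) sqn (dot (w k) v).
Proof.
move=> ow; rewrite (parseval _ ow) [RHS]big_mkcond; apply: eq_bigr => k _.
by rewrite dot_projv //; case: (S k); rewrite ?mul1r // mul0r /sqn mulr0.
Qed.

Lemma nrm2_projvC w S v : onb w ->
  nrm2 (projv w S v) + nrm2 (projv w (predC S) v) = nrm2 v.
Proof.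
by move=> ow; rewrite !nrm2_projv // (parseval v ow) [RHS](bigID S).
Qed.

Lemma nrm2_projv_le w S v : onb w -> nrm2 (projv w S v) <= nrm2 v.
Proof. by move=> ow; rewrite -(nrm2_projvC S v ow) lerDl nrm2_ge0. Qed.

Lemma dot_projv_sym w S v v' : onb w ->
  dot v (projv w S v') = dot (projv w S v) (projv w S v').
Proof.
move=> ow; rewrite (onb_dot v _ ow) [RHS](onb_dot _ _ ow).
apply: eq_bigr => k _; rewrite !dot_projv //.
by case: (S k); rewrite ?mul1r // !mul0r !mulr0.
Qed.

(** The weights 2 and 1/2 charge only half of the norm lost along the run, which [seqv_success] can
    absorb on its left-hand side. *)
Lemma Re_dot_le v v' : 2 * complex.Re (dot v v') <= 2 * nrm2 v + 2^-1 * nrm2 v'.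
Proof.
rewrite /dot Re_sum mulr_sumr /nrm2 !mulr_sumr -big_split; apply: ler_sum => i _ /=.
rewrite /sqn; case: (v i) (v' i) => [a b] [c d] /=.
have h1 := sqr_ge0 (2 * a - c); have h2 := sqr_ge0 (2 * b - d).
by nra.
Qed.

Lemma nrm2_sub v v' : nrm2 (fun i => v i - v' i) =
  nrm2 v - 2 * complex.Re (dot v v') + nrm2 v'.
Proof.
rewrite /dot Re_sum mulr_sumr /nrm2 -sumrB -big_split; apply: eq_bigr => i _ /=.
by rewrite /sqn; case: (v i) (v' i) => [a b] [c d] /=; ring.
Qed.

Lemma sqn_sub (a b : R[i]) : sqn (a - b) <= 2 * sqn a + 2 * sqn b.
Proof.
rewrite /sqn; case: a b => [a b] [c d] /=.
have h1 := sqr_ge0 (a + c); have h2 := sqr_ge0 (b + d); nra.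
Qed.

Lemma app_projop w S K v : app (projop w S K) v = projv w S (app K v).
Proof.
apply/funext => i; rewrite /app /projop /projv.
under eq_bigr do rewrite mulr_suml; rewrite exchange_big; apply: eq_bigr => k _ /=.
rewrite /dot mulr_suml; under eq_bigr do rewrite !mulr_suml.
rewrite exchange_big; apply: eq_bigr => l _ /=.
by rewrite mulr_sumr mulr_suml; apply: eq_bigr => j _; ring.
Qed.

Lemma app_idop v : app (@idop R I) v = v.
Proof.
apply/funext => i; rewrite /app (bigD1 i) //= /idop eqxx mul1r big1 ?addr0 // => j.
by rewrite eq_sym => /negbTE ->; rewrite mul0r.
Qed.

Lemma gram_quad K v : dot v (app (gram K) v) = ((nrm2 (app K v))%:C)%C.
Proof.
rewrite -dot_self /dot /app /gram /dot.
transitivity (\sum_i \sum_j \sum_l conjc (v i) * conjc (K l i) * (K l j * v j)).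
  apply: eq_bigr => i _; rewrite mulr_sumr; apply: eq_bigr => j _.
  by rewrite mulr_suml mulr_sumr; apply: eq_bigr => l _; ring.
under eq_bigr do rewrite exchange_big /=.
rewrite exchange_big; apply: eq_bigr => l _ /=; rewrite conjc_sum mulr_suml.
apply: eq_bigr => i _; rewrite mulr_sumr; apply: eq_bigr => j _.
by rewrite conjcM; ring.
Qed.

Lemma trm_eig D X w lam : eigdec X w lam ->
  trm D X = \sum_k ((lam k)%:C)%C * dot (w k) (app D (w k)).
Proof.
move=> [_ Xe]; rewrite /trm.
transitivity (\sum_a \sum_b \sum_k
   ((lam k)%:C)%C * (conjc (w k a) * (D a b * w k b))).
  apply: eq_bigr => a _; apply: eq_bigr => b _; rewrite Xe mulr_sumr.
  by apply: eq_bigr => k _; ring.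
under eq_bigr do rewrite exchange_big /=.
rewrite exchange_big; apply: eq_bigr => k _; rewrite /dot mulr_sumr.
by apply: eq_bigr => a _; rewrite /app mulr_sumr mulr_sumr.
Qed.

End Projections.

Section SequentialDecoding.
Context {R : realType} {I M : finType}.
Variables (w : M -> I -> I -> R[i]) (S : M -> pred I).
Hypothesis ow : forall m, onb (w m).

(** The unnormalised state after the tests before [m] have rejected and the test of [m] has
    accepted; its squared norm is the probability of that event. *)
Fixpoint seqv (ms : seq M) (v : I -> R[i]) (m : M) : I -> R[i] :=
  if ms is m' :: ms' then
    if m' == m then projv (w m') (S m') v
    else seqv ms' (projv (w m') (predC (S m')) v) m
  else fun=> 0.

Fixpoint seqop (ms : seq M) (K : op R I) (m : M) : op R I :=
  if ms is m' :: ms' then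
    if m' == m then projop (w m') (S m') K
    else seqop ms' (projop (w m') (predC (S m')) K) m
  else fun _ _ => 0.

Lemma app_seqop ms K m v : app (seqop ms K m) v = seqv ms (app K v) m.
Proof.
elim: ms K => [|m' ms IH] K /=.
  by apply/funext => i; rewrite /app big1 // => j _; rewrite mul0r.
by case: ifP => _; rewrite ?IH app_projop.
Qed.

Lemma seqv_sum ms v : \sum_m nrm2 (seqv ms v m) <= nrm2 v.
Proof.
elim: ms v => [|m' ms IH] v /=.
  rewrite big1 ?nrm2_ge0 // => m _; rewrite /nrm2 big1 // => i _.
  by rewrite /sqn mulr0.
rewrite (bigD1 m') //= eqxx -(nrm2_projvC (S m') v (ow m')) lerD2l.
apply: le_trans (IH (projv (w m') (predC (S m')) v)).
rewrite [leRHS](bigD1 m') //=; apply: ler_wpDl; first exact: nrm2_ge0.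
by apply: ler_sum => m; rewrite eq_sym => /negbTE ->.
Qed.

(* The first argument of [dot] stays fixed along the run, which makes the
   deviations telescope; AM-GM replaces Cauchy-Schwarz. *)
Lemma seqv_dot ms psi v m : m \in ms -> uniq ms ->
  2 * complex.Re (dot psi v - dot psi (seqv ms v m)) <=
  2 * (nrm2 (projv (w m) (predC (S m)) psi) +
       \sum_(m' <- ms | m' != m) nrm2 (projv (w m') (S m') psi)) +
  2^-1 * (nrm2 v - nrm2 (seqv ms v m)).
Proof.
have step m' (T : pred I) u : dot psi u - dot psi (projv (w m') T u) =
    dot (projv (w m') (predC T) psi) (projv (w m') (predC T) u).
  rewrite -dot_projv_sym //; apply/eqP; rewrite subr_eq addrC -dotDr; apply/eqP.
  by apply: eq_dot => // i; rewrite projvC.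
elim: ms v => [//|m' ms IH] v /=; rewrite inE => mms /andP[m'ms ums].
rewrite big_cons; case: (eqVneq m' m) => [e|ne] /=.
  rewrite e step; apply: le_trans (Re_dot_le _ _) _.
  have := nrm2_projvC (S m) v (ow m).
  have : 0 <= \sum_(j <- ms | j != m) nrm2 (projv (w j) (S j) psi).
    by apply: sumr_ge0 => j _; exact: nrm2_ge0.
  lra.
have {}mms : m \in ms by move: mms; rewrite eq_sym (negbTE ne).
have := IH (projv (w m') (predC (S m')) v) mms ums.
have := Re_dot_le (projv (w m') (S m') psi) (projv (w m') (S m') v).
have e : dot psi v - dot psi (projv (w m') (predC (S m')) v) =
         dot (projv (w m') (S m') psi) (projv (w m') (S m') v).
  by rewrite step; congr (dot _ _); apply/funext => i; apply: eq_bigl => k /=;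
     rewrite negbK.
have := nrm2_projvC (S m') v (ow m').
move: e => /(congr1 (@complex.Re R)); rewrite !ReB; lra.
Qed.

(** Gao's bound. Take [psi = v] in [seqv_dot] and use that the squared norm of the difference
    between [v] and the surviving vector is nonnegative; moving the half loss to the left doubles
    the constant 2 to 4. *)
Lemma seqv_success ms v m : m \in ms -> uniq ms ->
  nrm2 v - nrm2 (seqv ms v m) <=
  4 * (nrm2 (projv (w m) (predC (S m)) v) +
       \sum_(m' <- ms | m' != m) nrm2 (projv (w m') (S m') v)).
Proof.
move=> mms ums; have := seqv_dot v v mms ums.
have := nrm2_ge0 (fun i => v i - seqv ms v m i).
rewrite nrm2_sub dot_self ReB /=; lra.
Qed.

(** The part of [v] removed by the first projection is paid for once as lost norm, and 4 times 2 for
    replacing the projected vector by [v] in the test of [m]: hence 9 = 1 + 8, and 8 = 4 times 2 for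
    the test itself. *)
Lemma seqv_pretest ms V T v m : onb V -> m \in ms -> uniq ms -> nrm2 v = 1 ->
  1 - nrm2 (seqv ms (projv V T v) m) <=
  9 * nrm2 (projv V (predC T) v) + 8 * nrm2 (projv (w m) (predC (S m)) v) +
  4 * \sum_(m' <- ms | m' != m) nrm2 (projv (w m') (S m') (projv V T v)).
Proof.
move=> oV mms ums v1; have := seqv_success (projv V T v) mms ums.
have := nrm2_projvC T v oV; rewrite v1.
suff : nrm2 (projv (w m) (predC (S m)) (projv V T v)) <=
   2 * nrm2 (projv (w m) (predC (S m)) v) + 2 * nrm2 (projv V (predC T) v) by lra.
apply: (@le_trans _ _ (2 * nrm2 (projv (w m) (predC (S m)) v) +
   2 * nrm2 (projv (w m) (predC (S m)) (projv V (predC T) v)))); last first.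
  by rewrite lerD2l ler_pM2l // nrm2_projv_le.
rewrite !nrm2_projv // !mulr_sumr -big_split; apply: ler_sum => k _ /=.
have -> : dot (w m k) (projv V T v) =
          dot (w m k) v - dot (w m k) (projv V (predC T) v).
  apply/eqP; rewrite eq_sym subr_eq -dotDr; apply/eqP.
  by apply: eq_dot => // i; rewrite projvC.
exact: sqn_sub.
Qed.

(* [V], [T] give the projection onto the typical subspace of the average state,
   applied once before the codeword tests. *)
Lemma seq_packing (m0 : M) (V : I -> I -> R[i]) (T : pred I)
  (rho : M -> op R I) (lam : M -> I -> R) : onb V ->
  (forall m, eigdec (rho m) (w m) (lam m)) ->
  (forall m k, 0 <= lam m k) -> (forall m, \sum_k lam m k = 1) ->
  exists D : M -> op R I, povm D /\ forall m,
    1 - complex.Re (trm (D m) (rho m)) <=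
    9 * (\sum_k lam m k * \sum_(l | ~~ T l) sqn (dot (V l) (w m k))) +
    8 * (\sum_(k | ~~ S m k) lam m k) +
    4 * \sum_(m' | m' != m) \sum_k lam m k *
          nrm2 (projv (w m') (S m') (projv V T (w m k))).
Proof.
move=> oV ed l0 l1.
pose K m := seqop (enum M) (projop V T (@idop R I)) m.
have KE m v : app (K m) v = seqv (enum M) (projv V T v) m.
  by rewrite app_seqop app_projop app_idop.
pose rest : op R I := fun i j => idop R i j - \sum_m gram (K m) i j.
have quadD (X Y : op R I) v : dot v (app (fun i j => X i j + Y i j) v) =
    dot v (app X v) + dot v (app Y v).
  rewrite -dotDr; apply: eq_dot => // i; rewrite /app -big_split /=.
  by apply: eq_bigr => j _; rewrite mulrDl.
have quadrest v : dot v (app rest v) =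
    ((nrm2 v - \sum_m nrm2 (app (K m) v))%:C)%C.
  rewrite rcB rc_sum -dot_self /=.
  under eq_bigr do rewrite -gram_quad.
  rewrite -(@dot_sumr _ _ _ predT v (fun m => app (gram (K m)) v)) /=.
  apply/eqP; rewrite eq_sym subr_eq -dotDr; apply/eqP; apply: eq_dot => // i.
  rewrite -[v in LHS]app_idop /app exchange_big -big_split; apply: eq_bigr => j _ /=.
  by rewrite -mulr_suml -mulrDl subrK.
have rest_ge0 v : 0 <= nrm2 v - \sum_m nrm2 (app (K m) v).
  rewrite subr_ge0; under eq_bigr do rewrite KE.
  exact: le_trans (seqv_sum _ _) (nrm2_projv_le _ _ oV).
(* The leftover outcome, where the first projection fails or every test rejects, is assigned to [m0]
   to complete the POVM; this can only raise the success probabilities. *)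
exists (fun m => fun i j => gram (K m) i j + (m == m0)%:R * rest i j); split.
  split.
    move=> m; apply/psdP => v; rewrite quadD gram_quad.
    apply: addr_ge0; first by rewrite ler0c nrm2_ge0.
    case: (m == m0); last first.
      rewrite /dot big1 // => i _; rewrite /app big1 ?mulr0 // => j _.
      by rewrite mul0r mul0r.
    have -> : app (fun i j => true%:R * rest i j) v = app rest v.
      by apply/funext => i; apply: eq_bigr => j _; rewrite mul1r.
    by rewrite quadrest ler0c.
  move=> i j; rewrite big_split /= -mulr_suml.
  rewrite (_ : \sum_m (m == m0)%:R = 1) ?mul1r; first by rewrite addrC subrK.
  by rewrite (bigD1 m0) //= eqxx big1 ?addr0 // => m /negbTE ->.
move=> m.
rewrite (trm_eig _ (ed m)) Re_sum.
have lower k : nrm2 (seqv (enum M) (projv V T (w m k)) m) <=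
   complex.Re (dot (w m k) (app (fun i j => gram (K m) i j + (m == m0)%:R * rest i j) (w m k))).
  rewrite quadD gram_quad KE ReD lerDl.
  case: (m == m0).
    have -> : app (fun i j => true%:R * rest i j) (w m k) = app rest (w m k).
      by apply/funext => i; apply: eq_bigr => j _; rewrite mul1r.
    by rewrite quadrest; exact: rest_ge0.
  by rewrite /dot big1 // => i _; rewrite /app big1 ?mulr0 // => j _; rewrite !mul0r.
apply: (@le_trans _ _ (\sum_k lam m k *
    (1 - nrm2 (seqv (enum M) (projv V T (w m k)) m)))).
  rewrite -[X in X - _](l1 m) -sumrB; apply: ler_sum => k _.
  by rewrite ReZ mulrBr mulr1 lerD2l lerN2 ler_wpM2l.
apply: (@le_trans _ _ (\sum_k lam m k * (
  9 * nrm2 (projv V (predC T) (w m k)) + 8 * nrm2 (projv (w m) (predC (S m)) (w m k)) +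
  4 * \sum_(m' <- enum M | m' != m) nrm2 (projv (w m') (S m') (projv V T (w m k)))))).
  apply: ler_sum => k _; rewrite ler_wpM2l // seqv_pretest ?mem_enum ?enum_uniq //.
  exact: (onb_nrm2 k (ow m)).
under eq_bigr do rewrite !mulrDr.
rewrite !big_split /= !mulr_sumr; apply: lerD; first apply: lerD.
- by apply: ler_sum => k _; rewrite nrm2_projv // mulrCA.
- rewrite [leRHS]big_mkcond; apply: ler_sum => k _.
  rewrite nrm2_projv // mulrCA.
  have -> : \sum_(k0 | predC (S m) k0) sqn (dot (w m k0) (w m k)) = (~~ S m k)%:R.
    under eq_bigr do rewrite (ow m).1.
    case: (boolP (S m k)) => Sk /=.
      rewrite big1 // => l Sl; rewrite (_ : (l == k) = false) /sqn ?mulr0 //.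
      by apply: contraNF Sl => /eqP ->.
    rewrite (bigD1 k) //= eqxx /sqn conjc1 mulr1 big1 ?addr0 // => l /andP[_ /negbTE ->].
    by rewrite mulr0.
  by case: (S m k) => /=; rewrite ?mulr0 ?mulr1.
- rewrite [leRHS](eq_bigr (fun m' => \sum_k lam m k * (4 * nrm2 (projv (w m') (S m') (projv V T (w m k)))))).
    rewrite exchange_big; apply: ler_sum => k _ /=.
    by rewrite big_enum_cond mulr_sumr mulr_sumr.
  by move=> m' _; rewrite mulr_sumr; apply: eq_bigr => k _; ring.
Qed.

End SequentialDecoding.

Lemma exists_le_mean (R : realType) (T : finType) (P F : T -> R) (a : R) :
  is_pmf P -> \sum_t P t * F t <= a -> exists t, F t <= a.
Proof.
move=> [P0 P1] h; apply: contrapT => /forallNP nF.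
have {}nF t : a < F t by rewrite ltNge; apply/negP.
have : \sum_t P t * F t - a <= 0 by rewrite subr_le0.
rewrite -[a in _ - a]mul1r -P1 mulr_suml -sumrB.
under eq_bigr do rewrite -mulrBr.
have nn t : 0 <= P t * (F t - a) by rewrite mulr_ge0 // subr_ge0 ltW.
move=> le0; have e0 : \sum_t P t * (F t - a) = 0.
  by apply/eqP; rewrite eq_le le0 sumr_ge0.
have z t : P t = 0.
  move/eqP: e0; rewrite psumr_eq0 // => /allP/(_ t (mem_index_enum _)).
  by rewrite /= mulf_eq0 subr_eq0 (gt_eqF (nF t)) orbF => /eqP.
by move/eqP: P1; rewrite big1 // eq_sym oner_eq0.
Qed.

(** * Random coding with a threshold test for classical channels *)

Section ClassicalPacking.
Context {R : realType} {X Y M : finType}.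
Variables (P : X -> R) (W : X -> Y -> R) (g : R).
Hypotheses (pP : is_pmf P) (pW : forall x, is_pmf (W x)) (g0 : 0 <= g).

Definition outdist (y : Y) : R := \sum_x P x * W x y.

(** The likelihood ratio test with threshold [1 / g], written without division so that zero
    probabilities need no separate treatment. *)
Definition passes (x : X) (y : Y) : bool := outdist y <= g * W x y.

Definition thr_dec (m0 : M) (f : M -> X) (y : Y) : M :=
  odflt m0 [pick m | passes (f m) y].

Lemma thr_dec_err (m0 m : M) (f : M -> X) y :
  ((thr_dec m0 f y != m)%:R : R) <=
  (~~ passes (f m) y)%:R + \sum_(m' | m' != m) (passes (f m') y)%:R.
Proof.
rewrite /thr_dec; case: pickP => [m' pm'|none] /=.
  case: (eqVneq m' m) => [_|ne]; first by rewrite addr_ge0 // sumr_ge0.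
  rewrite (bigD1 m') //= pm' addrCA lerDl addr_ge0 // sumr_ge0 //.
rewrite none /=; case: (_ != _); rewrite ?lerDl ?addr_ge0 //; apply: sumr_ge0 => //.
Qed.

(** A wrong codeword is independent of the received [y], which then has law [outdist]. Where the
    test accepts, [outdist] is at most [g] times a probability, so each competitor costs at most
    [g]. *)
Lemma classical_packing (m0 m : M) :
  \sum_(f : {ffun M -> X}) (\prod_i P (f i)) *
    (\sum_y W (f m) y * (thr_dec m0 f y != m)%:R) <=
  \sum_x P x * (\sum_y W x y * (~~ passes x y)%:R) + (#|M|.-1)%:R * g.
Proof.
have [P0 P1] := pP.
apply: (@le_trans _ _ (\sum_(f : {ffun M -> X}) (\prod_i P (f i)) *
    ((\sum_y W (f m) y * (~~ passes (f m) y)%:R) +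
     \sum_(m' | m' != m) \sum_y W (f m) y * (passes (f m') y)%:R))).
  apply: ler_sum => f _; rewrite ler_wpM2l ?prodr_ge0 // exchange_big -big_split /=.
  apply: ler_sum => y _; rewrite -mulr_sumr -mulrDr ler_wpM2l ?(pW _).1 //.
  exact: thr_dec_err.
under eq_bigr do rewrite mulrDr; rewrite big_split /=.
rewrite (sum_ffun_at P1 m (fun x => \sum_y W x y * (~~ passes x y)%:R)) lerD2l.
under eq_bigr do rewrite mulr_sumr; rewrite exchange_big /=.
have -> : (#|M|.-1)%:R * g = \sum_(m' | m' != m) g.
  by rewrite sumr_const mulr_natl cardC1.
apply: ler_sum => m' ne.
rewrite (sum_ffun_at2 P1 (fun x x' => \sum_y W x y * (passes x' y)%:R)); last by rewrite eq_sym.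
rewrite exchange_big /=.
apply: (@le_trans _ _ (\sum_x P x * \sum_y outdist y * (passes x y)%:R)).
  apply: ler_sum => x _; rewrite le_eqVlt; apply/orP; left; apply/eqP.
  under eq_bigr do rewrite mulr_sumr; rewrite exchange_big mulr_sumr /=.
  by apply: eq_bigr => y _; rewrite /outdist mulr_suml mulr_sumr; apply: eq_bigr => x' _; ring.
apply: (@le_trans _ _ (\sum_x P x * g)); last by rewrite -mulr_suml P1 mul1r.
apply: ler_sum => x _; rewrite ler_wpM2l //.
apply: (@le_trans _ _ (\sum_y g * W x y)); last by rewrite -mulr_sumr (pW x).2 mulr1.
apply: ler_sum => y _; case: (boolP (passes x y)) => [h|_]; rewrite ?mulr1 ?mulr0 //.
by rewrite mulr_ge0 // (pW _).1.
Qed.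

End ClassicalPacking.

(** * Quantum error terms averaged over the random codeword *)

Section QuantumAverages.
Context {R : realType} {I X : finType}.
Variables (p : X -> R) (rho : X -> op R I) (w : X -> I -> I -> R[i]) (lam : X -> I -> R).
Variables (rhob : op R I) (V : I -> I -> R[i]) (mu : I -> R).
Hypotheses (p0 : forall x, 0 <= p x) (ed : forall x, eigdec (rho x) (w x) (lam x)).
Hypotheses (eb : eigdec rhob V mu) (mu0 : forall l, 0 <= mu l).
Hypothesis rhobE : forall i j, rhob i j = \sum_x ((p x)%:C)%C * rho x i j.

(** Both sides are the quadratic form of [rhob] at [z], by averaging and by its own spectrum. *)
Lemma quad_avg z :
  \sum_x p x * (\sum_k lam x k * sqn (dot z (w x k))) =
  \sum_l mu l * sqn (dot (V l) z).
Proof.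
apply: (@complexI R); rewrite -(eigdec_quad z eb) rc_sum.
transitivity (\sum_x ((p x)%:C)%C * dot z (app (rho x) z)).
  apply: eq_bigr => x _; rewrite rcM (eigdec_quad z (ed x)).
  by congr (_ * (_%:C)%C); apply: eq_bigr => k _; rewrite dot_conj sqn_conj.
under eq_bigr do rewrite -dotZr.
rewrite -(@dot_sumr _ _ _ predT z (fun x i => ((p x)%:C)%C * app (rho x) z i)).
apply: eq_dot => // i; rewrite /app.
under eq_bigr do rewrite mulr_sumr; rewrite exchange_big; apply: eq_bigr => j _ /=.
by rewrite rhobE mulr_suml; apply: eq_bigr => x _; rewrite mulrA.
Qed.

Lemma alpha_avg (T : pred I) :
  \sum_x p x * (\sum_k lam x k * \sum_(l | ~~ T l) sqn (dot (V l) (w x k))) =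
  \sum_(l | ~~ T l) mu l.
Proof.
transitivity (\sum_(l | ~~ T l) \sum_x p x * \sum_k lam x k * sqn (dot (V l) (w x k))).
  rewrite exchange_big; apply: eq_bigr => x _; rewrite -mulr_sumr exchange_big.
  by congr (_ * _); apply: eq_bigr => k _; rewrite mulr_sumr.
apply: eq_bigr => l _; rewrite quad_avg (bigD1 l) //= eb.1.1 eqxx /sqn conjc1 mulr1 mulr1.
rewrite big1 ?addr0 // => l' ne; rewrite eb.1.1 (negbTE ne) /sqn mulr0 mulr0 //.
Qed.

(** For an independent codeword the state averages to [rhob]. Restricted to [T] this is at most [t]
    times the identity, and the test projection has rank at most [s]. *)
Lemma gamma_avg (T S : pred I) (w' : I -> I -> R[i]) (s t : R) : onb w' ->
  0 <= t -> (forall l, T l -> mu l <= t) -> #|S|%:R <= s ->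
  \sum_x p x * (\sum_k lam x k * nrm2 (projv w' S (projv V T (w x k)))) <= s * t.
Proof.
move=> ow' t0 Tt Ss; have oV := eb.1.
apply: (@le_trans _ _ (\sum_(k' | S k') t)); last first.
  by rewrite sumr_const -mulr_natl ler_wpM2r.
apply: (@le_trans _ _ (\sum_(k' | S k') \sum_x p x *
    \sum_k lam x k * sqn (dot (projv V T (w' k')) (w x k)))).
  rewrite le_eqVlt; apply/orP; left; apply/eqP.
  rewrite exchange_big; apply: eq_bigr => x _; rewrite -mulr_sumr exchange_big.
  congr (_ * _); apply: eq_bigr => k _; rewrite nrm2_projv // mulr_sumr.
  apply: eq_bigr => k' _; congr (_ * sqn _).
  rewrite dot_projv_sym // -[RHS]conjcK -dot_conj [in RHS]dot_projv_sym //.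
  by rewrite -dot_conj.
apply: ler_sum => k' _; rewrite quad_avg.
rewrite -[t]mulr1 -(onb_nrm2 k' ow') (parseval _ oV) mulr_sumr; apply: ler_sum => l _.
rewrite dot_projv //; case: (boolP (T l)) => Tl.
  by rewrite mul1r ler_wpM2r ?sqn_ge0 // Tt.
by rewrite mul0r /sqn mulr0 mulr0 mulr_ge0 // sqn_ge0.
Qed.

End QuantumAverages.

(** * Random codebooks *)

Section RandomCode.
Context {R : realType} {U X1 X2 Y1 Y2 I M1 M2 : finType}.
Variables (PU : U -> R) (P1 : U -> X1 -> R) (P2 : U -> X2 -> R).
Variables (W1 : X1 -> X2 -> Y1 -> R) (W2 : X1 -> X2 -> Y2 -> R) (g1 g2 : R).
Variables (rho : X1 * X2 -> op R I) (w : X1 * X2 -> I -> I -> R[i])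
  (lam : X1 * X2 -> I -> R) (rhob : op R I) (V : I -> I -> R[i]) (mu : I -> R)
  (T : pred I) (S : X1 * X2 -> pred I) (s t : R) (m01 : M1) (m02 : M2).

Definition inputP (x : X1 * X2) : R := \sum_u PU u * P1 u x.1 * P2 u x.2.

Hypotheses (pU : is_pmf PU) (pP1 : forall u, is_pmf (P1 u))
  (pP2 : forall u, is_pmf (P2 u)) (pW1 : forall x1 x2, is_pmf (W1 x1 x2))
  (pW2 : forall x1 x2, is_pmf (W2 x1 x2)) (g10 : 0 <= g1) (g20 : 0 <= g2)
  (ed : forall x, eigdec (rho x) (w x) (lam x)) (lam0 : forall x k, 0 <= lam x k)
  (lam1 : forall x, \sum_k lam x k = 1) (eb : eigdec rhob V mu)
  (mu0 : forall l, 0 <= mu l)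
  (rhobE : forall i j, rhob i j = \sum_x ((inputP x)%:C)%C * rho x i j)
  (t0 : 0 <= t) (Tt : forall l, T l -> mu l <= t) (Ss : forall x, #|S x|%:R <= s).

Let K := (M1 * M2)%type.
(** One superposition cluster: a cloud centre in [U] and satellite codewords for all fresh messages
    of either user. A codebook is one cluster per key in [K]. *)
Let cell := (U * {ffun M1 -> X1} * {ffun M2 -> X2})%type.

Definition cellP (c : cell) : R :=
  PU c.1.1 * (\prod_m P1 c.1.1 (c.1.2 m)) * (\prod_m P2 c.1.1 (c.2 m)).

Definition cellx (c : cell) (m : K) : X1 * X2 := (c.1.2 m.1, c.2 m.2).

Definition est1 (c : cell) (m1 : M1) : Y1 -> M2 :=
  thr_dec (P2 c.1.1) (W1 (c.1.2 m1)) g1 m02 c.2.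

Definition est2 (c : cell) (m2 : M2) : Y2 -> M1 :=
  thr_dec (P1 c.1.1) (fun x1 => W2 x1 (c.2 m2)) g2 m01 c.1.2.

Definition err1 (c : cell) (m : K) : R :=
  \sum_y W1 (cellx c m).1 (cellx c m).2 y * (est1 c m.1 y != m.2)%:R.

Definition err2 (c : cell) (m : K) : R :=
  \sum_y W2 (cellx c m).1 (cellx c m).2 y * (est2 c m.2 y != m.1)%:R.

(* Bound on the decoding error of [seq_packing] when the receiver knows [m] and
   looks for [k]. *)
Definition errQ (c : {ffun K -> cell}) (k m : K) : R :=
  9 * (\sum_i lam (cellx (c k) m) i *
         \sum_(l | ~~ T l) sqn (dot (V l) (w (cellx (c k) m) i))) +
  8 * (\sum_(i | ~~ S (cellx (c k) m) i) lam (cellx (c k) m) i) +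
  4 * \sum_(k' | k' != k) \sum_i lam (cellx (c k) m) i *
        nrm2 (projv (w (cellx (c k') m)) (S (cellx (c k') m))
                (projv V T (w (cellx (c k) m) i))).

Definition miss1 : R :=
  \sum_u PU u * \sum_x1 P1 u x1 * \sum_x2 P2 u x2 *
    \sum_y W1 x1 x2 y * (~~ passes (P2 u) (W1 x1) g1 x2 y)%:R.

Definition miss2 : R :=
  \sum_u PU u * \sum_x2 P2 u x2 * \sum_x1 P1 u x1 *
    \sum_y W2 x1 x2 y * (~~ passes (P1 u) (fun x1 => W2 x1 x2) g2 x1 y)%:R.

Definition code_bound : R :=
  (miss1 + (#|M2|.-1)%:R * g1) + (miss2 + (#|M1|.-1)%:R * g2) +
  (9 * (\sum_(l | ~~ T l) mu l) +
   8 * (\sum_x inputP x * \sum_(i | ~~ S x i) lam x i) +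
   4 * ((#|M1| * #|M2|).-1%:R * (s * t))).

Lemma sum_cell (F : cell -> R) :
  \sum_c F c = \sum_u \sum_f1 \sum_f2 F (u, f1, f2).
Proof.
by rewrite [RHS]pair_big [RHS]pair_big /=; apply: eq_bigr => -[[u f1] f2].
Qed.

Lemma inputP_ge0 x : 0 <= inputP x.
Proof.
rewrite sumr_ge0 // => u _; rewrite !mulr_ge0 //.
- exact: pU.1.
- exact: (pP1 u).1.
- exact: (pP2 u).1.
Qed.

Lemma cell_marg (m : K) (F : X1 * X2 -> R) :
  \sum_c cellP c * F (cellx c m) = \sum_x inputP x * F x.
Proof.
rewrite sum_cell.
transitivity (\sum_u PU u * \sum_x1 P1 u x1 * \sum_x2 P2 u x2 * F (x1, x2)).
  apply: eq_bigr => u _; rewrite -(sum_ffun_at (pP1 u).2 m.1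
    (fun x1 => \sum_x2 P2 u x2 * F (x1, x2))) mulr_sumr.
  apply: eq_bigr => f1 _; rewrite -(sum_ffun_at (pP2 u).2 m.2
    (fun x2 => F (f1 m.1, x2))) !mulr_sumr.
  by apply: eq_bigr => f2 _; rewrite /cellP /cellx /=; ring.
transitivity (\sum_x1 \sum_x2 inputP (x1, x2) * F (x1, x2)); last first.
  by rewrite pair_big; apply: eq_bigr => -[].
under eq_bigr do rewrite mulr_sumr; rewrite exchange_big; apply: eq_bigr => x1 _ /=.
under eq_bigr do rewrite !mulr_sumr; rewrite exchange_big; apply: eq_bigr => x2 _ /=.
by rewrite mulr_suml; apply: eq_bigr => u _ /=; ring.
Qed.

Lemma cellP_pmf : is_pmf cellP.
Proof.
split=> [c|].
  rewrite !mulr_ge0 ?prodr_ge0 //; first exact: pU.1.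
  - by move=> m _; exact: (pP1 _).1.
  - by move=> m _; exact: (pP2 _).1.
have := cell_marg (m01, m02) (fun=> 1).
under eq_bigr do rewrite mulr1; move=> ->; under eq_bigr do rewrite mulr1.
rewrite exchange_big /=.
rewrite -pU.2; apply: eq_bigr => u _.
transitivity (\sum_x1 \sum_x2 PU u * P1 u x1 * P2 u x2).
  by rewrite pair_big.
under eq_bigr do rewrite -mulr_sumr (pP2 u).2 mulr1.
by rewrite -mulr_sumr (pP1 u).2 mulr1.
Qed.

(** Given the cloud centre and the codewords [f1], the satellites [f2] are i.i.d. with law [P2 u]
    and [W1 (f1 m.1)] is an ordinary channel, so [classical_packing] applies. *)
Lemma err1_mean m : \sum_c cellP c * err1 c m <= miss1 + (#|M2|.-1)%:R * g1.
Proof.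
rewrite sum_cell.
apply: (@le_trans _ _ (\sum_u PU u * \sum_(f1 : {ffun M1 -> X1}) (\prod_i P1 u (f1 i)) *
  \sum_(f2 : {ffun M2 -> X2}) (\prod_i P2 u (f2 i)) *
  (\sum_y W1 (f1 m.1) (f2 m.2) y *
     (thr_dec (P2 u) (W1 (f1 m.1)) g1 m02 f2 y != m.2)%:R))).
  rewrite le_eqVlt; apply/orP; left; apply/eqP; apply: eq_bigr => u _.
  rewrite mulr_sumr; apply: eq_bigr => f1 _; rewrite !mulr_sumr.
  by apply: eq_bigr => f2 _; rewrite /cellP /err1 /est1 /cellx /= !mulrA.
have -> : miss1 + (#|M2|.-1)%:R * g1 =
   \sum_u PU u * \sum_(f1 : {ffun M1 -> X1}) (\prod_i P1 u (f1 i)) *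
    (\sum_x2 P2 u x2 *
       (\sum_y W1 (f1 m.1) x2 y * (~~ passes (P2 u) (W1 (f1 m.1)) g1 x2 y)%:R) +
     (#|M2|.-1)%:R * g1).
  rewrite [X in _ + X = _](_ : _ = \sum_u PU u * ((#|M2|.-1)%:R * g1)); last first.
    by rewrite -mulr_suml pU.2 mul1r.
  rewrite -big_split; apply: eq_bigr => u _ /=; rewrite -mulrDr; congr (_ * _).
  rewrite (sum_ffun_at (pP1 u).2 m.1 (fun x1 => \sum_x2 P2 u x2 *
       (\sum_y W1 x1 x2 y * (~~ passes (P2 u) (W1 x1) g1 x2 y)%:R) +
     (#|M2|.-1)%:R * g1)).
  under [RHS]eq_bigr do rewrite mulrDr.
  by rewrite big_split /= -mulr_suml (pP1 u).2 mul1r.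
apply: ler_sum => u _; rewrite ler_wpM2l ?pU.1 //.
apply: ler_sum => f1 _; rewrite ler_wpM2l ?prodr_ge0 //.
  by move=> i _; exact: (pP1 u).1.
exact: classical_packing.
Qed.

Lemma err2_mean m : \sum_c cellP c * err2 c m <= miss2 + (#|M1|.-1)%:R * g2.
Proof.
rewrite sum_cell.
apply: (@le_trans _ _ (\sum_u PU u * \sum_(f2 : {ffun M2 -> X2}) (\prod_i P2 u (f2 i)) *
  \sum_(f1 : {ffun M1 -> X1}) (\prod_i P1 u (f1 i)) *
  (\sum_y W2 (f1 m.1) (f2 m.2) y *
     (thr_dec (P1 u) (fun x1 => W2 x1 (f2 m.2)) g2 m01 f1 y != m.1)%:R))).
  rewrite le_eqVlt; apply/orP; left; apply/eqP; apply: eq_bigr => u _.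
  rewrite exchange_big mulr_sumr; apply: eq_bigr => f2 _; rewrite !mulr_sumr.
  by apply: eq_bigr => f1 _; rewrite /cellP /err2 /est2 /cellx /=; rewrite -!mulrA; congr (_ * _); rewrite mulrCA.
have -> : miss2 + (#|M1|.-1)%:R * g2 =
   \sum_u PU u * \sum_(f2 : {ffun M2 -> X2}) (\prod_i P2 u (f2 i)) *
    (\sum_x1 P1 u x1 *
       (\sum_y W2 x1 (f2 m.2) y *
          (~~ passes (P1 u) (fun x1 => W2 x1 (f2 m.2)) g2 x1 y)%:R) +
     (#|M1|.-1)%:R * g2).
  rewrite [X in _ + X = _](_ : _ = \sum_u PU u * ((#|M1|.-1)%:R * g2)); last first.
    by rewrite -mulr_suml pU.2 mul1r.
  rewrite -big_split; apply: eq_bigr => u _ /=; rewrite -mulrDr; congr (_ * _).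
  rewrite (sum_ffun_at (pP2 u).2 m.2 (fun x2 => \sum_x1 P1 u x1 *
       (\sum_y W2 x1 x2 y * (~~ passes (P1 u) (fun x1 => W2 x1 x2) g2 x1 y)%:R) +
     (#|M1|.-1)%:R * g2)).
  under [RHS]eq_bigr do rewrite mulrDr.
  by rewrite big_split /= -mulr_suml (pP2 u).2 mul1r.
apply: ler_sum => u _; rewrite ler_wpM2l ?pU.1 //.
apply: ler_sum => f2 _; rewrite ler_wpM2l ?prodr_ge0 //.
  by move=> i _; exact: (pP2 u).1.
exact: (classical_packing (W := fun x1 => W2 x1 (f2 m.2))).
Qed.

(** The first two terms involve only the cluster of [k]. In the third the clusters of [k] and [k']
    are independent, so the sent state can be averaged with the wrong test held fixed. *)
Lemma errQ_mean k m :
  \sum_(c : {ffun K -> cell}) (\prod_i cellP (c i)) * errQ c k m <=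
  9 * (\sum_(l | ~~ T l) mu l) +
  8 * (\sum_x inputP x * \sum_(i | ~~ S x i) lam x i) +
  4 * ((#|M1| * #|M2|).-1%:R * (s * t)).
Proof.
have [cP0 cP1] := cellP_pmf.
have c1 (F : X1 * X2 -> R) : \sum_(c : {ffun K -> cell})
    (\prod_i cellP (c i)) * F (cellx (c k) m) = \sum_x inputP x * F x.
  by rewrite (sum_ffun_at cP1 k (fun c => F (cellx c m))) cell_marg.
have lin (Pc A B C : {ffun K -> cell} -> R) :
    \sum_c Pc c * (9 * A c + 8 * B c + 4 * C c) =
    9 * (\sum_c Pc c * A c) + 8 * (\sum_c Pc c * B c) + 4 * (\sum_c Pc c * C c).
  by rewrite !mulr_sumr -!big_split; apply: eq_bigr => c _ /=; ring.
rewrite lin; apply: lerD; first apply: lerD.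
- rewrite (c1 (fun x => \sum_i lam x i * \sum_(l | ~~ T l) sqn (dot (V l) (w x i)))).
  by rewrite (alpha_avg ed eb rhobE).
- by rewrite (c1 (fun x => \sum_(i | ~~ S x i) lam x i)).
rewrite ler_pM2l //.
under eq_bigr do rewrite mulr_sumr; rewrite exchange_big /=.
have -> : (#|M1| * #|M2|).-1%:R * (s * t) = \sum_(k' : K | k' != k) s * t.
  by rewrite sumr_const mulr_natl cardC1 card_prod.
apply: ler_sum => k' ne.
pose G x x' := \sum_i lam x i * nrm2 (projv (w x') (S x') (projv V T (w x i))).
rewrite (sum_ffun_at2 cP1 (fun a b => G (cellx a m) (cellx b m))); last by rewrite eq_sym.
rewrite exchange_big /=.
have -> : s * t = \sum_b cellP b * (s * t) by rewrite -mulr_suml cP1 mul1r.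
apply: ler_sum => b _.
have -> : \sum_a cellP a * cellP b * G (cellx a m) (cellx b m) =
  cellP b * \sum_x inputP x * G x (cellx b m).
  rewrite -(cell_marg m (fun x => G x (cellx b m))) mulr_sumr.
  by apply: eq_bigr => a _; ring.
rewrite ler_wpM2l //.
by apply: (gamma_avg ed eb rhobE) => //; exact: (ed _).1.
Qed.

(** The weighted family [nu], [k], [m] is arbitrary because a single codebook must later be good on
    average over all messages and all blocks at once. *)
Lemma random_code (J : finType) (nu : J -> R) (k m : J -> K) :
  (forall j, 0 <= nu j) ->
  exists (x1 : K -> M1 -> X1) (x2 : K -> M2 -> X2)
    (d1 : K -> M1 -> Y1 -> M2) (d2 : K -> M2 -> Y2 -> M1)
    (D : K -> K -> op R I),
    (forall m, povm (D m)) /\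
    \sum_j nu j *
      (\sum_y W1 (x1 (k j) (m j).1) (x2 (k j) (m j).2) y *
         (d1 (k j) (m j).1 y != (m j).2)%:R +
       \sum_y W2 (x1 (k j) (m j).1) (x2 (k j) (m j).2) y *
         (d2 (k j) (m j).2 y != (m j).1)%:R +
       (1 - complex.Re (trm (D (m j) (k j))
              (rho (x1 (k j) (m j).1, x2 (k j) (m j).2))))) <=
    (\sum_j nu j) * code_bound.
Proof.
move=> nu0; have [cP0 cP1] := cellP_pmf.
have bP : is_pmf (fun c : {ffun K -> cell} => \prod_i cellP (c i)).
  split=> [c|]; first by rewrite prodr_ge0.
  by rewrite (sum_ffun_prod (fun _ => cellP)) big1.
have [] := @exists_le_mean _ _ _ (fun c : {ffun K -> cell} => \sum_j nu j *
  (err1 (c (k j)) (m j) + err2 (c (k j)) (m j) + errQ c (k j) (m j)))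
  ((\sum_j nu j) * code_bound) bP.
  under eq_bigr do rewrite mulr_sumr; rewrite exchange_big mulr_suml /=.
  apply: ler_sum => j _; under eq_bigr do rewrite mulrCA.
  rewrite -mulr_sumr ler_wpM2l //; under eq_bigr do rewrite 2!mulrDr.
  rewrite 2!big_split /= /code_bound; apply: lerD (errQ_mean _ _).
  by rewrite (sum_ffun_at cP1 (k j) (fun c => err1 c (m j)))
    (sum_ffun_at cP1 (k j) (fun c => err2 c (m j))) lerD ?err1_mean ?err2_mean.
move=> c hc.
have hD m' : exists D : K -> op R I, povm D /\ forall k',
    1 - complex.Re (trm (D k') (rho (cellx (c k') m'))) <= errQ c k' m'.
  have [] := @seq_packing R I K (fun k' => w (cellx (c k') m'))
    (fun k' => S (cellx (c k') m')) (fun k' => (ed _).1) (m01, m02) V T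
    (fun k' => rho (cellx (c k') m')) (fun k' => lam (cellx (c k') m')) eb.1 => //.
  by move=> D [pD hD]; exists D.
have [D HD] := choice hD.
exists (fun k m1 => (c k).1.2 m1), (fun k m2 => (c k).2 m2),
  (fun k => est1 (c k)), (fun k => est2 (c k)), D.
split; first by move=> m'; exact: (HD m').1.
apply: le_trans hc; apply: ler_sum => j _; rewrite ler_wpM2l // lerD2l.
exact: (HD (m j)).2.
Qed.

End RandomCode.

(** * Products of operators and maps *)

Section OperatorFacts.
Context {R : realType}.

(** No injectivity of [h] is assumed: the form at [v] is the form of [X] at the sums of [v] over the
    fibres of [h]. This covers slices, permutations and trivial ancillas alike. *)
Lemma psd_reindex (I I' : finType) (h : I' -> I) (X : op R I) :
  psd X -> psd (fun a b => X (h a) (h b)).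
Proof.
move=> pX v; pose u i := \sum_(a | h a == i) v a.
suff <- : \sum_i \sum_j conjc (u i) * X i j * u j =
          \sum_a \sum_b conjc (v a) * X (h a) (h b) * v b by exact: pX.
rewrite [RHS](partition_big h xpredT) //=; apply: eq_bigr => i _.
under [RHS]eq_bigr do rewrite (partition_big h xpredT) //=.
rewrite [RHS]exchange_big; apply: eq_bigr => j _.
rewrite /u conjc_sum !mulr_suml; apply: eq_bigr => a /eqP <-.
by rewrite mulr_sumr; apply: eq_bigr => b /eqP <-.
Qed.

Lemma eigdec_ge0 (I : finType) (X : op R I) w lam k : psd X -> eigdec X w lam -> 0 <= lam k.
Proof.
move=> /psdP/(_ (w k)) + e; rewrite (eigdec_quad _ e) ler0c (bigD1 k) //= big1 ?addr0.
  by rewrite e.1.1 eqxx /sqn conjc1 mulr1 mulr1.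
by move=> l lk; rewrite e.1.1 (negbTE lk) /sqn mulr0 mulr0.
Qed.

Lemma eigdec_prod (T I : finType) (X : T -> op R I) (w : T -> I -> I -> R[i])
  (lam : T -> I -> R) : (forall t, eigdec (X t) (w t) (lam t)) ->
  eigdec (fun a b : {ffun T -> I} => \prod_t X t (a t) (b t))
    (fun k a => \prod_t w t (k t) (a t)) (fun k => \prod_t lam t (k t)).
Proof.
move=> e.
have prod_eq (a b : {ffun T -> I}) : \prod_t ((a t == b t)%:R : R[i]) = (a == b)%:R.
  have [->|ne] := eqVneq a b; first by rewrite big1 // => t _; rewrite eqxx.
  have /existsP[t nt] : [exists t, a t != b t].
    by apply: contraNT ne => /existsPn h; apply/eqP/ffunP => t; apply/eqP; have := h t; rewrite negbK.
  by rewrite (bigD1 t) //= (negbTE nt) mul0r.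
split; first split.
- move=> k l; rewrite -prod_eq /dot.
  under [LHS]eq_bigr do rewrite conjc_prod -big_split /=.
  rewrite (sum_ffun_prod (fun t i => conjc (w t (k t) i) * w t (l t) i)).
  by apply: eq_bigr => t _; rewrite -(e t).1.1.
- move=> a b; rewrite -prod_eq.
  under [LHS]eq_bigr do rewrite conjc_prod -big_split /=.
  rewrite (sum_ffun_prod (fun t i => w t i (a t) * conjc (w t i (b t)))).
  by apply: eq_bigr => t _; rewrite -(e t).1.2.
- move=> a b; under [RHS]eq_bigr do rewrite conjc_prod -big_split rc_prod -big_split /=.
  rewrite (sum_ffun_prod (fun t k => ((lam t k)%:C)%C * (w t k (a t) * conjc (w t k (b t))))).
  by apply: eq_bigr => t _; exact: (e t).2.
Qed.

Lemma psd_prod (T I : finType) (X : T -> op R I) : (forall t, psd (X t)) ->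
  psd (fun a b : {ffun T -> I} => \prod_t X t (a t) (b t)).
Proof.
move=> pX.
have /choice[w /choice[lam e]] t : exists (w : I -> I -> R[i]) (lam : I -> R),
    eigdec (X t) w lam.
  by have [w [lam [e _ _]]] := spectral_op (pX t); exists w, lam.
apply: (eigdec_psd (eigdec_prod e)) => k; apply: prodr_ge0 => t _.
exact: eigdec_ge0 (e t).
Qed.

Lemma trace_prod (T I : finType) (X : T -> op R I) :
  trace (fun a b : {ffun T -> I} => \prod_t X t (a t) (b t)) = \prod_t trace (X t).
Proof. by rewrite /trace (sum_ffun_prod (fun t i => X t i i)). Qed.

(** Diagonalising [X] alone turns the form into a nonnegative combination of values of the form of
    [Y]. *)
Lemma psd_tens (I J : finType) (X : op R I) (Y : op R J) :
  psd X -> psd Y -> psd (tens X Y).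
Proof.
move=> pX pY; have [w [lam [e l0 _]]] := spectral_op pX.
move=> v.
pose u k (j : J) := \sum_i conjc (w k i) * v (i, j).
suff -> : \sum_i \sum_j conjc (v i) * tens X Y i j * v j =
  \sum_k ((lam k)%:C)%C * dot (u k) (app Y (u k)).
  apply: sumr_ge0 => k _; rewrite mulr_ge0 ?ler0c //.
  by have /psdP := pY; apply.
transitivity (\sum_i \sum_j \sum_i' \sum_j' \sum_k ((lam k)%:C)%C *
   (conjc (v (i, j)) * w k i * Y j j' * conjc (w k i') * v (i', j'))).
  rewrite [RHS]pair_big; apply: eq_bigr => -[i j] _ /=.
  rewrite [RHS]pair_big; apply: eq_bigr => -[i' j'] _ /=.
  rewrite /tens /= e.2 mulr_suml mulr_sumr mulr_suml.
  by apply: eq_bigr => k _; ring.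
transitivity (\sum_k \sum_j \sum_j' \sum_i \sum_i' ((lam k)%:C)%C *
   (conjc (v (i, j)) * w k i * Y j j' * conjc (w k i') * v (i', j'))).
  under eq_bigr => i _ do under eq_bigr => j _ do under eq_bigr => i' _ do
    rewrite exchange_big.
  under eq_bigr => i _ do under eq_bigr => j _ do rewrite exchange_big.
  under eq_bigr => i _ do rewrite exchange_big.
  rewrite exchange_big; apply: eq_bigr => k _.
  rewrite exchange_big; apply: eq_bigr => j _.
  rewrite [RHS]exchange_big; apply: eq_bigr => i _.
  by rewrite exchange_big.
apply: eq_bigr => k _; rewrite /dot mulr_sumr; apply: eq_bigr => j _.
rewrite /app mulrA mulr_sumr; apply: eq_bigr => j' _.
rewrite /u conjc_sum [_ * \sum_i _ in RHS]mulr_sumr mulr_suml; apply: eq_bigr => i _.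
rewrite mulr_sumr mulr_sumr; apply: eq_bigr => i' _.
by rewrite conjcM conjcK; ring.
Qed.

Lemma trm_ge0 (I : finType) (D X : op R I) : psd D -> psd X -> 0 <= trm D X.
Proof.
move=> pD pX; have [w [lam [e l0 _]]] := spectral_op pX.
rewrite (trm_eig _ e) sumr_ge0 // => k _; rewrite mulr_ge0 ?ler0c //.
by have /psdP := pD; apply.
Qed.

Lemma linear_map0 (I J : finType) (F : op R I -> op R J) : linear_map F ->
  F (fun _ _ => 0) = fun _ _ => 0.
Proof.
move=> lF; have := lF (-1) (fun _ _ => 0) (fun _ _ => 0).
have -> : (fun _ _ : I => -1 * 0 + 0) = (fun _ _ => 0 : R[i]).
  by apply/funext => i; apply/funext => j; rewrite mulr0 addr0.
by move=> ->; apply/funext => i; apply/funext => j; rewrite mulN1r addNr.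
Qed.

Lemma linear_mapZ (I J : finType) (F : op R I -> op R J) c X : linear_map F ->
  F (fun i j => c * X i j) = fun i j => c * F X i j.
Proof.
move=> lF; have := lF c X (fun _ _ => 0); rewrite linear_map0 //.
have -> : (fun i i' => c * X i i' + 0) = (fun i i' => c * X i i').
  by apply/funext => i; apply/funext => j; rewrite addr0.
by move=> ->; apply/funext => i; apply/funext => j; rewrite addr0.
Qed.

Lemma linear_map_sum (I J T : finType) (F : op R I -> op R J)
  (c : T -> R[i]) (X : T -> op R I) i j : linear_map F ->
  F (fun i i' => \sum_t c t * X t i i') i j = \sum_t c t * F (X t) i j.
Proof.
move=> lF; elim: (index_enum T) => [|t r IH].
  rewrite big_nil; transitivity (F (fun _ _ => 0) i j); last by rewrite linear_map0.
  by congr (F _ i j); apply/funext => a; apply/funext => b; rewrite big_nil.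
rewrite big_cons -IH.
have := lF (c t) (X t) (fun i i' => \sum_(t <- r) c t * X t i i').
move=> /(congr1 (fun f => f i j)) <-.
by congr (F _ i j); apply/funext => a; apply/funext => b; rewrite big_cons.
Qed.

(** Complete positivity is stated for the ancillas ['I_k]; enumerating [K] transfers it to any
    finite type. *)
Lemma cp_idL (I J K : finType) (F : op R I -> op R J) (X : op R (K * I)%type) :
  completely_positive F -> psd X -> psd (idL F X).
Proof.
move=> [_ cp] pX.
pose h (a : 'I_#|K| * I) : K * I := (enum_val a.1, a.2).
have := psd_reindex (fun a : K * J => (enum_rank a.1, a.2)) (cp _ _ (psd_reindex h pX)).
congr psd; apply/funext => a; apply/funext => b; rewrite /idL /h /=.
by rewrite !enum_rankK.
Qed.

Lemma cp_psd (I J : finType) (F : op R I -> op R J) (X : op R I) :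
  completely_positive F -> psd X -> psd (F X).
Proof.
move=> cp pX; have := cp_idL cp (psd_reindex (fun a : unit * I => a.2) pX).
by move=> /(psd_reindex (fun j : J => (tt, j))).
Qed.

Lemma unitop_expand (I : finType) (X : op R I) :
  X = fun i i' => \sum_(p : I * I) X p.1 p.2 * unitop R p.1 p.2 i i'.
Proof.
apply/funext => i; apply/funext => i'; rewrite (bigD1 (i, i')) //= /unitop !eqxx mulr1.
rewrite big1 ?addr0 // => -[k l] /=; rewrite xpair_eqE [i == k]eq_sym [i' == l]eq_sym.
by move=> /negbTE ->; rewrite mulr0.
Qed.

Lemma tpow_map_prod (I J : finType) (n : nat) (F : op R I -> op R J)
  (X : 'I_n -> op R I) : linear_map F ->
  tpow_map F (fun a a' : {ffun 'I_n -> I} => \prod_t X t (a t) (a' t)) =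
  fun b b' => \prod_t F (X t) (b t) (b' t).
Proof.
move=> lF; apply/funext => b; apply/funext => b'; rewrite /tpow_map.
rewrite -(sum_ffun_pair (fun a a' : {ffun 'I_n -> I} => (\prod_t X t (a t) (a' t)) *
   \prod_(t < n) F (unitop R (a t) (a' t)) (b t) (b' t))) /=.
transitivity (\prod_t \sum_(p : I * I) X t p.1 p.2 * F (unitop R p.1 p.2) (b t) (b' t)).
  rewrite -(sum_ffun_prod (fun t p => X t p.1 p.2 * F (unitop R p.1 p.2) (b t) (b' t))).
  apply: eq_bigr => f _; rewrite -big_split; apply: eq_bigr => t _ /=.
  by rewrite !ffunE.
apply: eq_bigr => t _; rewrite [in RHS](unitop_expand (X t)).
by rewrite (linear_map_sum (fun p => X t p.1 p.2) (fun p => unitop R p.1 p.2)).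
Qed.

Lemma join_inputs_prod (A1 A2 : finType) (n : nat) (X : 'I_n -> op R A1)
  (Y : 'I_n -> op R A2) :
  join_inputs (fun a a' : {ffun 'I_n -> A1} => \prod_t X t (a t) (a' t))
    (fun a a' : {ffun 'I_n -> A2} => \prod_t Y t (a t) (a' t)) =
  fun a a' => \prod_t tens (X t) (Y t) (a t) (a' t).
Proof.
apply/funext => a; apply/funext => a'; rewrite /join_inputs -big_split.
by apply: eq_bigr => t _; rewrite !ffunE.
Qed.

End OperatorFacts.

Section Sequences.
Context {T : finType}.

Lemma restrE t (z : {ffun 'I_t.+1 -> T}) j : restr z j = z (widen_ord (leqnSn t) j).
Proof. by rewrite ffunE. Qed.

Lemma restr_snoc t (a : {ffun 'I_t -> T}) x : restr (snoc a x) = a.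
Proof.
apply/ffunP => j; rewrite !ffunE.
have -> : widen_ord (leqnSn t) j = lift ord_max j.
  by apply: val_inj; rewrite /= /bump leqNgt ltn_ord.
by rewrite liftK.
Qed.

Lemma snoc_widen t (a : {ffun 'I_t -> T}) x j : snoc a x (widen_ord (leqnSn t) j) = a j.
Proof. by rewrite -restrE restr_snoc. Qed.

Lemma snoc_max t (a : {ffun 'I_t -> T}) x : snoc a x ord_max = x.
Proof. by rewrite ffunE unlift_none. Qed.

Lemma snoc_restr t (a : {ffun 'I_t.+1 -> T}) : snoc (restr a) (a ord_max) = a.
Proof.
apply/ffunP => j; rewrite !ffunE; case: unliftP => [i ->|->] //.
by rewrite restrE; congr (a _); apply: val_inj; rewrite /= /bump leqNgt ltn_ord.
Qed.

Lemma tcons0 t (a : {ffun 'I_t -> T}) x : tcons x a ord0 = x.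
Proof. by rewrite ffunE unlift_none. Qed.

Lemma tconsS t (a : {ffun 'I_t -> T}) x j : tcons x a (lift ord0 j) = a j.
Proof. by rewrite ffunE liftK. Qed.

Lemma sum_snoc (K : nmodType) t (F : {ffun 'I_t.+1 -> T} -> K) :
  \sum_a F a = \sum_r \sum_x F (snoc r x).
Proof.
rewrite pair_big (reindex (fun p : {ffun 'I_t -> T} * T => snoc p.1 p.2)) //=.
exists (fun a => (restr a, a ord_max)) => [[r x] _|a _] /=.
  by rewrite restr_snoc snoc_max.
exact: snoc_restr.
Qed.

(** Total sequences avoid dependent lengths: encoders take functions on [nat], and strict causality
    says that only entries below the current time matter. *)
Definition ext (z0 : T) n (z : {ffun 'I_n -> T}) (i : nat) : T :=
  if insub i is Some j then z j else z0.

Lemma ext_ord (z0 : T) n (z : {ffun 'I_n -> T}) (j : 'I_n) : ext z0 z j = z j.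
Proof. by rewrite /ext valK. Qed.

Lemma ext_restr (z0 : T) n (z : {ffun 'I_n.+1 -> T}) i : (i < n)%N ->
  ext z0 (restr z) i = ext z0 z i.
Proof.
move=> lti; have -> : i = Ordinal lti :> nat by [].
by rewrite ext_ord restrE -(ext_ord z0).
Qed.

Lemma ext_snoc (z0 : T) n (r : {ffun 'I_n -> T}) x i : (i < n)%N ->
  ext z0 (snoc r x) i = ext z0 r i.
Proof. by move=> lti; rewrite -ext_restr // restr_snoc. Qed.

End Sequences.

(** * Feedback codes with product inputs *)

(** The instrument sees only the newest channel output; its result becomes the last memory position
    and the older memory is left untouched. *)
Definition pinst (R : realType) (B J Z : finType) (G : Z -> op R B -> op R J)
  (t : nat) (z : Z) (X : op R (B * {ffun 'I_t -> J})%type) : op R {ffun 'I_t.+1 -> J} :=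
  fun a b => G z (fun i i' => X (i, restr a) (i', restr b)) (a ord_max) (b ord_max).

Section PositionwiseInstrument.
Context {R : realType} {B J Z : finType}.
Variable G : Z -> op R B -> op R J.
Hypothesis HG : qinstrument G.

Lemma pinst_trace t z (X : op R (B * {ffun 'I_t -> J})%type) :
  trace (pinst G z X) = \sum_r trace (G z (fun i i' => X (i, r) (i', r))).
Proof.
rewrite /trace sum_snoc; apply: eq_bigr => r _; apply: eq_bigr => j _.
by rewrite /pinst restr_snoc snoc_max.
Qed.

Lemma trace_slices t (X : op R (B * {ffun 'I_t -> J})%type) :
  trace X = \sum_r trace (fun i i' => X (i, r) (i', r)).
Proof. by rewrite exchange_big pair_big; apply: eq_bigr => -[]. Qed.

Lemma pinst_qinstrument t : qinstrument (@pinst R B J Z G t).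
Proof.
have [HGz HGt] := HG; split.
  move=> z; have [[lG cG] nG] := HGz z; split; first split.
  - move=> c X Y; apply/funext => a; apply/funext => b.
    by rewrite /pinst -/(_ c X Y) lG.
  - move=> k X pX.
    pose h (p : ('I_k * {ffun 'I_t -> J}) * B) : 'I_k * (B * {ffun 'I_t -> J}) :=
      (p.1.1, (p.2, p.1.2)).
    have := cp_idL (HGz z).1 (psd_reindex h pX).
    move=> /(psd_reindex (fun p : 'I_k * {ffun 'I_t.+1 -> J} =>
      ((p.1, restr p.2), p.2 ord_max))).
    by [].
  - move=> X pX; rewrite pinst_trace trace_slices; apply: ler_sum => r _.
    by apply: nG; exact: (psd_reindex (fun i => (i, r)) pX).
move=> X; transitivity (\sum_z trace (pinst G z X)); first by rewrite exchange_big.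
under eq_bigr do rewrite pinst_trace; rewrite exchange_big trace_slices /=.
apply: eq_bigr => r _; rewrite -HGt; exact: exchange_big.
Qed.

Definition castf (T : Type) m n (e : m = n) (a : {ffun 'I_n -> T}) : {ffun 'I_m -> T} :=
  [ffun i => a (cast_ord e i)].

Lemma ecast_op m n (e : m = n) (Y : op R ({ffun 'I_m -> J} * B)%type) a b :
  (ecast j (op R ({ffun 'I_j -> J} * B)%type) e Y) a b =
  Y (castf e a.1, a.2) (castf e b.1, b.2).
Proof.
case: n / e a b => a b /=; have castid (x : {ffun 'I_m -> J}) : castf erefl x = x.
  by apply/ffunP => i; rewrite ffunE cast_ord_id.
by rewrite !castid -!surjective_pairing.
Qed.

Definition lft t k (a : {ffun 'I_(t + k) -> J}) : {ffun 'I_t -> J} :=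
  [ffun i => a (lshift k i)].

(** A positionwise instrument never revisits stored systems, so product inputs stay products. The
    memory state [M] is general so that the induction can move one processed output into it. *)
Lemma run_prod (z0 : Z) k t (zs : seq Z) (M : op R {ffun 'I_t -> J})
  (rho : nat -> op R B) a b : size zs = k ->
  run (fun t => @pinst R B J Z G t) zs
    (fun x y : {ffun 'I_t -> J} * {ffun 'I_k.+1 -> B} =>
       M x.1 y.1 * \prod_(j < k.+1) rho j (x.2 j) (y.2 j)) a b =
  M (lft a.1) (lft b.1) *
  (\prod_(j < k) G (nth z0 zs j) (rho j) (a.1 (rshift t j)) (b.1 (rshift t j))) *
  rho k a.2 b.2.
Proof.
elim: k t zs M rho a b => [|k IH] t zs M rho a b /=.
  move=> _; rewrite ecast_op big_ord0 mulr1 big_ord_recl big_ord0 mulr1 /= !ffunE.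
  by congr (M _ _ * _); apply/ffunP => i; rewrite !ffunE; congr (_ _); apply: val_inj.
case: zs => [//|z zs] [szs]; rewrite ecast_op.
have lG := (HG.1 z).1.1.
pose M' : op R {ffun 'I_t.+1 -> J} := fun x y =>
  M (restr x) (restr y) * G z (rho 0%N) (x ord_max) (y ord_max).
have -> : rstep (pinst G z) (fun x y : {ffun 'I_t -> J} * {ffun 'I_k.+2 -> B} =>
       M x.1 y.1 * \prod_(j < k.+2) rho j (x.2 j) (y.2 j)) =
    (fun x y => M' x.1 y.1 * \prod_(j < k.+1) rho j.+1 (x.2 j) (y.2 j)).
  apply/funext => x; apply/funext => y; rewrite /rstep /idR /pinst /=.
  transitivity (G z (fun i i' => (M (restr x.1) (restr y.1) *
     \prod_(j < k.+1) rho j.+1 (x.2 j) (y.2 j)) * rho 0%N i i') (x.1 ord_max) (y.1 ord_max)).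
    congr (G z _ _ _); apply/funext => i; apply/funext => i'.
    rewrite -mulrA; congr (_ * _); rewrite [LHS]big_ord_recl !tcons0 mulrC; congr (_ * _).
    by apply: eq_bigr => j _; rewrite !tconsS.
  by rewrite linear_mapZ // /M' mulrAC.
rewrite (IH _ _ _ (fun j => rho j.+1)) //= /M' big_ord_recl /=.
have e1 (c : {ffun 'I_(t + k.+1) -> J}) : restr (lft (castf (addSnnS t k) c)) = lft c.
  by apply/ffunP => i; rewrite !ffunE; congr (c _); apply: val_inj.
have e2 (c : {ffun 'I_(t + k.+1) -> J}) :
    lft (castf (addSnnS t k) c) ord_max = c (rshift t ord0).
  by rewrite !ffunE; congr (c _); apply: val_inj; rewrite /= addn0.
rewrite !e1 !e2 !mulrA; congr (_ * _ * _); apply: eq_bigr => j _.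
have e3 (c : {ffun 'I_(t + k.+1) -> J}) :
    castf (addSnnS t k) c (rshift t.+1 j) = c (rshift t (lift ord0 j)).
  by rewrite !ffunE; congr (c _); apply: val_inj; rewrite /= /bump /= addSnnS.
by rewrite !e3.
Qed.

End PositionwiseInstrument.

Section ProductCode.
Context {R : realType} {A1 A2 B J Z1 Z2 X1 X2 : finType}.
Variables (N : op R (A1 * A2)%type -> op R B) (th : X1 -> op R A1) (ph : X2 -> op R A2).
Variable G : (Z1 * Z2)%type -> op R B -> op R J.
Hypotheses (HN : qchannel N) (Hth : forall x, qdensity (th x))
  (Hph : forall x, qdensity (ph x)) (HG : qinstrument G).
Variables (z01 : Z1) (z02 : Z2) (n M1 M2 : nat).
Variables (f1 : nat -> 'I_M1 -> (nat -> Z1) -> X1) (f2 : nat -> 'I_M2 -> (nat -> Z2) -> X2).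
Hypothesis causal1 : forall t m s s', (forall i, (i < t)%N -> s i = s' i) ->
  f1 t m s = f1 t m s'.
Hypothesis causal2 : forall t m s s', (forall i, (i < t)%N -> s i = s' i) ->
  f2 t m s = f2 t m s'.
Variable D : ('I_M1 * 'I_M2)%type -> op R {ffun 'I_n -> J}.
Hypothesis HD : povm D.

Definition chout (x : X1 * X2) : op R B := N (tens (th x.1) (ph x.2)).

Definition prob_out (z : Z1 * Z2) (x : X1 * X2) : R :=
  complex.Re (trace (G z (chout x))).

(* The last channel output is discarded by the decoder: it has no feedback round. *)
Definition prodcode : fb_code R A1 A2 B J Z1 Z2 n M1 M2 := FbCode
  (fun t m z => fun a a' : {ffun 'I_t.+1 -> A1} =>
     \prod_(j < t.+1) th (f1 j m (ext z01 z)) (a j) (a' j))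
  (fun t m z => fun a a' : {ffun 'I_t.+1 -> A2} =>
     \prod_(j < t.+1) ph (f2 j m (ext z02 z)) (a j) (a' j))
  (fun t => @pinst R B J (Z1 * Z2)%type G t)
  (fun m _ _ => fun a b => D m a.1 b.1 * (a.2 == b.2)%:R).

Lemma chout_density x : qdensity (chout x).
Proof.
have [p1 t1] := Hth x.1; have [p2 t2] := Hph x.2; split.
  by apply: (cp_psd HN.1); exact: psd_tens.
rewrite HN.2 /trace /tens.
transitivity (trace (th x.1) * trace (ph x.2)); last by rewrite t1 t2 mulr1.
rewrite /trace mulr_suml; under [RHS]eq_bigr do rewrite mulr_sumr.
by rewrite pair_big.
Qed.

Lemma inst_psd z x : psd (G z (chout x)).
Proof. exact: cp_psd (HG.1 z).1 (chout_density x).1. Qed.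

Lemma psd_trace_ge0 (I : finType) (X : op R I) : psd X -> 0 <= trace X.
Proof.
move=> pX; have [w [lam [e l0 _]]] := spectral_op pX.
by rewrite (eigdec_trace e) ler0c sumr_ge0.
Qed.

Lemma trace_inst z x : trace (G z (chout x)) = ((prob_out z x)%:C)%C.
Proof. by rewrite ReK // psd_trace_ge0 //; exact: inst_psd. Qed.

Lemma prob_out_pmf x : is_pmf (prob_out^~ x).
Proof.
split=> [z|]; first by rewrite Re_ge0 // psd_trace_ge0 //; exact: inst_psd.
rewrite -Re_sum; suff -> : \sum_z trace (G z (chout x)) = 1 by [].
by rewrite exchange_big -[LHS]/(trace (fun j j' => \sum_z G z (chout x) j j')) HG.2 (chout_density x).2.
Qed.

Lemma trlast_prod (A X : finType) (rho : X -> op R A) t (x : nat -> X) :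
  (forall x, trace (rho x) = 1) ->
  trlast (fun a a' : {ffun 'I_t.+2 -> A} => \prod_(j < t.+2) rho (x j) (a j) (a' j)) =
  (fun a a' : {ffun 'I_t.+1 -> A} => \prod_(j < t.+1) rho (x j) (a j) (a' j)).
Proof.
move=> t1; apply/funext => a; apply/funext => a'; rewrite /trlast.
under eq_bigr do rewrite big_ord_recr /= !snoc_max.
transitivity ((\prod_(j < t.+1) rho (x j) (a j) (a' j)) * trace (rho (x t.+1))).
  rewrite /trace mulr_sumr; apply: eq_bigr => y _; congr (_ * _).
  by apply: eq_bigr => j _; rewrite !snoc_widen.
by rewrite t1 mulr1.
Qed.

Lemma density_prod (A X : finType) (rho : X -> op R A) t (x : nat -> X) :
  (forall x, qdensity (rho x)) ->
  qdensity (fun a a' : {ffun 'I_t -> A} => \prod_(j < t) rho (x j) (a j) (a' j)).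
Proof.
move=> d; split.
  by apply: (psd_prod (X := fun j : 'I_t => rho (x j))) => j; exact: (d _).1.
by rewrite (trace_prod (fun j : 'I_t => rho (x j))) big1 // => j _; exact: (d _).2.
Qed.

Lemma prodcodeP : is_fb_code prodcode.
Proof.
split; [|split; [|split; [|split; [|split]]]].
- by move=> t m z _; exact: (density_prod _ (fun j => f1 j m (ext z01 z))).
- by move=> t m z _; exact: (density_prod _ (fun j => f2 j m (ext z02 z))).
- move=> t m z _; rewrite /= (trlast_prod _ (fun j => f1 j m (ext z01 z)) (fun x => (Hth x).2)).
  apply/funext => a; apply/funext => a'; apply: eq_bigr => j _.
  rewrite (@causal1 _ _ (ext z01 z) (ext z01 (restr z))) // => i ij.
  by rewrite ext_restr // (leq_trans ij) // -ltnS.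
- move=> t m z _; rewrite /= (trlast_prod _ (fun j => f2 j m (ext z02 z)) (fun x => (Hph x).2)).
  apply/funext => a; apply/funext => a'; apply: eq_bigr => j _.
  rewrite (@causal2 _ _ (ext z02 z) (ext z02 (restr z))) // => i ij.
  by rewrite ext_restr // (leq_trans ij) // -ltnS.
- by move=> t _; exact: pinst_qinstrument.
move=> z1 z2; split=> [m|[a x] [b y]] /=.
  have -> : (fun a b : {ffun 'I_n -> J} * B => D m a.1 b.1 * (a.2 == b.2)%:R) =
      tens (D m) (@idop R B) by [].
  apply: psd_tens; first exact: HD.1.
  apply/psdP => v; rewrite app_idop dot_self ler0c; exact: nrm2_ge0.
rewrite -mulr_suml HD.2 xpair_eqE.
by case: (a == b); case: (x == y); rewrite ?mulr1 ?mulr0.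
Qed.

(** By [run_prod] the final state is a product in which the decoder ignores the last channel output;
    that factor contributes its trace, which is 1. *)
Lemma fb_prob_prod m mh z1 z2 :
  fb_prob N prodcode m mh z1 z2 = complex.Re (trm (D mh)
    (fun a b : {ffun 'I_n -> J} => \prod_(t < n)
       G (z1 t, z2 t) (chout (f1 t m.1 (ext z01 z1), f2 t m.2 (ext z02 z2))) (a t) (b t))).
Proof.
rewrite /fb_prob /=; congr complex.Re.
pose rho j := chout (f1 j m.1 (ext z01 z1), f2 j m.2 (ext z02 z2)).
rewrite (join_inputs_prod (fun t => th (f1 t m.1 (ext z01 z1)))
  (fun t => ph (f2 t m.2 (ext z02 z2)))).
rewrite (tpow_map_prod (fun t => tens (th (f1 t m.1 (ext z01 z1)))
  (ph (f2 t m.2 (ext z02 z2)))) HN.1.1) /=.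
set zs := [seq (z1 t, z2 t) | t <- enum 'I_n].
have -> : (fun a b : {ffun 'I_0 -> J} * {ffun 'I_n.+1 -> B} => \prod_(t < n.+1)
    N (tens (th (f1 t m.1 (ext z01 z1))) (ph (f2 t m.2 (ext z02 z2)))) (a.2 t) (b.2 t)) =
  (fun a b => (fun _ _ => 1) a.1 b.1 * \prod_(t < n.+1) rho t (a.2 t) (b.2 t)).
  by apply/funext => a; apply/funext => b; rewrite mul1r.
have szs : size zs = n by rewrite size_map size_enum_ord.
have runE a b := run_prod HG (z01, z02) (fun _ _ => 1) rho a b szs.
transitivity (\sum_(a : {ffun 'I_n -> J} * B) \sum_(b : {ffun 'I_n -> J} * B)
   D mh a.1 b.1 * (a.2 == b.2)%:R *
   ((\prod_(t < n) G (z1 t, z2 t) (rho t) (b.1 t) (a.1 t)) * rho n b.2 a.2)).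
  apply: eq_bigr => a _; apply: eq_bigr => b _; congr (_ * _).
  rewrite runE mul1r; congr (_ * _); apply: eq_bigr => j _.
  rewrite (nth_map j) ?size_enum_ord // nth_ord_enum.
  by congr (G _ _ _ _); congr (_ _); apply: val_inj.
transitivity (\sum_a \sum_b D mh a b *
   (\prod_(t < n) G (z1 t, z2 t) (rho t) (b t) (a t)) * trace (rho n)).
  rewrite -(pair_big xpredT xpredT (fun a x => \sum_(b : {ffun 'I_n -> J} * B)
    D mh a b.1 * (x == b.2)%:R *
    ((\prod_(t < n) G (z1 t, z2 t) (rho t) (b.1 t) (a t)) * rho n b.2 x))) /=.
  apply: eq_bigr => a _.
  transitivity (\sum_x \sum_b \sum_y D mh a b * (x == y)%:R *
    ((\prod_(t < n) G (z1 t, z2 t) (rho t) (b t) (a t)) * rho n y x)).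
    by apply: eq_bigr => x _; rewrite pair_big.
  rewrite exchange_big; apply: eq_bigr => b _; rewrite /trace mulr_sumr.
  apply: eq_bigr => x _; rewrite (bigD1 x) //= eqxx mulr1 mulrA [X in _ + X]big1 ?addr0 //.
  by move=> y; rewrite eq_sym => /negbTE ->; rewrite mulr0 mul0r.
by apply: eq_bigr => a _; apply: eq_bigr => b _; rewrite (chout_density _).2 mulr1.
Qed.

End ProductCode.

(** * Products and sums along backward and causal chains *)

Lemma onesub_prod_le (R : realType) (I : finType) (p : I -> R) :
  (forall i, 0 <= p i <= 1) -> 1 - \prod_i p i <= \sum_i (1 - p i).
Proof.
move=> h; suff : forall r : seq I, 0 <= \prod_(i <- r) p i <= 1 /\
    1 - \prod_(i <- r) p i <= \sum_(i <- r) (1 - p i) by move=> /(_ (index_enum I))[].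
elim=> [|i r [/andP[r0 r1] IH]]; first by rewrite !big_nil ler01 lexx subrr.
rewrite !big_cons; have /andP[i0 i1] := h i; split.
  by rewrite mulr_ge0 // mulr_ile1.
by nra.
Qed.

Lemma sum_tcons (T : finType) (K : nmodType) t (F : {ffun 'I_t.+1 -> T} -> K) :
  \sum_a F a = \sum_r \sum_x F (tcons x r).
Proof.
rewrite pair_big (reindex (fun p : {ffun 'I_t -> T} * T => tcons p.2 p.1)) //=.
exists (fun a => ([ffun j => a (lift ord0 j)], a ord0)) => [[r x] _|a _] /=.
  by rewrite tcons0; congr pair; apply/ffunP => j; rewrite ffunE tconsS.
by apply/ffunP => j; case: (unliftP ord0 j) => [i ->|->]; rewrite ?tconsS ?tcons0 ?ffunE.
Qed.

Lemma ext_tcons (T : finType) (z0 : T) n (r : {ffun 'I_n -> T}) x i :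
  ext z0 (tcons x r) i.+1 = ext z0 r i.
Proof.
have [lt|ge] := ltnP i n.
  have -> : i.+1 = lift ord0 (Ordinal lt) :> nat by [].
  rewrite ext_ord tconsS -(ext_ord z0); congr ext.
by rewrite /ext !insubF // ltnNge ?ltnS ge.
Qed.

(** Entry 0 occurs only in the first factor, so it can be summed out first; iterating collapses the
    chain. This gives the completeness of a measurement that proceeds from the last block to the
    first. *)
Lemma backward_sum (K : comNzRingType) (T : finType) (k0 : T) n
  (c : nat -> T -> T -> K) (d : nat -> K) :
  (forall b k', \sum_k c b k' k = d b) ->
  \sum_(s : {ffun 'I_n -> T}) \prod_(b < n) c b (ext k0 s b.+1) (s b) =
  \prod_(b < n) d b.
Proof.
elim: n c d => [|n IH] c d cd.
  under eq_bigr do rewrite big_ord0; rewrite big_ord0 sumr_const.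
  by rewrite cardT -cardE card_ffun card_ord expn0.
rewrite sum_tcons [RHS]big_ord_recl.
transitivity (\sum_(r : {ffun 'I_n -> T}) (\sum_x c 0%N (ext k0 r 0%N) x) *
   \prod_(b < n) c b.+1 (ext k0 r b.+1) (r b)).
  apply: eq_bigr => r _; rewrite mulr_suml; apply: eq_bigr => x _.
  rewrite big_ord_recl tcons0 ext_tcons; congr (_ * _); apply: eq_bigr => b _.
  by rewrite tconsS ext_tcons.
under eq_bigr do rewrite cd; rewrite -mulr_sumr (IH (fun b => c b.+1) (fun b => d b.+1)) //.
Qed.

(** No earlier factor sees the latest pair of outcomes, so the outcomes are summed out from the last
    time backwards. This is total probability for inputs that depend on past feedback. *)
Lemma causal_sum (K : comNzRingType) (T1 T2 : finType) (z01 : T1) (z02 : T2)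
  (w : nat -> (nat -> T1) -> (nat -> T2) -> T1 -> T2 -> K) n :
  (forall t s1 s1' s2 s2', (forall i, (i < t)%N -> s1 i = s1' i) ->
     (forall i, (i < t)%N -> s2 i = s2' i) -> w t s1 s2 = w t s1' s2') ->
  (forall t s1 s2, \sum_x \sum_y w t s1 s2 x y = 1) ->
  \sum_(z1 : {ffun 'I_n -> T1}) \sum_(z2 : {ffun 'I_n -> T2})
    \prod_(t < n) w t (ext z01 z1) (ext z02 z2) (z1 t) (z2 t) = 1.
Proof.
move=> cw w1; elim: n => [|n IH].
  under eq_bigr => z1 _ do (under eq_bigr do rewrite big_ord0).
  by rewrite !sumr_const !cardT -!cardE !card_ffun !card_ord !expn0 mulr1n.
rewrite sum_snoc; under eq_bigr do rewrite exchange_big sum_snoc /=.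
rewrite -[RHS]IH; apply: eq_bigr => r1 _; apply: eq_bigr => r2 _.
rewrite -[RHS]mulr1 -[X in _ = _ * X](w1 n (ext z01 r1) (ext z02 r2)) exchange_big mulr_sumr.
apply: eq_bigr => x _; rewrite mulr_sumr; apply: eq_bigr => y _.
rewrite big_ord_recr /= !snoc_max; congr (_ * _).
  apply: eq_bigr => t _; rewrite !snoc_widen.
  by rewrite (cw t _ (ext z01 r1) _ (ext z02 r2)) // => i it;
     rewrite ext_snoc // (ltn_trans it).
by rewrite (cw n _ (ext z01 r1) _ (ext z02 r2)) // => i it; rewrite ext_snoc.
Qed.

(** * Born probabilities of product and block operators *)

Section Traces.
Context {R : realType}.

Lemma trm_prod (T I : finType) (D X : T -> op R I) :
  trm (fun a b : {ffun T -> I} => \prod_t D t (a t) (b t))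
      (fun a b => \prod_t X t (a t) (b t)) = \prod_t trm (D t) (X t).
Proof.
rewrite /trm -(sum_ffun_pair (fun a b : {ffun T -> I} =>
  (\prod_t D t (a t) (b t)) * \prod_t X t (b t) (a t))).
under [RHS]eq_bigr do rewrite pair_big.
rewrite -(sum_ffun_prod (fun t p => D t p.1 p.2 * X t p.2 p.1)).
apply: eq_bigr => f _; rewrite -big_split; apply: eq_bigr => t _ /=.
by rewrite !ffunE.
Qed.

Lemma trm_tens (I J : finType) (D X : op R I) (D' X' : op R J) :
  trm (tens D D') (tens X X') = trm D X * trm D' X'.
Proof.
rewrite /trm /tens mulr_suml -(pair_big xpredT xpredT (fun a a' =>
  \sum_b D a b.1 * D' a' b.2 * (X b.1 a * X' b.2 a'))) /=.
apply: eq_bigr => a _; rewrite mulr_sumr; apply: eq_bigr => a' _.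
rewrite -(pair_big xpredT xpredT (fun b b' =>
  D a b * D' a' b' * (X b a * X' b' a'))) /= mulr_suml.
apply: eq_bigr => b _; rewrite mulr_sumr; apply: eq_bigr => b' _; ring.
Qed.

Lemma trm_bij (I I' : finType) (h : I' -> I) (D X : op R I) : bijective h ->
  trm (fun a b => D (h a) (h b)) (fun a b => X (h a) (h b)) = trm D X.
Proof.
move=> bh; rewrite /trm [RHS](reindex h) /=; last exact: onW_bij.
by apply: eq_bigr => a _; rewrite [RHS](reindex h) //; exact: onW_bij.
Qed.

Lemma trm_idop (I : finType) (X : op R I) : trm (@idop R I) X = trace X.
Proof.
rewrite /trm /trace; apply: eq_bigr => a _; rewrite (bigD1 a) //= /idop eqxx mul1r.
by rewrite big1 ?addr0 // => b; rewrite eq_sym => /negbTE ->; rewrite mul0r.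
Qed.

Lemma trm_suml (I K : finType) (P : pred K) (D : K -> op R I) (X : op R I) :
  trm (fun a b => \sum_(k | P k) D k a b) X = \sum_(k | P k) trm (D k) X.
Proof.
rewrite /trm [RHS]exchange_big; apply: eq_bigr => a _.
by rewrite exchange_big; apply: eq_bigr => b _; rewrite mulr_suml.
Qed.

Lemma trm_sumr (I K : finType) (D : op R I) (X : K -> op R I) :
  trm D (fun a b => \sum_k X k a b) = \sum_k trm D (X k).
Proof.
rewrite /trm [RHS]exchange_big; apply: eq_bigr => a _.
by rewrite exchange_big; apply: eq_bigr => b _; rewrite mulr_sumr.
Qed.

Lemma povm_trm (I K : finType) (D : K -> op R I) (X : op R I) : povm D ->
  \sum_k trm (D k) X = trace X.
Proof.
move=> [_ D1]; rewrite -trm_suml -trm_idop; congr trm.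
by apply/funext => a; apply/funext => b; exact: D1.
Qed.

Lemma povm_trm_le (I K : finType) (D : K -> op R I) (X : op R I) k : povm D -> psd X ->
  complex.Re (trm (D k) X) <= complex.Re (trace X).
Proof.
move=> pD pX; rewrite -(povm_trm _ pD) (bigD1 k) //= ReD lerDl Re_ge0 // sumr_ge0 //.
by move=> l _; rewrite trm_ge0 //; exact: pD.1.
Qed.

Lemma psd_sum (I K : finType) (P : pred K) (X : K -> op R I) :
  (forall k, P k -> psd (X k)) -> psd (fun a b => \sum_(k | P k) X k a b).
Proof.
move=> pX v; suff -> : \sum_i \sum_j conjc (v i) * (\sum_(k | P k) X k i j) * v j =
  \sum_(k | P k) \sum_i \sum_j conjc (v i) * X k i j * v j.
  by apply: sumr_ge0 => k Pk; exact: pX.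
rewrite [RHS]exchange_big; apply: eq_bigr => i _.
rewrite [RHS]exchange_big; apply: eq_bigr => j _.
by rewrite mulr_sumr mulr_suml.
Qed.

Lemma psd_idop (I : finType) : psd (@idop R I).
Proof. by apply/psdP => v; rewrite app_idop dot_self ler0c nrm2_ge0. Qed.

End Traces.

(** * Block Markov coding *)

Section BlockSplitting.
Variables (l nb r : nat).
Local Notation n := (nb.+1 * l.+1 + r)%N.

Lemma bpos_subproof (b : 'I_nb.+1) (j : 'I_l.+1) : (b * l.+1 + j < nb.+1 * l.+1)%N.
Proof.
apply: (@leq_trans (b.+1 * l.+1)); first by rewrite mulSn addnC ltn_add2r.
by rewrite leq_mul2r ltn_ord orbT.
Qed.

Definition bpos (b : 'I_nb.+1) (j : 'I_l.+1) : 'I_n :=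
  lshift r (Ordinal (bpos_subproof b j)).

Definition rpos (i : 'I_r) : 'I_n := rshift (nb.+1 * l.+1) i.

Lemma bpos_div b j : (bpos b j %/ l.+1)%N = b.
Proof. by rewrite /= divnMDl // divn_small ?addn0. Qed.

Lemma bpos_mod b j : (bpos b j %% l.+1)%N = j.
Proof. by rewrite /= modnMDl modn_small. Qed.

Lemma bpos_inord (i : 'I_(nb.+1 * l.+1)) :
  bpos (inord (i %/ l.+1)%N) (inord (i %% l.+1)%N) = lshift r i.
Proof.
apply: val_inj; rewrite /= !inordK ?ltn_pmod //; first by rewrite -divn_eq.
by rewrite ltn_divLR.
Qed.

Section Values.
Context {T : finType}.

Definition bsplit (a : {ffun 'I_n -> T}) :
    {ffun 'I_nb.+1 -> {ffun 'I_l.+1 -> T}} * {ffun 'I_r -> T} :=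
  ([ffun b => [ffun j => a (bpos b j)]], [ffun i => a (rpos i)]).

Lemma bsplit_bij : bijective bsplit.
Proof.
exists (fun p : {ffun 'I_nb.+1 -> {ffun 'I_l.+1 -> T}} * {ffun 'I_r -> T} =>
  [ffun t : 'I_n => match fintype.split t with
    | inl i => p.1 (inord (i %/ l.+1)%N) (inord (i %% l.+1)%N)
    | inr i => p.2 i end]).
  move=> a; apply/ffunP => t; rewrite ffunE.
  case: fintype.splitP => i ti; rewrite !ffunE; congr (a _); last by apply: val_inj; rewrite /= ti.
  by rewrite bpos_inord; apply: val_inj; rewrite /= ti.
move=> [A c]; congr pair; apply/ffunP => b; rewrite !ffunE.
  apply/ffunP => j; rewrite !ffunE (unsplitK (inl _)) /=.
  congr (A _ _); apply: val_inj; rewrite /= inordK.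
  - by rewrite divnMDl // divn_small ?addn0.
  - by rewrite divnMDl // divn_small ?addn0.
  - by rewrite modnMDl modn_small.
  - by rewrite ltn_pmod.
by rewrite (unsplitK (inr _)).
Qed.

End Values.

Lemma prod_blocks (K : comNzRingType) (F : 'I_n -> K) :
  \prod_t F t = (\prod_b \prod_j F (bpos b j)) * \prod_i F (rpos i).
Proof.
rewrite big_split_ord; congr (_ * _); rewrite pair_big.
rewrite (reindex (fun p : 'I_nb.+1 * 'I_l.+1 => Ordinal (bpos_subproof p.1 p.2))) //=.
exists (fun i : 'I_(nb.+1 * l.+1) => (inord (i %/ l.+1)%N, inord (i %% l.+1)%N)).
  move=> [b j] _ /=; congr pair; apply: val_inj; rewrite /= inordK.
  - by rewrite divnMDl // divn_small ?addn0.
  - by rewrite divnMDl // divn_small ?addn0.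
  - by rewrite modnMDl modn_small.
  - by rewrite ltn_pmod.
move=> i _; have /(congr1 val) /= := bpos_inord i.
by move=> e; apply: val_inj.
Qed.

Lemma prod_bsplit (R : realType) (T : finType) (X : 'I_n -> op R T) :
  (fun a b : {ffun 'I_n -> T} => \prod_t X t (a t) (b t)) =
  (fun a b => tens
     (fun A A' : {ffun 'I_nb.+1 -> {ffun 'I_l.+1 -> T}} =>
        \prod_k (fun y y' : {ffun 'I_l.+1 -> T} =>
           \prod_j X (bpos k j) (y j) (y' j)) (A k) (A' k))
     (fun c c' : {ffun 'I_r -> T} => \prod_i X (rpos i) (c i) (c' i))
     (bsplit a) (bsplit b)).
Proof.
apply/funext => a; apply/funext => b; rewrite prod_blocks /tens.
congr (_ * _).
  by apply: eq_bigr => k _; apply: eq_bigr => j _; rewrite !ffunE.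
by apply: eq_bigr => i _; rewrite !ffunE.
Qed.

Lemma sum_block (K : comNzRingType) (T : finType) (F : 'I_n -> T -> K) (b : 'I_nb.+1)
  (g : {ffun 'I_l.+1 -> T} -> K) : (forall t, \sum_x F t x = 1) ->
  \sum_(a : {ffun 'I_n -> T}) (\prod_t F t (a t)) * g [ffun j => a (bpos b j)] =
  \sum_(y : {ffun 'I_l.+1 -> T}) (\prod_j F (bpos b j) (y j)) * g y.
Proof.
move=> F1.
transitivity (\sum_(p : {ffun 'I_nb.+1 -> {ffun 'I_l.+1 -> T}} * {ffun 'I_r -> T})
   ((\prod_k \prod_j F (bpos k j) (p.1 k j)) * (\prod_i F (rpos i) (p.2 i))) * g (p.1 b)).
  rewrite [RHS](reindex bsplit) /=; last exact: onW_bij bsplit_bij.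
  apply: eq_bigr => a _; rewrite prod_blocks ffunE; congr (_ * _ * _).
    by apply: eq_bigr => k _; apply: eq_bigr => j _; rewrite !ffunE.
  by apply: eq_bigr => i _; rewrite !ffunE.
rewrite -(pair_big xpredT xpredT (fun (A : {ffun 'I_nb.+1 -> {ffun 'I_l.+1 -> T}})
    (c : {ffun 'I_r -> T}) => ((\prod_k \prod_j F (bpos k j) (A k j)) * (\prod_i F (rpos i) (c i))) * g (A b))) /=.
transitivity (\sum_(A : {ffun 'I_nb.+1 -> {ffun 'I_l.+1 -> T}})
    (\prod_k \prod_j F (bpos k j) (A k j)) * g (A b)).
  apply: eq_bigr => A _; under eq_bigr do rewrite mulrAC; rewrite -mulr_sumr.
  by rewrite (sum_ffun_prod (fun i => F (rpos i))) [X in _ * X]big1 ?mulr1.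
rewrite (sum_ffun_at_dep (P := fun k (y : {ffun 'I_l.+1 -> T}) =>
  \prod_j F (bpos k j) (y j))) // => k.
by rewrite (sum_ffun_prod (fun j => F (bpos k j))) big1.
Qed.

End BlockSplitting.

Section BlockMarkov.
Context {R : realType} {A1 A2 B J Z1 Z2 X1 X2 B1 B2 : finType}.
Variables (N : op R (A1 * A2)%type -> op R B) (th : X1 -> op R A1) (ph : X2 -> op R A2).
Variable G : (Z1 * Z2)%type -> op R B -> op R J.
Hypotheses (HN : qchannel N) (Hth : forall x, qdensity (th x))
  (Hph : forall x, qdensity (ph x)) (HG : qinstrument G).
Variables (z01 : Z1) (z02 : Z2) (x01 : X1) (x02 : X2) (b01 : B1) (b02 : B2).
Variables (l nb r M1 M2 : nat).
Local Notation n := (nb.+1 * l.+1 + r)%N.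
Let KK := (B1 * B2)%type.
Variables (x1 : KK -> B1 -> {ffun 'I_l.+1 -> X1}) (x2 : KK -> B2 -> {ffun 'I_l.+1 -> X2})
  (d1 : KK -> B1 -> {ffun 'I_l.+1 -> Z1} -> B2)
  (d2 : KK -> B2 -> {ffun 'I_l.+1 -> Z2} -> B1)
  (Dc : KK -> KK -> op R {ffun 'I_l.+1 -> J}).
Hypothesis HDc : forall m, povm (Dc m).
Variables (emb1 : 'I_M1 -> {ffun 'I_nb -> B1}) (emb2 : 'I_M2 -> {ffun 'I_nb -> B2}).
Hypotheses (inj1 : injective emb1) (inj2 : injective emb2).
Variable m0 : 'I_M1 * 'I_M2.

Definition window (T : finType) (s : nat -> T) (b : nat) : {ffun 'I_l.+1 -> T} :=
  [ffun j : 'I_l.+1 => s (b * l.+1 + j)%N].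

(** Only [nb] of the [nb.+1] blocks carry fresh messages. In the last block [ext] supplies the
    default, known to all, from which backward decoding starts; likewise the key of block 0 is a
    default. *)
Definition msg1 (m : 'I_M1) (b : nat) : B1 := ext b01 (emb1 m) b.
Definition msg2 (m : 'I_M2) (b : nat) : B2 := ext b02 (emb2 m) b.
Definition msg (m : 'I_M1 * 'I_M2) (b : nat) : KK := (msg1 m.1 b, msg2 m.2 b).

Definition key (m : 'I_M1 * 'I_M2) (b : nat) : KK :=
  if b is b'.+1 then msg m b' else (b01, b02).

(** The key as transmitter 1 believes it: its own component is exact, the other one is decoded using
    the previous believed key, so errors may propagate. *)
Fixpoint kest1 (m : 'I_M1) (s : nat -> Z1) (b : nat) : KK :=
  if b is b'.+1 then (msg1 m b', d1 (kest1 m s b') (msg1 m b') (window s b'))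
  else (b01, b02).

Fixpoint kest2 (m : 'I_M2) (s : nat -> Z2) (b : nat) : KK :=
  if b is b'.+1 then (d2 (kest2 m s b') (msg2 m b') (window s b'), msg2 m b')
  else (b01, b02).

Definition bf1 (t : nat) (m : 'I_M1) (s : nat -> Z1) : X1 :=
  if (t < nb.+1 * l.+1)%N then
    x1 (kest1 m s (t %/ l.+1)%N) (msg1 m (t %/ l.+1)%N) (inord (t %% l.+1)%N)
  else x01.

Definition bf2 (t : nat) (m : 'I_M2) (s : nat -> Z2) : X2 :=
  if (t < nb.+1 * l.+1)%N then
    x2 (kest2 m s (t %/ l.+1)%N) (msg2 m (t %/ l.+1)%N) (inord (t %% l.+1)%N)
  else x02.

(* The channel inputs that are sent when all feedback estimates are correct; the
   actual run agrees with this one on the outcome strings without an error. *)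
Definition genie (m : 'I_M1 * 'I_M2) (t : nat) : X1 * X2 :=
  if (t < nb.+1 * l.+1)%N then
    (x1 (key m (t %/ l.+1)%N) (msg1 m.1 (t %/ l.+1)%N) (inord (t %% l.+1)%N),
     x2 (key m (t %/ l.+1)%N) (msg2 m.2 (t %/ l.+1)%N) (inord (t %% l.+1)%N))
  else (x01, x02).

Lemma window_causal (T : finType) (s s' : nat -> T) b t : (b.+1 * l.+1 <= t)%N ->
  (forall i, (i < t)%N -> s i = s' i) -> window s b = window s' b.
Proof.
move=> bt e; apply/ffunP => j; rewrite !ffunE e // (leq_trans _ bt) //.
by rewrite mulSn addnC ltn_add2r.
Qed.

Lemma kest1_causal m s s' b t : (b * l.+1 <= t)%N ->
  (forall i, (i < t)%N -> s i = s' i) -> kest1 m s b = kest1 m s' b.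
Proof.
move=> + e; elim: b => [//|b IH] bt /=.
rewrite IH ?(window_causal bt e) // (leq_trans _ bt) // leq_mul2r leqnSn orbT //.
Qed.

Lemma kest2_causal m s s' b t : (b * l.+1 <= t)%N ->
  (forall i, (i < t)%N -> s i = s' i) -> kest2 m s b = kest2 m s' b.
Proof.
move=> + e; elim: b => [//|b IH] bt /=.
rewrite IH ?(window_causal bt e) // (leq_trans _ bt) // leq_mul2r leqnSn orbT //.
Qed.

Lemma bf1_causal t m s s' : (forall i, (i < t)%N -> s i = s' i) ->
  bf1 t m s = bf1 t m s'.
Proof. by move=> e; rewrite /bf1 (kest1_causal m (leq_trunc_div t l.+1) e). Qed.

Lemma bf2_causal t m s s' : (forall i, (i < t)%N -> s i = s' i) ->
  bf2 t m s = bf2 t m s'.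
Proof. by move=> e; rewrite /bf2 (kest2_causal m (leq_trunc_div t l.+1) e). Qed.

(** Stated with the true key and not the believed one, so the event depends on the outcomes of one
    block only. If it holds in every block, induction makes all believed keys true. *)
Definition right1 (m : 'I_M1 * 'I_M2) (b : nat) (y : {ffun 'I_l.+1 -> Z1}) : bool :=
  d1 (key m b) (msg1 m.1 b) y == msg2 m.2 b.

Definition right2 (m : 'I_M1 * 'I_M2) (b : nat) (y : {ffun 'I_l.+1 -> Z2}) : bool :=
  d2 (key m b) (msg2 m.2 b) y == msg1 m.1 b.

Lemma bf1_genie m s t : (t < n)%N ->
  (forall b, (b < nb.+1)%N -> right1 m b (window s b)) -> bf1 t m.1 s = (genie m t).1.
Proof.
move=> _ ok; have kE b : (b < nb.+1)%N -> kest1 m.1 s b = key m b.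
  elim: b => [//|b IH] lb /=; have lb' := ltnW lb.
  by rewrite IH // (eqP (ok _ lb')).
rewrite /bf1 /genie; case: ifP => // lt; rewrite kE // ltn_divLR //.
Qed.

Lemma bf2_genie m s t : (t < n)%N ->
  (forall b, (b < nb.+1)%N -> right2 m b (window s b)) -> bf2 t m.2 s = (genie m t).2.
Proof.
move=> _ ok; have kE b : (b < nb.+1)%N -> kest2 m.2 s b = key m b.
  elim: b => [//|b IH] lb /=; have lb' := ltnW lb.
  by rewrite IH // (eqP (ok _ lb')).
rewrite /bf2 /genie; case: ifP => // lt; rewrite kE // ltn_divLR //.
Qed.

Lemma genie_bpos m (b : 'I_nb.+1) j : genie m (bpos r b j) =
  (x1 (key m b) (msg1 m.1 b) j, x2 (key m b) (msg2 m.2 b) j).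
Proof.
rewrite /genie bpos_div bpos_mod inord_val.
by rewrite (_ : (_ < _)%N = true) //; exact: bpos_subproof.
Qed.

Lemma window_bpos (T : finType) (z0 : T) (z : {ffun 'I_n -> T}) (b : 'I_nb.+1) :
  window (ext z0 z) b = [ffun j => z (bpos r b j)].
Proof. by apply/ffunP => j; rewrite !ffunE -(ext_ord z0). Qed.

(* Backward decoding: the pair of block [b] is read off block [b.+1], whose own
   fresh messages are known by then. *)
Definition dseqb (s : {ffun 'I_nb -> KK}) (b : 'I_nb.+1) : op R {ffun 'I_l.+1 -> J} :=
  if unlift ord0 b is Some c then Dc (ext (b01, b02) s c.+1) (s c)
  else @idop R _.

Definition dseq (s : {ffun 'I_nb -> KK}) : op R {ffun 'I_n -> J} :=
  fun a b => tens
    (fun A A' : {ffun 'I_nb.+1 -> {ffun 'I_l.+1 -> J}} => \prod_k dseqb s k (A k) (A' k))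
    (@idop R {ffun 'I_r -> J}) (bsplit a) (bsplit b).

Lemma dseq_povm : povm dseq.
Proof.
split=> [s|a a'].
  have pE : psd (fun A A' : {ffun 'I_nb.+1 -> {ffun 'I_l.+1 -> J}} =>
      \prod_k dseqb s k (A k) (A' k)).
    apply: psd_prod => k; rewrite /dseqb; case: unliftP => [c _|_]; last exact: psd_idop.
    exact: (HDc _).1.
  exact: (psd_reindex (@bsplit l nb r J) (psd_tens pE (@psd_idop R _))).
rewrite /dseq /tens -mulr_suml.
transitivity (((bsplit a).1 == (bsplit a').1)%:R * ((bsplit a).2 == (bsplit a').2)%:R : R[i]).
  congr (_ * _).
  pose A := (bsplit a).1; pose A' := (bsplit a').1; rewrite -/A -/A'.
  transitivity ((A ord0 == A' ord0)%:R *
     \prod_(b < nb) ((A (lift ord0 b) == A' (lift ord0 b))%:R : R[i])).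
    have inE (b : 'I_nb) : A (lift ord0 b) = A (inord b.+1) /\ A' (lift ord0 b) = A' (inord b.+1).
      have -> : lift ord0 b = inord b.+1 :> 'I_nb.+1.
        by apply: val_inj; rewrite /= inordK // ltnS.
      by [].
    under [X in _ = _ * X]eq_bigr => b _ do rewrite (inE b).1 (inE b).2.
    (* With the matrix entries fixed the elements of [Dc] are scalars, and the sum over [s] is a
       backward chain whose factor [b] measures block [b.+1]; [inord] lets the factors be indexed by
       [nat]. *)
    rewrite -(backward_sum (b01, b02) nb (c := fun b k' k => Dc k' k (A (inord b.+1)) (A' (inord b.+1)))
      (d := fun b => (A (inord b.+1) == A' (inord b.+1))%:R)); last first.
      by move=> b k'; exact: (HDc k').2.
    rewrite mulr_sumr; apply: eq_bigr => s _; rewrite big_ord_recl /dseqb unlift_none.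
    congr (_ * _); apply: eq_bigr => b _.
    by rewrite liftK (inE b).1 (inE b).2.
  rewrite -(big_ord_recl nb (fun b => (A b == A' b)%:R)).
  have [->|ne] := eqVneq A A'; first by rewrite big1 // => b _; rewrite eqxx.
  have /existsP[b nt] : [exists b, A b != A' b].
    apply: contraNT ne => /existsPn h; apply/eqP/ffunP => b.
    by apply/eqP; have := h b; rewrite negbK.
  by rewrite (bigD1 b) //= (negbTE nt) mul0r.
rewrite -(inj_eq (bij_inj (bsplit_bij l nb r (T := J)))) -natrM mulnb.
by rewrite [X in (X : bool)%:R = _](_ : _ = (bsplit a == bsplit a')) //; case: (bsplit a); case: (bsplit a').
Qed.

Definition emb (m : 'I_M1 * 'I_M2) : {ffun 'I_nb -> KK} :=
  [ffun b => (emb1 m.1 b, emb2 m.2 b)].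

(* [emb] need not be onto, so the remaining decoder outcomes go to [m0]. *)
Definition unemb (s : {ffun 'I_nb -> KK}) : 'I_M1 * 'I_M2 :=
  odflt m0 [pick m | emb m == s].

Lemma unembK m : unemb (emb m) = m.
Proof.
rewrite /unemb; case: pickP => [m' /eqP/ffunP e|/(_ m)]; last by rewrite eqxx.
rewrite /= [m']surjective_pairing [m]surjective_pairing; congr pair.
  by apply: inj1; apply/ffunP => b; have := e b; rewrite !ffunE => -[].
by apply: inj2; apply/ffunP => b; have := e b; rewrite !ffunE => -[].
Qed.

Lemma ext_emb m i : ext (b01, b02) (emb m) i = msg m i.
Proof. by rewrite /msg /msg1 /msg2 /ext; case: insubP => // j _ _; rewrite ffunE. Qed.

Definition bdec (mh : 'I_M1 * 'I_M2) : op R {ffun 'I_n -> J} :=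
  fun a b => \sum_(s | unemb s == mh) dseq s a b.

Lemma bdec_povm : povm bdec.
Proof.
split=> [m|a b]; first by apply: psd_sum => s _; exact: dseq_povm.1.
by rewrite -dseq_povm.2 [RHS](partition_big unemb xpredT).
Qed.

Definition outstate (x : X1 * X2) : op R J := fun j j' => \sum_z G z (chout N th ph x) j j'.

Lemma outstate_psd x : psd (outstate x).
Proof. by apply: psd_sum => z _; exact: inst_psd. Qed.

Lemma outstate_trace x : trace (outstate x) = 1.
Proof. by rewrite HG.2 (chout_density HN Hth Hph x).2. Qed.

Definition out1 (x : X1 * X2) (y : Z1) : R := \sum_z prob_out N th ph G (y, z) x.
Definition out2 (x : X1 * X2) (y : Z2) : R := \sum_z prob_out N th ph G (z, y) x.

Definition bin (k m : KK) (j : 'I_l.+1) : X1 * X2 := (x1 k m.1 j, x2 k m.2 j).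

Definition berr1 (k m : KK) : R :=
  \sum_(y : {ffun 'I_l.+1 -> Z1}) (\prod_j out1 (bin k m j) (y j)) *
    (d1 k m.1 y != m.2)%:R.

Definition berr2 (k m : KK) : R :=
  \sum_(y : {ffun 'I_l.+1 -> Z2}) (\prod_j out2 (bin k m j) (y j)) *
    (d2 k m.2 y != m.1)%:R.

Definition berrQ (k m : KK) : R :=
  1 - complex.Re (trm (Dc m k)
    (fun a a' : {ffun 'I_l.+1 -> J} => \prod_j outstate (bin k m j) (a j) (a' j))).

Definition bmcode := prodcode th ph G z01 z02 bf1 bf2 bdec.

Lemma bmcodeP : is_fb_code bmcode.
Proof.
by apply: prodcodeP => //; [exact: bf1_causal | exact: bf2_causal | exact: bdec_povm].
Qed.

Section FixedMessages.
Variable m : 'I_M1 * 'I_M2.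

Let inp (z1 : {ffun 'I_n -> Z1}) (z2 : {ffun 'I_n -> Z2}) (t : nat) : X1 * X2 :=
  (bf1 t m.1 (ext z01 z1), bf2 t m.2 (ext z02 z2)).

Let branch (x : nat -> X1 * X2) (z1 : {ffun 'I_n -> Z1}) (z2 : {ffun 'I_n -> Z2}) :
    op R {ffun 'I_n -> J} :=
  fun a b => \prod_(t < n) G (z1 t, z2 t) (chout N th ph (x t)) (a t) (b t).

Let weight (x : nat -> X1 * X2) (z1 : {ffun 'I_n -> Z1}) (z2 : {ffun 'I_n -> Z2}) : R :=
  \prod_(t < n) prob_out N th ph G (z1 t, z2 t) (x t).

Let good (z1 : {ffun 'I_n -> Z1}) (z2 : {ffun 'I_n -> Z2}) : bool :=
  [forall b : 'I_nb.+1, right1 m b [ffun j => z1 (bpos r b j)] &&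
                        right2 m b [ffun j => z2 (bpos r b j)]].

Lemma branch_psd x z1 z2 : psd (branch x z1 z2).
Proof.
apply: (psd_prod (X := fun t : 'I_n => G (z1 t, z2 t) (chout N th ph (x t)))) => t.
exact: inst_psd.
Qed.

Lemma branch_trace x z1 z2 : complex.Re (trace (branch x z1 z2)) = weight x z1 z2.
Proof.
rewrite (trace_prod (fun t : 'I_n => G (z1 t, z2 t) (chout N th ph (x t)))).
under eq_bigr do rewrite trace_inst //.
by rewrite -rc_prod.
Qed.

Lemma weight_ge0 x z1 z2 : 0 <= weight x z1 z2.
Proof. by apply: prodr_ge0 => t _; apply: (prob_out_pmf HN Hth Hph HG _).1. Qed.

Lemma weight_sum : \sum_z1 \sum_z2 weight (inp z1 z2) z1 z2 = 1.
Proof.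
apply: (causal_sum z01 z02 (w := fun t s1 s2 y1 y2 =>
  prob_out N th ph G (y1, y2) (bf1 t m.1 s1, bf2 t m.2 s2))).
  by move=> t s1 s1' s2 s2' e1 e2; rewrite (bf1_causal _ e1) (bf2_causal _ e2).
move=> t s1 s2; rewrite pair_big.
rewrite -(prob_out_pmf HN Hth Hph HG (bf1 t m.1 s1, bf2 t m.2 s2)).2.
by apply: eq_bigr => -[].
Qed.

Lemma good_inp z1 z2 t : good z1 z2 -> (t < n)%N -> inp z1 z2 t = genie m t.
Proof.
move=> /forallP ok lt; rewrite /inp [RHS]surjective_pairing; congr pair.
  apply: bf1_genie => // b lb; have /andP[+ _] := ok (Ordinal lb).
  by rewrite -(window_bpos z01).
apply: bf2_genie => // b lb; have /andP[_ +] := ok (Ordinal lb).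
by rewrite -(window_bpos z02).
Qed.

(** The genie inputs and the measurement do not depend on the outcomes, so the branches sum to the
    product state [Om]. The probability of the correct backward chain then factorises over the
    blocks, and [onesub_prod_le] adds up the block errors. *)
Lemma genie_success : \sum_z1 \sum_z2 complex.Re (trm (bdec m) (branch (genie m) z1 z2)) >=
  1 - \sum_(b < nb.+1) berrQ (key m b) (msg m b).
Proof.
pose Om : op R {ffun 'I_n -> J} :=
  fun a b => \prod_(t < n) outstate (genie m t) (a t) (b t).
have pOm : psd Om.
  apply: (psd_prod (X := fun t : 'I_n => outstate (genie m t))) => t.
  exact: outstate_psd.
have -> : \sum_z1 \sum_z2 complex.Re (trm (bdec m) (branch (genie m) z1 z2)) =
    complex.Re (trm (bdec m) Om).
  under eq_bigr do rewrite -Re_sum; rewrite -Re_sum; congr complex.Re.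
  rewrite -(sum_ffun_pair (fun z1 z2 => trm (bdec m) (branch (genie m) z1 z2))).
  rewrite -trm_sumr; congr trm; apply/funext => a; apply/funext => b.
  rewrite /Om /outstate -(sum_ffun_prod (fun (t : 'I_n) z => G z (chout N th ph (genie m t)) (a t) (b t))).
  apply: eq_bigr => z _; apply: eq_bigr => t _; rewrite !ffunE.
  by rewrite -surjective_pairing.
pose pb (b : 'I_nb.+1) := trm (dseqb (emb m) b)
  (fun y y' : {ffun 'I_l.+1 -> J} => \prod_j outstate (bin (key m b) (msg m b) j) (y j) (y' j)).
have blk_psd b : psd (fun y y' : {ffun 'I_l.+1 -> J} =>
    \prod_j outstate (bin (key m b) (msg m b) j) (y j) (y' j)).
  apply: (psd_prod (X := fun j => outstate (bin (key m b) (msg m b) j))) => j.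
  exact: outstate_psd.
have blk_tr b : trace (fun y y' : {ffun 'I_l.+1 -> J} =>
    \prod_j outstate (bin (key m b) (msg m b) j) (y j) (y' j)) = 1.
  rewrite (trace_prod (fun j => outstate (bin (key m b) (msg m b) j))) big1 // => j _.
  exact: outstate_trace.
have pb0 b : 0 <= pb b.
  apply: trm_ge0 => //; rewrite /dseqb; case: unliftP => [c _|_]; last exact: psd_idop.
  exact: (HDc _).1.
have step1 : complex.Re (trm (dseq (emb m)) Om) <= complex.Re (trm (bdec m) Om).
  rewrite /bdec trm_suml (bigD1 (emb m)) ?unembK //= ReD lerDl Re_ge0 // sumr_ge0 //.
  by move=> s _; apply: trm_ge0 => //; exact: dseq_povm.1.
have step2 : trm (dseq (emb m)) Om = \prod_b pb b.
  rewrite /Om (prod_bsplit (fun t : 'I_n => outstate (genie m t))) /dseq.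
  rewrite (trm_bij _ _ (bsplit_bij _ _ _)) trm_tens.
  rewrite trm_idop (trace_prod (fun i => outstate (genie m (rpos l nb i)))).
  rewrite [X in _ * X]big1 ?mulr1; last by move=> i _; exact: outstate_trace.
  rewrite (trm_prod (dseqb (emb m)) (fun k y y' => \prod_j outstate (genie m (bpos r k j)) (y j) (y' j))).
  apply: eq_bigr => b _; congr trm; apply/funext => y; apply/funext => y'.
  by apply: eq_bigr => j _; rewrite genie_bpos.
have step3 : complex.Re (\prod_b pb b) = \prod_b complex.Re (pb b).
  have -> : \prod_b pb b = ((\prod_b complex.Re (pb b))%:C)%C.
    by rewrite rc_prod; apply: eq_bigr => b _; rewrite ReK.
  by [].
apply: le_trans step1; rewrite step2 step3 lerBlDr -lerBlDl.
have key1 b : 1 - complex.Re (pb b) <= berrQ (key m b) (msg m b).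
  rewrite /pb /dseqb; case: unliftP => [c ->|_].
    by rewrite ext_emb -(ext_ord (b01, b02)) ext_emb.
  (* Nothing is measured in block 0, whose key is a default; its zero error is bounded by the
     nonnegative [berrQ] so that all blocks have the same form. *)
  rewrite trm_idop blk_tr subrr /berrQ subr_ge0.
  by rewrite (le_trans (povm_trm_le _ (HDc _) (blk_psd b))) // blk_tr.
apply: le_trans (onesub_prod_le _) _.
  move=> b; rewrite Re_ge0 //= /pb /dseqb; case: unliftP => [c _|_].
    by rewrite (le_trans (povm_trm_le _ (HDc _) (blk_psd b))) // blk_tr.
  by rewrite trm_idop blk_tr.
by apply: ler_sum => b _; exact: key1.
Qed.

(** A union bound over blocks. With genie inputs the outcomes at different times are independent, so
    each event is evaluated under the marginal law of its own block. *)
Lemma bad_weight : \sum_z1 \sum_z2 weight (genie m) z1 z2 * (~~ good z1 z2)%:R <=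
  \sum_(b < nb.+1) (berr1 (key m b) (msg m b) + berr2 (key m b) (msg m b)).
Proof.
apply: (@le_trans _ _ (\sum_z1 \sum_z2 \sum_(b < nb.+1) (weight (genie m) z1 z2 *
   (~~ right1 m b [ffun j => z1 (bpos r b j)])%:R + weight (genie m) z1 z2 *
   (~~ right2 m b [ffun j => z2 (bpos r b j)])%:R))).
  apply: ler_sum => z1 _; apply: ler_sum => z2 _.
  under [leRHS]eq_bigr do rewrite -mulrDr; rewrite -mulr_sumr ler_wpM2l ?weight_ge0 //.
  case: (boolP (good z1 z2)) => [_|]; first by rewrite sumr_ge0.
  rewrite negb_forall => /existsP[b]; rewrite negb_and => nb'.
  rewrite (bigD1 b) //= -[leLHS]addr0; apply: lerD; last by apply: sumr_ge0.
  move: nb'; case: (~~ _) => /= [_|->]; last by rewrite add0r.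
  by rewrite lerDl ler0n.
under eq_bigr do rewrite exchange_big; rewrite exchange_big; apply: ler_sum => b _ /=.
under eq_bigr do rewrite big_split; rewrite big_split /= le_eqVlt; apply/orP; left; apply/eqP.
have s1 x : \sum_y out1 x y = 1.
  by rewrite /out1 pair_big -(prob_out_pmf HN Hth Hph HG x).2; apply: eq_bigr => -[].
have s2 x : \sum_y out2 x y = 1.
  rewrite /out2 exchange_big pair_big -(prob_out_pmf HN Hth Hph HG x).2.
  by apply: eq_bigr => -[].
congr (_ + _).
  transitivity (\sum_(z1 : {ffun 'I_n -> Z1}) (\prod_(t < n) out1 (genie m t) (z1 t)) *
     (~~ right1 m b [ffun j => z1 (bpos r b j)])%:R).
    apply: eq_bigr => z1 _; rewrite -mulr_suml; congr (_ * _).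
    by rewrite (sum_ffun_prod (fun (t : 'I_n) z2 => prob_out N th ph G (z1 t, z2) (genie m t))).
  rewrite (sum_block (F := fun (t : 'I_n) y => out1 (genie m t) y) b (fun y => (~~ right1 m b y)%:R)) //.
  apply: eq_bigr => y _; congr (_ * _); apply: eq_bigr => j _; by rewrite genie_bpos.
rewrite exchange_big.
transitivity (\sum_(z2 : {ffun 'I_n -> Z2}) (\prod_(t < n) out2 (genie m t) (z2 t)) *
     (~~ right2 m b [ffun j => z2 (bpos r b j)])%:R).
  apply: eq_bigr => z2 _; rewrite -mulr_suml; congr (_ * _).
  by rewrite (sum_ffun_prod (fun (t : 'I_n) z1 => prob_out N th ph G (z1, z2 t) (genie m t))).
rewrite (sum_block (F := fun (t : 'I_n) y => out2 (genie m t) y) b (fun y => (~~ right2 m b y)%:R)) //.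
apply: eq_bigr => y _; congr (_ * _); apply: eq_bigr => j _; by rewrite genie_bpos.
Qed.

(** On [good] outcome strings the actual and the genie branch coincide. On the others the actual
    success is at least 0, while the genie success is at most the weight of its branch. *)
Lemma message_error :
  \sum_z1 \sum_z2 \sum_(mh | mh != m) fb_prob N bmcode m mh z1 z2 <=
  \sum_(b < nb.+1) (berr1 (key m b) (msg m b) + berr2 (key m b) (msg m b) +
                    berrQ (key m b) (msg m b)).
Proof.
have prE mh z1 z2 : fb_prob N bmcode m mh z1 z2 =
    complex.Re (trm (bdec mh) (branch (inp z1 z2) z1 z2)).
  exact: fb_prob_prod.
have lower z1 z2 : complex.Re (trm (bdec m) (branch (genie m) z1 z2)) -
    weight (genie m) z1 z2 * (~~ good z1 z2)%:R <= fb_prob N bmcode m m z1 z2.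
  rewrite prE; case: (boolP (good z1 z2)) => [g|_] /=.
    rewrite mulr0 subr0 (_ : branch (inp z1 z2) z1 z2 = branch (genie m) z1 z2) //.
    apply/funext => a; apply/funext => b; apply: eq_bigr => t _.
    by rewrite good_inp.
  rewrite mulr1; apply: (@le_trans _ _ 0).
    rewrite subr_le0 -branch_trace; apply: povm_trm_le bdec_povm _; exact: branch_psd.
  by apply: Re_ge0; apply: trm_ge0; [exact: bdec_povm.1 | exact: branch_psd].
(* By [weight_sum] the actual run has total probability 1, so the error is the complement of the
   success. *)
have tot : \sum_z1 \sum_z2 \sum_(mh | mh != m) fb_prob N bmcode m mh z1 z2 =
    1 - \sum_z1 \sum_z2 fb_prob N bmcode m m z1 z2.
  rewrite -weight_sum -sumrB; apply: eq_bigr => z1 _.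
  rewrite -sumrB; apply: eq_bigr => z2 _.
  rewrite -branch_trace -(povm_trm _ bdec_povm) Re_sum [in RHS](bigD1 m) //= prE.
  rewrite addrAC subrr add0r; apply: eq_bigr => mh _; exact: prE.
rewrite tot; apply: (@le_trans _ _ (1 - \sum_z1 \sum_z2
   (complex.Re (trm (bdec m) (branch (genie m) z1 z2)) -
    weight (genie m) z1 z2 * (~~ good z1 z2)%:R))).
  rewrite lerD2l lerN2; apply: ler_sum => z1 _; apply: ler_sum => z2 _; exact: lower.
have -> : \sum_z1 \sum_z2 (complex.Re (trm (bdec m) (branch (genie m) z1 z2)) -
    weight (genie m) z1 z2 * (~~ good z1 z2)%:R) =
  \sum_z1 \sum_z2 complex.Re (trm (bdec m) (branch (genie m) z1 z2)) -
  \sum_z1 \sum_z2 weight (genie m) z1 z2 * (~~ good z1 z2)%:R.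
  by under eq_bigr do rewrite sumrB; rewrite sumrB.
rewrite big_split /=; have := genie_success; have := bad_weight; lra.
Qed.

End FixedMessages.

Lemma block_markov_error :
  fb_error N bmcode <= \sum_(p : ('I_M1 * 'I_M2) * 'I_nb.+1)
    (M1 * M2)%:R^-1 * (berr1 (key p.1 p.2) (msg p.1 p.2) +
      berr2 (key p.1 p.2) (msg p.1 p.2) + berrQ (key p.1 p.2) (msg p.1 p.2)).
Proof.
rewrite -mulr_sumr /fb_error ler_wpM2l ?invr_ge0 ?ler0n //.
rewrite -(pair_big xpredT xpredT (fun m (b : 'I_nb.+1) => berr1 (key m b) (msg m b) +
      berr2 (key m b) (msg m b) + berrQ (key m b) (msg m b))) /=.
by apply: ler_sum => m _; exact: message_error.
Qed.

End BlockMarkov.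

(** * Identically distributed blocks *)

(* Markov's inequality in pointwise form: the tilted product factorizes when
   summed over product alphabets. *)
Lemma exp_tilt (R : realType) (T : finType) (a h : T -> R) (s : R) (b : bool) :
  (forall j, 0 <= a j) -> 0 < s ->
  (b -> (forall j, 0 < a j) -> 0 <= \sum_j h j) ->
  (\prod_j a j) * b%:R <= \prod_j (a j * expR (s * h j)).
Proof.
move=> a0 s0 hb.
have r0 : 0 <= \prod_j (a j * expR (s * h j)).
  by apply: prodr_ge0 => j _; rewrite mulr_ge0 ?expR_ge0.
case: b hb => hb; last by rewrite mulr0.
rewrite mulr1; have [/existsP[j /eqP aj]|npos] := boolP [exists j, a j == 0].
  by rewrite (bigD1 j) //= aj mul0r.
have pos j : 0 < a j.
  by rewrite lt_neqAle a0 andbT eq_sym; move/existsPn: npos; apply.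
rewrite big_split /= -expR_sum -mulr_sumr ler_peMr ?prodr_ge0 //.
by rewrite -expR0 ler_expR mulr_ge0 ?hb // ltW.
Qed.

Lemma ln_prod (R : realType) (T : finType) (a : T -> R) : (forall j, 0 < a j) ->
  ln (\prod_j a j) = \sum_j ln (a j).
Proof.
move=> pos; apply: (@expR_inj R); rewrite expR_sum lnK ?posrE ?prodr_gt0 //.
by apply: eq_bigr => j _; rewrite lnK ?posrE.
Qed.

Lemma sum_const_ord (R : realType) n (c : R) : \sum_(j < n) c = n%:R * c.
Proof. by rewrite sumr_const card_ord mulr_natl. Qed.

Section IID.
Context {R : realType} {U X1 X2 Y1 Y2 J : finType}.
Variables (PU : U -> R) (P1 : U -> X1 -> R) (P2 : U -> X2 -> R).
Variables (W1 : X1 -> X2 -> Y1 -> R) (W2 : X1 -> X2 -> Y2 -> R).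
Variables (rho : X1 * X2 -> op R J) (w : X1 * X2 -> J -> J -> R[i])
  (lam : X1 * X2 -> J -> R) (rhob : op R J) (V : J -> J -> R[i]) (mu : J -> R).
Hypotheses (pU : is_pmf PU) (pP1 : forall u, is_pmf (P1 u))
  (pP2 : forall u, is_pmf (P2 u)) (pW1 : forall x1 x2, is_pmf (W1 x1 x2))
  (pW2 : forall x1 x2, is_pmf (W2 x1 x2))
  (ed : forall x, eigdec (rho x) (w x) (lam x)) (lam0 : forall x k, 0 <= lam x k)
  (lam1 : forall x, \sum_k lam x k = 1) (eb : eigdec rhob V mu)
  (mu0 : forall l, 0 <= mu l)
  (rhobE : forall i j, rhob i j = \sum_x ((inputP PU P1 P2 x)%:C)%C * rho x i j).

Definition jointP1 (t : U * X1 * X2 * Y1) : R :=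
  let: (u, x1, x2, y) := t in PU u * P1 u x1 * P2 u x2 * W1 x1 x2 y.

Definition jointP2 (t : U * X1 * X2 * Y2) : R :=
  let: (u, x1, x2, y) := t in PU u * P1 u x1 * P2 u x2 * W2 x1 x2 y.

Definition dens1 (t : U * X1 * X2 * Y1) : R :=
  let: (u, x1, x2, y) := t in ln (W1 x1 x2 y) - ln (outdist (P2 u) (W1 x1) y).

Definition dens2 (t : U * X1 * X2 * Y2) : R :=
  let: (u, x1, x2, y) := t in
  ln (W2 x1 x2 y) - ln (outdist (P1 u) (fun x1 => W2 x1 x2) y).

(** In nats, I(X2; Y1 | U X1), as the mean of the information density; [info2] is I(X1; Y2 | U
    X2). *)
Definition info1 : R := \sum_t jointP1 t * dens1 t.
Definition info2 : R := \sum_t jointP2 t * dens2 t.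
(** In nats, the mean entropy of the states [rho x]; with [entB], the entropy of the average state,
    [entB - entC] is the Holevo information of the ensemble. *)
Definition entC : R := - \sum_(t : (X1 * X2) * J) inputP PU P1 P2 t.1 * lam t.1 t.2 * ln (lam t.1 t.2).
Definition entB : R := - \sum_l mu l * ln (mu l).

Lemma sum_quad (K : nmodType) (Y : finType) (F : U * X1 * X2 * Y -> K) :
  \sum_t F t = \sum_u \sum_x1 \sum_x2 \sum_y F (u, x1, x2, y).
Proof. by rewrite !pair_big; apply: eq_bigr => -[[[u x1] x2] y]. Qed.

Lemma jointP1_pmf : is_pmf jointP1.
Proof.
split=> [[[[u x1] x2] y]|].
  by rewrite /= !mulr_ge0 ?pU.1 ?(pP1 _).1 ?(pP2 _).1 ?(pW1 _ _).1.
rewrite sum_quad -pU.2; apply: eq_bigr => u _.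
transitivity (\sum_x1 PU u * P1 u x1); last by rewrite -mulr_sumr (pP1 u).2 mulr1.
apply: eq_bigr => x1 _; transitivity (\sum_x2 PU u * P1 u x1 * P2 u x2).
  by apply: eq_bigr => x2 _; rewrite -mulr_sumr (pW1 _ _).2 mulr1.
by rewrite -mulr_sumr (pP2 u).2 mulr1.
Qed.

Lemma jointP2_pmf : is_pmf jointP2.
Proof.
split=> [[[[u x1] x2] y]|].
  by rewrite /= !mulr_ge0 ?pU.1 ?(pP1 _).1 ?(pP2 _).1 ?(pW2 _ _).1.
rewrite sum_quad -pU.2; apply: eq_bigr => u _.
transitivity (\sum_x1 PU u * P1 u x1); last by rewrite -mulr_sumr (pP1 u).2 mulr1.
apply: eq_bigr => x1 _; transitivity (\sum_x2 PU u * P1 u x1 * P2 u x2).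
  by apply: eq_bigr => x2 _; rewrite -mulr_sumr (pW2 _ _).2 mulr1.
by rewrite -mulr_sumr (pP2 u).2 mulr1.
Qed.

Lemma inputP_sum : \sum_x inputP PU P1 P2 x = 1.
Proof.
rewrite exchange_big -pU.2; apply: eq_bigr => u _.
transitivity (\sum_x1 \sum_x2 PU u * P1 u x1 * P2 u x2); first by rewrite pair_big.
under eq_bigr do rewrite -mulr_sumr (pP2 u).2 mulr1.
by rewrite -mulr_sumr (pP1 u).2 mulr1.
Qed.

Lemma mu_sum : \sum_l mu l = 1.
Proof.
apply: (@complexI R); rewrite -(eigdec_trace eb) /trace.
under eq_bigr do rewrite rhobE; rewrite exchange_big /=.
rewrite -inputP_sum rc_sum; apply: eq_bigr => x _; rewrite -mulr_sumr.
by rewrite -[\sum_i _]/(trace (rho x)) (eigdec_trace (ed x)) lam1 mulr1.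
Qed.

Lemma outdist_pos (X Y : finType) (P : X -> R) (W : X -> Y -> R) x y :
  (forall x, 0 <= P x) -> (forall x y, 0 <= W x y) -> 0 < P x -> 0 < W x y ->
  0 < outdist P W y.
Proof.
move=> P0 W0 Px Wx; rewrite /outdist (bigD1 x) //= ltr_pwDl ?mulr_gt0 //.
by rewrite sumr_ge0 // => x' _; rewrite mulr_ge0.
Qed.

Section Block.
Variable L : nat.

Definition PUL (u : {ffun 'I_L -> U}) : R := \prod_j PU (u j).
Definition P1L (u : {ffun 'I_L -> U}) (x : {ffun 'I_L -> X1}) : R := \prod_j P1 (u j) (x j).
Definition P2L (u : {ffun 'I_L -> U}) (x : {ffun 'I_L -> X2}) : R := \prod_j P2 (u j) (x j).
Definition W1L (x1 : {ffun 'I_L -> X1}) (x2 : {ffun 'I_L -> X2}) (y : {ffun 'I_L -> Y1}) : R :=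
  \prod_j W1 (x1 j) (x2 j) (y j).
Definition W2L (x1 : {ffun 'I_L -> X1}) (x2 : {ffun 'I_L -> X2}) (y : {ffun 'I_L -> Y2}) : R :=
  \prod_j W2 (x1 j) (x2 j) (y j).
Definition rhoL (x : {ffun 'I_L -> X1} * {ffun 'I_L -> X2}) : op R {ffun 'I_L -> J} :=
  fun a b => \prod_j rho (x.1 j, x.2 j) (a j) (b j).
Definition wL (x : {ffun 'I_L -> X1} * {ffun 'I_L -> X2}) (k a : {ffun 'I_L -> J}) : R[i] :=
  \prod_j w (x.1 j, x.2 j) (k j) (a j).
Definition lamL (x : {ffun 'I_L -> X1} * {ffun 'I_L -> X2}) (k : {ffun 'I_L -> J}) : R :=
  \prod_j lam (x.1 j, x.2 j) (k j).
Definition rhobL : op R {ffun 'I_L -> J} := fun a b => \prod_j rhob (a j) (b j).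
Definition VL (k a : {ffun 'I_L -> J}) : R[i] := \prod_j V (k j) (a j).
Definition muL (k : {ffun 'I_L -> J}) : R := \prod_j mu (k j).

Lemma pmf_prod (T : finType) (P : 'I_L -> T -> R) : (forall j, is_pmf (P j)) ->
  is_pmf (fun f : {ffun 'I_L -> T} => \prod_j P j (f j)).
Proof.
move=> h; split=> [f|]; first by apply: prodr_ge0 => j _; exact: (h j).1.
by rewrite sum_ffun_prod big1 // => j _; exact: (h j).2.
Qed.

Lemma inputPL x : inputP PUL P1L P2L x = \prod_j inputP PU P1 P2 (x.1 j, x.2 j).
Proof.
rewrite /inputP -(sum_ffun_prod (fun j u => PU u * P1 u (x.1 j) * P2 u (x.2 j))).
by apply: eq_bigr => u _; rewrite !big_split.
Qed.

Lemma rhobLE i j : rhobL i j = \sum_x ((inputP PUL P1L P2L x)%:C)%C * rhoL x i j.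
Proof.
rewrite /rhobL; under eq_bigr do rewrite rhobE.
rewrite -(sum_ffun_prod (fun t x => ((inputP PU P1 P2 x)%:C)%C * rho x (i t) (j t))).
transitivity (\sum_(x1 : {ffun 'I_L -> X1}) \sum_(x2 : {ffun 'I_L -> X2})
   ((inputP PUL P1L P2L (x1, x2))%:C)%C * rhoL (x1, x2) i j); last first.
  by rewrite pair_big; apply: eq_bigr => -[].
rewrite -(sum_ffun_pair (fun x1 x2 => ((inputP PUL P1L P2L (x1, x2))%:C)%C * rhoL (x1, x2) i j)).
apply: eq_bigr => x _; rewrite inputPL rc_prod -big_split; apply: eq_bigr => t _ /=.
by rewrite !ffunE -surjective_pairing.
Qed.

Lemma ed_L x : eigdec (rhoL x) (wL x) (lamL x).
Proof. exact: (eigdec_prod (fun j : 'I_L => ed (x.1 j, x.2 j))). Qed.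

Lemma eb_L : eigdec rhobL VL muL.
Proof. exact: (eigdec_prod (fun j : 'I_L => eb)). Qed.

Lemma lamL_ge0 x k : 0 <= lamL x k.
Proof. by apply: prodr_ge0. Qed.

Lemma lamL_sum x : \sum_k lamL x k = 1.
Proof. by rewrite (sum_ffun_prod (fun j k => lam (x.1 j, x.2 j) k)) big1. Qed.

(** The eigenvalues sum to 1, so at most [sigma^-1] of them can reach [sigma]; this is the rank
    bound for the codeword test. *)
Lemma card_large x (sigma : R) : 0 < sigma ->
  #|[pred k | sigma <= lamL x k]|%:R <= sigma^-1.
Proof.
move=> s0; rewrite -div1r ler_pdivlMr // -[leRHS](lamL_sum x).
rewrite mulr_natl -sumr_const [leRHS](bigID (fun k => sigma <= lamL x k)) /=.
rewrite -[leLHS]addr0; apply: lerD; first by apply: ler_sum => k.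
by apply: sumr_ge0 => k _; exact: lamL_ge0.
Qed.

(** Under the law [mu] the variable [ln mu] has mean [- entB], so a product eigenvalue that is too
    large is an upward deviation of an i.i.d. sum; the tilted sum factorises into [q ^+ L]. *)
Lemma avg_tail (eta s q : R) : 0 < s ->
  \sum_l mu l * expR (s * (ln (mu l) - (- entB) - eta)) <= q ->
  \sum_(l | ~~ (muL l <= expR (- (L%:R * (entB - eta))))) muL l <= q ^+ L.
Proof.
move=> s0 hq.
have q0 l : 0 <= mu l * expR (s * (ln (mu l) - (- entB) - eta)).
  by rewrite mulr_ge0 ?expR_ge0.
apply: (@le_trans _ _ (\prod_(j < L) \sum_l mu l * expR (s * (ln (mu l) - (- entB) - eta)))).
  rewrite -(sum_ffun_prod (fun (_ : 'I_L) l => mu l * expR (s * (ln (mu l) - (- entB) - eta)))).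
  rewrite big_mkcond; apply: ler_sum => l _.
  rewrite (_ : (if _ then _ else _) = muL l * (~~ (muL l <= expR (- (L%:R * (entB - eta)))))%:R); last first.
    by case: (~~ _); rewrite ?mulr1 ?mulr0.
  apply: exp_tilt => //; rewrite -ltNge => lt pos.
  rewrite -(@ltr_ln R) ?posrE ?expR_gt0 ?prodr_gt0 // expRK ln_prod // in lt.
  rewrite !sumrB !sum_const_ord; lra.
rewrite prodr_const card_ord lerXn2r ?nnegrE ?sumr_ge0 //.
by apply: le_trans hq; rewrite sumr_ge0.
Qed.

(** The opposite tail: [- ln lam] has mean [entC], and a conditional eigenvalue that is too small is
    an upward deviation. The input law also factorises, so one single-letter factor [q] suffices. *)
Lemma cond_tail (eta s q : R) : 0 < s ->
  \sum_(t : (X1 * X2) * J) inputP PU P1 P2 t.1 * lam t.1 t.2 *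
     expR (s * (- ln (lam t.1 t.2) - entC - eta)) <= q ->
  \sum_x inputP PUL P1L P2L x *
    \sum_(k | ~~ (expR (- (L%:R * (entC + eta))) <= lamL x k)) lamL x k <= q ^+ L.
Proof.
move=> s0 hq.
have ip0 x : 0 <= inputP PU P1 P2 x by apply: inputP_ge0.
pose F x := \sum_k lam x k * expR (s * (- ln (lam x k) - entC - eta)).
have F0 x : 0 <= F x by rewrite sumr_ge0 // => k _; rewrite mulr_ge0 ?expR_ge0.
have FE : \sum_x inputP PU P1 P2 x * F x = \sum_(t : (X1 * X2) * J)
    inputP PU P1 P2 t.1 * lam t.1 t.2 * expR (s * (- ln (lam t.1 t.2) - entC - eta)).
  rewrite -(pair_big xpredT xpredT (fun x k => inputP PU P1 P2 x * lam x k *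
    expR (s * (- ln (lam x k) - entC - eta)))) /=.
  by apply: eq_bigr => x _; rewrite mulr_sumr; apply: eq_bigr => k _; rewrite mulrA.
apply: (@le_trans _ _ (\prod_(j < L) \sum_x inputP PU P1 P2 x * F x)); last first.
  rewrite prodr_const card_ord lerXn2r ?nnegrE ?FE //.
    by rewrite -FE sumr_ge0 // => x _; rewrite mulr_ge0.
  by apply: le_trans hq; rewrite -FE sumr_ge0 // => x _; rewrite mulr_ge0.
rewrite -(sum_ffun_prod (fun (_ : 'I_L) x => inputP PU P1 P2 x * F x)).
have -> : \sum_(f : {ffun 'I_L -> X1 * X2}) \prod_j (inputP PU P1 P2 (f j) * F (f j)) =
   \sum_(x : {ffun 'I_L -> X1} * {ffun 'I_L -> X2}) inputP PUL P1L P2L x *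
     \prod_j F (x.1 j, x.2 j).
  transitivity (\sum_(x1 : {ffun 'I_L -> X1}) \sum_(x2 : {ffun 'I_L -> X2})
    inputP PUL P1L P2L (x1, x2) * \prod_j F (x1 j, x2 j)); last first.
    by rewrite pair_big; apply: eq_bigr => -[].
  rewrite -(sum_ffun_pair (fun x1 x2 => inputP PUL P1L P2L (x1, x2) * \prod_j F (x1 j, x2 j))).
  apply: eq_bigr => f _; rewrite inputPL -big_split; apply: eq_bigr => j _ /=.
  by rewrite !ffunE -surjective_pairing.
apply: ler_sum => x _; rewrite ler_wpM2l ?inputPL ?prodr_ge0 //.
rewrite -(sum_ffun_prod (fun j k => lam (x.1 j, x.2 j) k *
  expR (s * (- ln (lam (x.1 j, x.2 j) k) - entC - eta)))).
rewrite big_mkcond; apply: ler_sum => k _.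
rewrite (_ : (if _ then _ else _) = lamL x k * (~~ (expR (- (L%:R * (entC + eta))) <= lamL x k))%:R); last first.
  by case: (~~ _); rewrite ?mulr1 ?mulr0.
apply: exp_tilt => //; rewrite -ltNge => lt pos.
rewrite -(@ltr_ln R) ?posrE ?expR_gt0 ?prodr_gt0 // expRK ln_prod // in lt.
rewrite !sumrB sumrN !sum_const_ord; lra.
Qed.

Lemma outdistL (X Y : finType) (P : 'I_L -> X -> R) (W : 'I_L -> X -> Y -> R)
  (y : {ffun 'I_L -> Y}) :
  outdist (fun x : {ffun 'I_L -> X} => \prod_j P j (x j))
    (fun x (y : {ffun 'I_L -> Y}) => \prod_j W j (x j) (y j)) y =
  \prod_j outdist (P j) (W j) (y j).
Proof.
rewrite /outdist -(sum_ffun_prod (fun j x => P j x * W j x (y j))).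
by apply: eq_bigr => x _; rewrite big_split.
Qed.

Lemma sum_quad_prod (Y : finType) (F : U * X1 * X2 * Y -> R) :
  (\sum_t F t) ^+ L = \sum_(u : {ffun 'I_L -> U}) \sum_(x1 : {ffun 'I_L -> X1})
    \sum_(x2 : {ffun 'I_L -> X2}) \sum_(y : {ffun 'I_L -> Y})
    \prod_j F (u j, x1 j, x2 j, y j).
Proof.
rewrite sum_quad -[L in LHS]card_ord -prodr_const.
rewrite -(sum_ffun_prod (fun (_ : 'I_L) u => \sum_x1 \sum_x2 \sum_y F (u, x1, x2, y))).
apply: eq_bigr => u _.
rewrite -(sum_ffun_prod (fun (j : 'I_L) x1 => \sum_x2 \sum_y F (u j, x1, x2, y))).
apply: eq_bigr => x1 _.
rewrite -(sum_ffun_prod (fun (j : 'I_L) x2 => \sum_y F (u j, x1 j, x2, y))).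
apply: eq_bigr => x2 _.
by rewrite -(sum_ffun_prod (fun (j : 'I_L) y => F (u j, x1 j, x2 j, y))).
Qed.

(** Taking logarithms, the sent codeword fails the threshold test exactly when the summed density
    falls below [L%:R * (info1 - eta)], a lower deviation from its mean. *)
Lemma miss1_tail (eta s q : R) : 0 < s ->
  \sum_t jointP1 t * expR (s * (- dens1 t - (- info1) - eta)) <= q ->
  miss1 PUL P1L P2L W1L (expR (- (L%:R * (info1 - eta)))) <= q ^+ L.
Proof.
move=> s0 hq; have [jp0 jp1] := jointP1_pmf.
have h0 : 0 <= \sum_t jointP1 t * expR (s * (- dens1 t - (- info1) - eta)).
  by rewrite sumr_ge0 // => t _; rewrite mulr_ge0 ?expR_ge0.
apply: (@le_trans _ _ ((\sum_t jointP1 t * expR (s * (- dens1 t - (- info1) - eta))) ^+ L)); last first.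
  by rewrite lerXn2r ?nnegrE // (le_trans h0).
rewrite sum_quad_prod /miss1; apply: ler_sum => u _; rewrite mulr_sumr.
apply: ler_sum => x1 _; rewrite !mulr_sumr; apply: ler_sum => x2 _.
rewrite !mulr_sumr; apply: ler_sum => y _.
set b := ~~ _; rewrite !mulrA [leLHS](_ : _ = (\prod_j jointP1 (u j, x1 j, x2 j, y j)) * b%:R); last first.
  by rewrite /PUL /P1L /P2L /W1L -!big_split.
apply: (exp_tilt (h := fun j => - dens1 (u j, x1 j, x2 j, y j) - (- info1) - eta)) => //.
rewrite /b /passes -ltNge => lt pos.
(* [exp_tilt] asks for the inequality only where every joint weight is positive; then each factor is
   positive and logarithms may be taken. *)
have pos4 j : [/\ 0 < PU (u j), 0 < P1 (u j) (x1 j), 0 < P2 (u j) (x2 j) &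
                  0 < W1 (x1 j) (x2 j) (y j)].
  have := pos j; rewrite /jointP1.
  have := pU.1 (u j); have := (pP1 (u j)).1 (x1 j); have := (pP2 (u j)).1 (x2 j).
  have := (pW1 (x1 j) (x2 j)).1 (y j).
  rewrite !le_eqVlt => /orP[/eqP <-|->]; first by rewrite mulr0 ltxx.
  move=> /orP[/eqP <-|->]; first by rewrite mulr0 mul0r ltxx.
  move=> /orP[/eqP <-|->]; first by rewrite mulr0 !mul0r ltxx.
  by move=> /orP[/eqP <-|->]; first by rewrite !mul0r ltxx.
have posb j : 0 < outdist (P2 (u j)) (W1 (x1 j)) (y j).
  have [_ _ p2 pw] := pos4 j; apply: (outdist_pos _ _ p2 pw).
    by move=> x; exact: (pP2 _).1.
  by move=> x y'; exact: (pW1 _ _).1.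
rewrite (outdistL (fun j => P2 (u j)) (fun j => W1 (x1 j))) in lt.
have posW : 0 < W1L x1 x2 y by apply: prodr_gt0 => j _; have [] := pos4 j.
have pg := expR_gt0 (- (L%:R * (info1 - eta))).
have pO : 0 < \prod_j outdist (P2 (u j)) (W1 (x1 j)) (y j).
  by apply: prodr_gt0 => j _; exact: posb.
move: lt; rewrite -ltr_ln ?posrE ?(mulr_gt0 pg posW) ?pO // lnM ?posrE // expRK.
rewrite /W1L !ln_prod //; last by move=> j; have [] := pos4 j.
move=> lt; rewrite !sumrB sumrN sumrB !sum_const_ord; lra.
Qed.

Lemma miss2_tail (eta s q : R) : 0 < s ->
  \sum_t jointP2 t * expR (s * (- dens2 t - (- info2) - eta)) <= q ->
  miss2 PUL P1L P2L W2L (expR (- (L%:R * (info2 - eta)))) <= q ^+ L.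
Proof.
move=> s0 hq; have [jp0 jp1] := jointP2_pmf.
have h0 : 0 <= \sum_t jointP2 t * expR (s * (- dens2 t - (- info2) - eta)).
  by rewrite sumr_ge0 // => t _; rewrite mulr_ge0 ?expR_ge0.
apply: (@le_trans _ _ ((\sum_t jointP2 t * expR (s * (- dens2 t - (- info2) - eta))) ^+ L)); last first.
  by rewrite lerXn2r ?nnegrE // (le_trans h0).
rewrite sum_quad_prod /miss2; apply: ler_sum => u _; rewrite mulr_sumr.
rewrite [leRHS]exchange_big; apply: ler_sum => x2 _; rewrite !mulr_sumr.
apply: ler_sum => x1 _; rewrite !mulr_sumr; apply: ler_sum => y _.
set b := ~~ _; rewrite [leLHS](_ : _ = (\prod_j jointP2 (u j, x1 j, x2 j, y j)) * b%:R); last first.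
  by rewrite /jointP2 !big_split /= /PUL /P1L /P2L /W2L; ring.
apply: (exp_tilt (h := fun j => - dens2 (u j, x1 j, x2 j, y j) - (- info2) - eta)) => //.
rewrite /b /passes -ltNge => lt pos.
have pos4 j : [/\ 0 < PU (u j), 0 < P1 (u j) (x1 j), 0 < P2 (u j) (x2 j) &
                  0 < W2 (x1 j) (x2 j) (y j)].
  have := pos j; rewrite /jointP2.
  have := pU.1 (u j); have := (pP1 (u j)).1 (x1 j); have := (pP2 (u j)).1 (x2 j).
  have := (pW2 (x1 j) (x2 j)).1 (y j).
  rewrite !le_eqVlt => /orP[/eqP <-|->]; first by rewrite mulr0 ltxx.
  move=> /orP[/eqP <-|->]; first by rewrite mulr0 mul0r ltxx.
  move=> /orP[/eqP <-|->]; first by rewrite mulr0 !mul0r ltxx.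
  by move=> /orP[/eqP <-|->]; first by rewrite !mul0r ltxx.
have posb j : 0 < outdist (P1 (u j)) (fun x1 => W2 x1 (x2 j)) (y j).
  have [_ p1 _ pw] := pos4 j; apply: (outdist_pos _ _ p1 pw).
    by move=> x; exact: (pP1 _).1.
  by move=> x y'; exact: (pW2 _ _).1.
rewrite (outdistL (fun j => P1 (u j)) (fun j x1 => W2 x1 (x2 j))) in lt.
have posW : 0 < W2L x1 x2 y by apply: prodr_gt0 => j _; have [] := pos4 j.
have pg := expR_gt0 (- (L%:R * (info2 - eta))).
have pO : 0 < \prod_j outdist (P1 (u j)) (fun x1 => W2 x1 (x2 j)) (y j).
  by apply: prodr_gt0 => j _; exact: posb.
move: lt; rewrite -ltr_ln ?posrE ?(mulr_gt0 pg posW) ?pO // lnM ?posrE // expRK.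
rewrite /W2L !ln_prod //; last by move=> j; have [] := pos4 j.
move=> lt; rewrite !sumrB sumrN sumrB !sum_const_ord; lra.
Qed.

End Block.

(** [q] is the largest of four Chernoff factors and depends on [eta] alone; block length, message
    sets and the weighted family are quantified after it. *)
Lemma iid_code (eta : R) : 0 < eta -> exists q : R, 0 <= q < 1 /\
  forall (L : nat) (M1 M2 T : finType) (nu : T -> R) (k m : T -> M1 * M2),
  M1 -> M2 -> (forall j, 0 <= nu j) ->
  exists (x1 : M1 * M2 -> M1 -> {ffun 'I_L -> X1}) (x2 : M1 * M2 -> M2 -> {ffun 'I_L -> X2})
    (d1 : M1 * M2 -> M1 -> {ffun 'I_L -> Y1} -> M2)
    (d2 : M1 * M2 -> M2 -> {ffun 'I_L -> Y2} -> M1)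
    (D : M1 * M2 -> M1 * M2 -> op R {ffun 'I_L -> J}),
    (forall m, povm (D m)) /\
    \sum_j nu j *
      (\sum_y W1L (x1 (k j) (m j).1) (x2 (k j) (m j).2) y *
         (d1 (k j) (m j).1 y != (m j).2)%:R +
       \sum_y W2L (x1 (k j) (m j).1) (x2 (k j) (m j).2) y *
         (d2 (k j) (m j).2 y != (m j).1)%:R +
       (1 - complex.Re (trm (D (m j) (k j))
              (rhoL (x1 (k j) (m j).1, x2 (k j) (m j).2))))) <=
    (\sum_j nu j) * (19 * q ^+ L +
      (#|M2|.-1)%:R * expR (- (L%:R * (info1 - eta))) +
      (#|M1|.-1)%:R * expR (- (L%:R * (info2 - eta))) +
      4 * ((#|M1| * #|M2|).-1%:R * expR (- (L%:R * (entB - entC - 2 * eta))))).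
Proof.
move=> eta0.
have [s1 [s10 h1]] := @chernoff _ _ _ (fun t => - dens1 t) (- info1) eta jointP1_pmf
  ltac:(by under eq_bigr do rewrite mulrN; rewrite sumrN) eta0.
have [s2 [s20 h2]] := @chernoff _ _ _ (fun t => - dens2 t) (- info2) eta jointP2_pmf
  ltac:(by under eq_bigr do rewrite mulrN; rewrite sumrN) eta0.
have pmu : is_pmf mu by split=> //; exact: mu_sum.
have [s3 [s30 h3]] := @chernoff _ _ _ (fun l => ln (mu l)) (- entB) eta pmu
  ltac:(by rewrite opprK) eta0.
have pjl : is_pmf (fun t : (X1 * X2) * J => inputP PU P1 P2 t.1 * lam t.1 t.2).
  split=> [t|]; first by rewrite mulr_ge0 ?inputP_ge0.
  rewrite -(pair_big xpredT xpredT (fun x k => inputP PU P1 P2 x * lam x k)) /=.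
  rewrite -inputP_sum; apply: eq_bigr => x _; by rewrite -mulr_sumr lam1 mulr1.
have [s4 [s40 h4]] := @chernoff _ _ _ (fun t : (X1 * X2) * J => - ln (lam t.1 t.2)) entC eta pjl
  ltac:(by under eq_bigr do rewrite mulrN; rewrite sumrN) eta0.
set q1 := \sum_t _ in h1; set q2 := \sum_t _ in h2.
set q3 := \sum_t _ in h3; set q4 := \sum_t _ in h4.
pose q := Num.max (Num.max q1 q2) (Num.max q3 q4).
have q1q : q1 <= q by rewrite !le_max lexx.
have q2q : q2 <= q by rewrite !le_max lexx orbT.
have q3q : q3 <= q by rewrite !le_max lexx !orbT.
have q4q : q4 <= q by rewrite !le_max lexx !orbT.
exists q; split.
  rewrite !gt_max h1 h2 h3 h4 !andbT (le_trans _ q3q) // sumr_ge0 // => l _.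
  by rewrite mulr_ge0 ?expR_ge0.
move=> L M1 M2 T nu k m m01 m02 nu0.
pose g1 := expR (- (L%:R * (info1 - eta))); pose g2 := expR (- (L%:R * (info2 - eta))).
pose tt := expR (- (L%:R * (entB - eta))); pose sg := expR (- (L%:R * (entC + eta))).
have cardS (x : {ffun 'I_L -> X1} * {ffun 'I_L -> X2}) :
    #|[pred k | sg <= lamL x k]|%:R <= sg^-1 by apply: card_large; exact: expR_gt0.
have [x1 [x2 [d1 [d2 [D [pD hD]]]]]] :=
  @random_code R _ _ _ _ _ _ M1 M2 (@PUL L) (@P1L L) (@P2L L) (@W1L L) (@W2L L) g1 g2
  (@rhoL L) (@wL L) (@lamL L) (@rhobL L) (@VL L) (@muL L) (fun l => muL l <= tt)
  (fun x => [pred k | sg <= lamL x k]) sg^-1 tt m01 m02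
  (pmf_prod (fun=> pU)) (fun u => pmf_prod (fun j => pP1 (u j)))
  (fun u => pmf_prod (fun j => pP2 (u j)))
  (fun x1 x2 => pmf_prod (fun j => pW1 (x1 j) (x2 j)))
  (fun x1 x2 => pmf_prod (fun j => pW2 (x1 j) (x2 j)))
  (expR_ge0 _) (expR_ge0 _) (@ed_L L) (@lamL_ge0 L) (@lamL_sum L) (@eb_L L) (@rhobLE L)
  (expR_ge0 _) (fun l h => h) cardS T nu k m nu0.
exists x1, x2, d1, d2, D; split => //; apply: le_trans hD _.
rewrite ler_wpM2l ?sumr_ge0 //.
have q0 : 0 <= q by rewrite (le_trans _ q3q) // sumr_ge0 // => l _; rewrite mulr_ge0 ?expR_ge0.
have b1 := miss1_tail L s10 q1q; have b2 := miss2_tail L s20 q2q.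
have b3 := avg_tail L s30 q3q; have b4 := cond_tail L s40 q4q.
(* Rank bound of the codeword test times the largest typical eigenvalue of the average state. *)
have -> : expR (- (L%:R * (entB - entC - 2 * eta))) = sg^-1 * tt.
  by rewrite /sg /tt -expRN -expRD; congr expR; ring.
(* 19 = 1 + 1 + 9 + 8: the two missed threshold tests and the two typicality failures as weighted in
   [code_bound]. *)
rewrite /code_bound -/g1 -/g2 -/tt -/sg in b1 b2 b3 b4 *.
lra.
Qed.

End IID.

(** * Data processing through overlaps of eigenvectors *)

Section DataProcessing.
Context {R : realType} {S X Y J : finType}.
Variables (A : S -> R) (B : S -> X -> R) (lam : S -> X -> J -> R)
  (c : S -> X -> J -> J -> R) (mu : J -> R) (f : J -> Y).
Hypotheses (pA : is_pmf A) (pB : forall s, is_pmf (B s))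
  (lam0 : forall s x k, 0 <= lam s x k) (lam1 : forall s x, \sum_k lam s x k = 1)
  (c0 : forall s x k l, 0 <= c s x k l)
  (cl : forall s x k, \sum_l c s x k l = 1) (ck : forall s x l, \sum_k c s x k l = 1)
  (cf : forall s x k l, f k != f l -> c s x k l = 0)
  (muE : forall l, mu l = \sum_s \sum_x A s * B s x * \sum_k lam s x k * c s x k l).

(** The classical channel obtained by reading the outcome [f k] off an eigenvector index [k] of law
    [lam s x]. *)
Definition coarse (s : S) (x : X) (y : Y) : R := \sum_(k | f k == y) lam s x k.

Lemma coarse_ge0 s x y : 0 <= coarse s x y.
Proof. by apply: sumr_ge0. Qed.

Lemma coarse_ge s x k : lam s x k <= coarse s x (f k).
Proof. by rewrite /coarse (bigD1 k) //= lerDl sumr_ge0. Qed.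

Lemma weight4_ge0 s x k l : 0 <= A s * B s x * lam s x k * c s x k l.
Proof. by rewrite !mulr_ge0 ?pA.1 ?(pB s).1. Qed.

Lemma mu_ge s x k l : A s * B s x * lam s x k * c s x k l <= mu l.
Proof.
rewrite muE (bigD1 s) //= (bigD1 x) //= (bigD1 k) //=.
rewrite -[leLHS]addr0; apply: lerD; last first.
  apply: sumr_ge0 => s' _; apply: sumr_ge0 => x' _.
  by rewrite !mulr_ge0 ?pA.1 ?(pB _).1 // sumr_ge0 // => k' _; rewrite mulr_ge0.
rewrite -[leLHS]addr0; apply: lerD; last first.
  apply: sumr_ge0 => x' _.
  by rewrite !mulr_ge0 ?pA.1 ?(pB _).1 // sumr_ge0 // => k' _; rewrite mulr_ge0.
rewrite -mulrA ler_wpM2l ?mulr_ge0 ?pA.1 ?(pB _).1 // lerDl sumr_ge0 // => k' _.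
by rewrite mulr_ge0.
Qed.

Lemma mu_ge0 l : 0 <= mu l.
Proof.
rewrite muE; apply: sumr_ge0 => s _; apply: sumr_ge0 => x _.
by rewrite !mulr_ge0 ?pA.1 ?(pB _).1 // sumr_ge0 // => k' _; rewrite mulr_ge0.
Qed.

Lemma weight4_sum : \sum_s \sum_x \sum_k \sum_l A s * B s x * lam s x k * c s x k l = 1.
Proof.
rewrite -pA.2; apply: eq_bigr => s _.
transitivity (\sum_x A s * B s x); last by rewrite -mulr_sumr (pB s).2 mulr1.
apply: eq_bigr => x _; transitivity (\sum_k A s * B s x * lam s x k).
  by apply: eq_bigr => k _; rewrite -mulr_sumr cl mulr1.
by rewrite -mulr_sumr lam1 mulr1.
Qed.

Lemma mu_sum1 : \sum_l mu l = 1.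
Proof.
rewrite -weight4_sum; under eq_bigr do rewrite muE.
rewrite exchange_big; apply: eq_bigr => s _; rewrite exchange_big; apply: eq_bigr => x _ /=.
rewrite [RHS]exchange_big; apply: eq_bigr => l _; rewrite mulr_sumr.
by apply: eq_bigr => k _; rewrite mulrA.
Qed.

(* Gibbs' inequality for the joint law of a pair of eigenvectors (one of each
   conditional state, one of the average state), where [c] is their overlap. *)
Lemma coarse_info_le :
  \sum_s \sum_x A s * B s x *
    (\sum_y coarse s x y * (ln (coarse s x y) - ln (outdist (B s) (coarse s) y))) <=
  \sum_s \sum_x A s * B s x *
    (\sum_k \sum_l lam s x k * c s x k l * (ln (lam s x k) - ln (mu l))).
Proof.
pose Wb s y := outdist (B s) (coarse s) y.
pose w4 s x k l := A s * B s x * lam s x k * c s x k l.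
have Wb0 s y : 0 <= Wb s y.
  by apply: sumr_ge0 => x _; rewrite mulr_ge0 ?(pB s).1 ?coarse_ge0.
have -> : \sum_s \sum_x A s * B s x *
    (\sum_y coarse s x y * (ln (coarse s x y) - ln (outdist (B s) (coarse s) y))) =
  \sum_s \sum_x \sum_k \sum_l w4 s x k l * (ln (coarse s x (f k)) - ln (Wb s (f k))).
  apply: eq_bigr => s _; apply: eq_bigr => x _.
  transitivity (\sum_k A s * B s x * lam s x k * (ln (coarse s x (f k)) - ln (Wb s (f k)))).
    rewrite (partition_big f xpredT) //= mulr_sumr; apply: eq_bigr => y _.
    rewrite {1}/coarse mulr_suml mulr_sumr; apply: eq_bigr => k /eqP ->.
    by rewrite !mulrA.
  apply: eq_bigr => k _; rewrite -mulr_suml; congr (_ * _).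
  by rewrite /w4 -mulr_sumr cl mulr1.
have -> : \sum_s \sum_x A s * B s x *
    (\sum_k \sum_l lam s x k * c s x k l * (ln (lam s x k) - ln (mu l))) =
  \sum_s \sum_x \sum_k \sum_l w4 s x k l * (ln (lam s x k) - ln (mu l)).
  apply: eq_bigr => s _; apply: eq_bigr => x _; rewrite mulr_sumr; apply: eq_bigr => k _.
  by rewrite mulr_sumr; apply: eq_bigr => l _; rewrite /w4 !mulrA.
rewrite -subr_ge0.
(* The reference measure: [A s * mu l], times the posterior of [x] given [s] and the outcome [f l],
   times the overlap. Its mass is at most 1: the overlaps sum to 1 over [k], and the posterior to 1,
   or to 0 where [Wb] vanishes. *)
pose r s x k l := A s * B s x * c s x k l * mu l * coarse s x (f l) / Wb s (f l).
apply: (@le_trans _ _ (\sum_s \sum_x \sum_k \sum_l (w4 s x k l - r s x k l))); last first.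
  rewrite -sumrB; apply: ler_sum => s _; rewrite -sumrB; apply: ler_sum => x _.
  rewrite -sumrB; apply: ler_sum => k _; rewrite -sumrB; apply: ler_sum => l _.
  rewrite -mulrBr; have [e|nz] := eqVneq (w4 s x k l) 0.
    rewrite e mul0r sub0r oppr_le0 /r divr_ge0 // !mulr_ge0 ?pA.1 ?(pB s).1 ?mu_ge0 ?coarse_ge0 //.
  have w0 : 0 < w4 s x k l by rewrite lt_neqAle eq_sym nz weight4_ge0.
  have /and4P[As Bs ls cs] : [&& 0 < A s, 0 < B s x, 0 < lam s x k & 0 < c s x k l].
    move: nz; rewrite /w4 !mulf_eq0 !negb_or => /andP[/andP[/andP[a b] l'] c'].
    by rewrite !lt0r a b l' c' pA.1 (pB s).1 lam0 c0.
  have fkl : f k = f l by apply/eqP; apply: contraTT cs => /cf ->; rewrite ltxx.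
  have mul0' : 0 < mu l by apply: lt_le_trans (mu_ge s x k l).
  have cg : 0 < coarse s x (f k) by apply: lt_le_trans (coarse_ge s x k).
  have Wg : 0 < Wb s (f k).
    by apply: outdist_pos Bs cg; [exact: (pB s).1 | move=> ? ?; exact: coarse_ge0].
  pose q := mu l * coarse s x (f k) / (lam s x k * Wb s (f k)).
  have q0 : 0 < q by rewrite divr_gt0 // mulr_gt0.
  have -> : r s x k l = w4 s x k l * q.
    by rewrite /r /w4 /q -fkl; field; rewrite !gt_eqF.
  rewrite -[X in X - _]mulr1 -mulrBr ler_pM2l //.
  have -> : ln (lam s x k) - ln (mu l) - (ln (coarse s x (f k)) - ln (Wb s (f k))) = - ln q.
    rewrite /q lnM ?posrE ?mulr_gt0 ?invr_gt0 ?mulr_gt0 // lnV ?posrE ?mulr_gt0 //.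
    by rewrite !lnM ?posrE //; ring.
  have : ln (1 + (q - 1)) <= q - 1 by apply: le_ln1Dx; lra.
  rewrite [1 + _]addrC subrK; lra.
have -> : \sum_s \sum_x \sum_k \sum_l (w4 s x k l - r s x k l) =
    1 - \sum_s \sum_l A s * mu l * (Wb s (f l) / Wb s (f l)).
  rewrite -weight4_sum -sumrB; apply: eq_bigr => s _.
  have -> : \sum_l A s * mu l * (Wb s (f l) / Wb s (f l)) =
      \sum_x \sum_k \sum_l r s x k l.
    transitivity (\sum_l \sum_x \sum_k r s x k l); last first.
      rewrite exchange_big; apply: eq_bigr => x _; exact: exchange_big.
    apply: eq_bigr => l _; rewrite [X in _ * (X / _)]/Wb /outdist mulr_suml mulr_sumr.
    apply: eq_bigr => x _.
    transitivity (A s * B s x * mu l * coarse s x (f l) / Wb s (f l) * \sum_k c s x k l).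
      by rewrite ck /Wb /outdist; ring.
    by rewrite mulr_sumr; apply: eq_bigr => k _; rewrite /r; ring.
  rewrite -sumrB; apply: eq_bigr => x _; rewrite -sumrB; apply: eq_bigr => k _.
  by rewrite -sumrB.
rewrite subr_ge0; apply: (@le_trans _ _ (\sum_s \sum_l A s * mu l)).
  apply: ler_sum => s _; apply: ler_sum => l _.
  rewrite ler_piMr ?mulr_ge0 ?pA.1 ?mu_ge0 //.
  by have [->|nz] := eqVneq (Wb s (f l)) 0; rewrite ?mul0r ?ler01 // divff.
under eq_bigr do rewrite -mulr_sumr mu_sum1 mulr1.
by rewrite pA.2.
Qed.

End DataProcessing.

(** * Entropic quantities *)

Section ConditionalInformation.
Context {R : realType}.

Lemma shannon_marg (T S : finType) (f : T -> S) (P : T -> R) :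
  shannon (marg f P) = - \sum_t P t * log2 (marg f P (f t)).
Proof.
rewrite /shannon; congr (- _); rewrite [RHS](partition_big f xpredT) //=.
by apply: eq_bigr => s _; rewrite {1}/marg mulr_suml; apply: eq_bigr => t /eqP ->.
Qed.

Lemma marg_comp (T S S' : finType) (f : T -> S) (g : S -> S') (P : T -> R) :
  marg g (marg f P) = marg (g \o f) P.
Proof.
apply/funext => s'; rewrite /marg [RHS](partition_big f (fun s => g s == s')) //=.
apply: eq_bigr => s /eqP gs; apply: eq_bigl => t.
by case: eqP => [->|_]; rewrite ?gs ?eqxx ?andbT // andbF.
Qed.

Section Triple.
Context {SX SY SW : finType}.
Variable Q : SX * SY * SW -> R.

Lemma marg_XW x w : marg (fun q : SX * SY * SW => (q.1.1, q.2)) Q (x, w) = \sum_y Q (x, y, w).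
Proof.
rewrite /marg (reindex_onto (fun y => (x, y, w)) (fun q => q.1.2)) /=.
  by apply: eq_bigl => y; rewrite !eqxx.
by move=> [[x' y'] w'] /= /eqP[-> ->].
Qed.

Lemma marg_YW y w : marg (fun q : SX * SY * SW => (q.1.2, q.2)) Q (y, w) = \sum_x Q (x, y, w).
Proof.
rewrite /marg (reindex_onto (fun x => (x, y, w)) (fun q => q.1.1)) /=.
  by apply: eq_bigl => x; rewrite !eqxx.
by move=> [[x' y'] w'] /= /eqP[-> ->].
Qed.

Lemma marg_W w : marg (fun q : SX * SY * SW => q.2) Q w = \sum_x \sum_y Q (x, y, w).
Proof.
rewrite pair_big /marg (reindex_onto (fun p : SX * SY => (p, w)) (fun q => q.1)) /=.
  by apply: eq_big => [[x y]|[x y]] //=; rewrite !eqxx.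
by move=> [[x' y'] w'] /= /eqP ->.
Qed.

End Triple.

Lemma cCMI_triple (T SX SY SW : finType) (P : T -> R) (fX : T -> SX) (fY : T -> SY)
  (fW : T -> SW) (Q : SX * SY * SW -> R) :
  marg (fun t => (fX t, fY t, fW t)) P = Q ->
  cCMI P fX fY fW = \sum_q Q q * (log2 (Q q) + log2 (\sum_x \sum_y Q (x, y, q.2))
    - log2 (\sum_y Q (q.1.1, y, q.2)) - log2 (\sum_x Q (x, q.1.2, q.2))).
Proof.
move=> QE; rewrite /cCMI QE.
rewrite -[marg (fun t => (fX t, fW t)) P](marg_comp (fun t => (fX t, fY t, fW t)) (fun q => (q.1.1, q.2))).
rewrite -[marg (fun t => (fY t, fW t)) P](marg_comp (fun t => (fX t, fY t, fW t)) (fun q => (q.1.2, q.2))).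
rewrite -[marg fW P](marg_comp (fun t => (fX t, fY t, fW t)) (fun q => q.2)).
rewrite QE !shannon_marg /shannon -!sumrN -!big_split; apply: eq_bigr => -[[x y] w] _ /=.
by rewrite marg_XW marg_YW marg_W; ring.
Qed.

(** The Markov chain enters here: given [(u, v)] the input [x] has law [P u], so [PU], [PV] and [P]
    cancel among the four logarithms and only the information density remains. *)
Lemma cCMI_channel (T U V X Y : finType) (Pt : T -> R) (fX : T -> X) (fY : T -> Y)
  (fW : T -> U * V) (PU : U -> R) (PV : U -> V -> R) (P : U -> X -> R)
  (W : X -> V -> Y -> R) :
  (forall u, 0 <= PU u) -> (forall u, is_pmf (PV u)) -> (forall u, is_pmf (P u)) ->
  (forall x v, is_pmf (W x v)) ->
  marg (fun t => (fX t, fY t, fW t)) Pt =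
    (fun q => PU q.2.1 * P q.2.1 q.1.1 * PV q.2.1 q.2.2 * W q.1.1 q.2.2 q.1.2) ->
  cCMI Pt fX fY fW = (\sum_u \sum_v \sum_x \sum_y PU u * P u x * PV u v * W x v y *
     (ln (W x v y) - ln (outdist (P u) (fun x => W x v) y))) / ln 2.
Proof.
move=> U0 pV pP pW /cCMI_triple ->.
pose F u v x y := PU u * P u x * PV u v * W x v y *
     (ln (W x v y) - ln (outdist (P u) (fun x => W x v) y)).
transitivity (\sum_(q : X * Y * (U * V)) F q.2.1 q.2.2 q.1.1 q.1.2 / ln 2); last first.
  rewrite -mulr_suml; congr (_ / _).
  rewrite -(pair_big xpredT xpredT (fun (p : X * Y) (r : U * V) => F r.1 r.2 p.1 p.2)) /=.
  rewrite exchange_big /= -(pair_big xpredT xpredT (fun u v => \sum_(p : X * Y) F u v p.1 p.2)) /=.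
  apply: eq_bigr => u _; apply: eq_bigr => v _; by rewrite -(pair_big xpredT xpredT (F u v)).
apply: eq_bigr => -[[x y] [u v]] _ /=; rewrite /F.
set Q := PU u * P u x * PV u v * W x v y.
have [->|nz] := eqVneq Q 0; first by rewrite !mul0r.
have /and4P[Us Ps Vs Ws] : [&& 0 < PU u, 0 < P u x, 0 < PV u v & 0 < W x v y].
  move: nz; rewrite /Q !mulf_eq0 !negb_or => /andP[/andP[/andP[a b] c'] d'].
  by rewrite !lt0r a b c' d' U0 (pP u).1 (pV u).1 (pW x v).1.
have Og : 0 < outdist (P u) (fun x => W x v) y.
  by apply: outdist_pos Ps Ws; [exact: (pP u).1 | move=> ? ?; exact: (pW _ _).1].
have -> : \sum_x \sum_y PU u * P u x * PV u v * W x v y = PU u * PV u v.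
  transitivity (\sum_x PU u * PV u v * P u x); last by rewrite -mulr_sumr (pP u).2 mulr1.
  by apply: eq_bigr => x' _; rewrite -mulr_sumr (pW x' v).2; ring.
have -> : \sum_y PU u * P u x * PV u v * W x v y = PU u * P u x * PV u v.
  by rewrite -mulr_sumr (pW x v).2 mulr1.
have -> : \sum_x PU u * P u x * PV u v * W x v y =
    PU u * PV u v * outdist (P u) (fun x => W x v) y.
  by rewrite /outdist mulr_sumr; apply: eq_bigr => x' _; ring.
by rewrite -[RHS]mulrA; congr (_ * _); rewrite /Q /log2 !lnM ?posrE ?mulr_gt0 //; ring.
Qed.

End ConditionalInformation.

(** * Spectra of direct sums, relabelings and diagonal operators *)

Section BlockSpectra.
Context {R : realType}.

Lemma eigdec_block (S I : finType) (Y : S -> op R I) (w : S -> I -> I -> R[i])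
  (lam : S -> I -> R) : (forall s, eigdec (Y s) (w s) (lam s)) ->
  eigdec (fun a b : S * I => (a.1 == b.1)%:R * Y a.1 a.2 b.2)
    (fun k a => (k.1 == a.1)%:R * w k.1 k.2 a.2) (fun k => lam k.1 k.2).
Proof.
move=> e; have delta (s : S) (F : S -> R[i]) : \sum_t (s == t)%:R * F t = F s.
  rewrite (bigD1 s) //= eqxx mul1r big1 ?addr0 // => t; rewrite eq_sym => /negbTE ->.
  by rewrite mul0r.
have delta' (s : S) (F : S -> R[i]) : \sum_t (t == s)%:R * F t = F s.
  by rewrite -[RHS]delta; apply: eq_bigr => t _; rewrite eq_sym.
split; first split.
- move=> [s k] [s' k']; rewrite /dot /=.
  rewrite -(pair_big xpredT xpredT (fun t i => conjc ((s == t)%:R * w s k i) * ((s' == t)%:R * w s' k' i))) /=.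
  transitivity (\sum_t (s == t)%:R * ((s' == t)%:R * dot (w s k) (w s' k'))).
    apply: eq_bigr => t _; rewrite /dot !mulr_sumr; apply: eq_bigr => i _.
    by rewrite conjcM conjc_nat; ring.
  rewrite delta xpair_eqE eq_sym; case: eqP => [->|_]; rewrite ?mul0r // mul1r.
  by rewrite (e s').1.1.
- move=> [s i] [s' i']; rewrite /=.
  rewrite -(pair_big xpredT xpredT (fun t k => (t == s)%:R * w t k i * conjc ((t == s')%:R * w t k i'))) /=.
  transitivity (\sum_t (t == s)%:R * ((t == s')%:R * \sum_k w t k i * conjc (w t k i'))).
    apply: eq_bigr => t _; rewrite !mulr_sumr; apply: eq_bigr => k _.
    by rewrite conjcM conjc_nat; ring.
  rewrite delta' (e s).1.2 xpair_eqE; case: (s == s'); rewrite ?mul0r ?mul1r //.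
- move=> [s i] [s' i']; rewrite /=.
  rewrite -(pair_big xpredT xpredT (fun t k => ((lam t k)%:C)%C * ((t == s)%:R * w t k i * conjc ((t == s')%:R * w t k i')))) /=.
  transitivity (\sum_t (t == s)%:R * ((t == s')%:R * \sum_k ((lam t k)%:C)%C * (w t k i * conjc (w t k i')))).
    by rewrite delta' (e s).2.
  apply: eq_bigr => t _; rewrite !mulr_sumr; apply: eq_bigr => k _.
  by rewrite conjcM conjc_nat; ring.
Qed.

Lemma eigdec_reindex (I I' : finType) (h : I' -> I) (X : op R I) w lam : bijective h ->
  eigdec X w lam ->
  eigdec (fun a b => X (h a) (h b)) (fun k a => w (h k) (h a)) (fun k => lam (h k)).
Proof.
move=> bh [[ow wc] Xe]; have hi := bij_inj bh.
split; first split.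
- move=> k l; rewrite -(inj_eq hi) -ow /dot [RHS](reindex h) //; exact: onW_bij.
- move=> i j; rewrite -(inj_eq hi) -wc [RHS](reindex h) //; exact: onW_bij.
- move=> i j; rewrite Xe (reindex h) //; exact: onW_bij.
Qed.

Lemma eigdec_diag (I : finType) (p : I -> R) :
  eigdec (fun a b : I => (a == b)%:R * ((p a)%:C)%C) (fun k a => (k == a)%:R) p.
Proof.
have delta (s : I) (F : I -> R[i]) : \sum_t (s == t)%:R * F t = F s.
  rewrite (bigD1 s) //= eqxx mul1r big1 ?addr0 // => t; rewrite eq_sym => /negbTE ->.
  by rewrite mul0r.
split; first split.
- by move=> k l; rewrite /dot; under eq_bigr do rewrite conjc_nat; rewrite delta eq_sym.
- move=> i j; under eq_bigr do rewrite conjc_nat eq_sym; by rewrite delta.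
- move=> i j; rewrite -[LHS]/((i == j)%:R * _).
  transitivity (\sum_k (i == k)%:R * ((k == j)%:R * ((p k)%:C)%C)); first by rewrite delta.
  by apply: eq_bigr => k _; rewrite conjc_nat [k == i]eq_sym; ring.
Qed.

Lemma eigdecZ (I : finType) (X : op R I) w lam (a : R) : eigdec X w lam ->
  eigdec (fun i j => (a%:C)%C * X i j) w (fun k => a * lam k).
Proof.
move=> [ow Xe]; split=> // i j; rewrite Xe mulr_sumr; apply: eq_bigr => k _.
by rewrite rcM mulrA.
Qed.

End BlockSpectra.

(* Recording the classical outcome in the memory lets the decoder act on the
   memory alone, as one POVM on the unconditioned post-measurement state. *)
Definition copyG (R : realType) (B Bb Z : finType) (G : Z -> op R B -> op R Bb)
  (z : Z) (X : op R B) : op R (Bb * Z)%type :=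
  fun a b => ((a.2 == z) && (b.2 == z))%:R * G z X a.1 b.1.

Section CopiedOutcome.
Context {R : realType} {B Bb Z : finType}.
Variable G : Z -> op R B -> op R Bb.
Hypothesis HG : qinstrument G.

Lemma psd_mask (I : finType) (X : op R I) (m : pred I) : psd X ->
  psd (fun a b => (m a && m b)%:R * X a b).
Proof.
move=> pX v; have := pX (fun i => (m i)%:R * v i); congr (0 <= _).
apply: eq_bigr => i _; apply: eq_bigr => j _.
by rewrite conjcM conjc_nat -mulnb natrM; ring.
Qed.

Lemma copyG_trace z X : trace (copyG G z X) = trace (G z X).
Proof.
rewrite /trace -(pair_big xpredT xpredT (fun b z' => copyG G z X (b, z') (b, z'))) /=.
apply: eq_bigr => b _; rewrite (bigD1 z) //= /copyG /= eqxx mul1r big1 ?addr0 //.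
by move=> z' /negbTE ->; rewrite mul0r.
Qed.

Lemma copyG_qinstrument : qinstrument (copyG G).
Proof.
split=> [z|X].
  have [[lG cG] nG] := HG.1 z; split; first split.
  - move=> c X Y; apply/funext => a; apply/funext => b.
    by rewrite /copyG lG; ring.
  - move=> k X pX; pose h (a : 'I_k * (Bb * Z)) : 'I_k * Bb := (a.1, a.2.1).
    exact: (psd_mask (fun a : 'I_k * (Bb * Z) => a.2.2 == z) (psd_reindex h (cG k X pX))).
  - by move=> X pX; rewrite copyG_trace; exact: nG.
rewrite -[RHS]HG.2; transitivity (\sum_z trace (copyG G z X)); first exact: exchange_big.
by under eq_bigr do rewrite copyG_trace; rewrite exchange_big.
Qed.

Lemma copyG_sum X a b : \sum_z copyG G z X a b = (a.2 == b.2)%:R * G a.2 X a.1 b.1.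
Proof.
rewrite (bigD1 a.2) //= /copyG eqxx /= [b.2 == _]eq_sym big1 ?addr0 // => z.
by rewrite eq_sym => /negbTE ->; rewrite mul0r.
Qed.

End CopiedOutcome.

(** * Informations of the single-letter state *)

Section SingleLetter.
Context {R : realType} {A1 A2 B Bb U X1 X2 Z1 Z2 : finType}.
Variables (N : op R (A1 * A2)%type -> op R B) (PU : U -> R) (P1 : U -> X1 -> R)
  (P2 : U -> X2 -> R) (th : X1 -> op R A1) (ph : X2 -> op R A2)
  (G : (Z1 * Z2)%type -> op R B -> op R Bb).
Hypotheses (HN : qchannel N) (pU : is_pmf PU) (pP1 : forall u, is_pmf (P1 u))
  (pP2 : forall u, is_pmf (P2 u)) (Hth : forall x, qdensity (th x))
  (Hph : forall x, qdensity (ph x)) (HG : qinstrument G).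
Let J := (Bb * (Z1 * Z2))%type.
Let p := inputP PU P1 P2.
Let HC := copyG_qinstrument HG.

Definition omega1 (x : X1 * X2) : op R J := outstate N th ph (copyG G) x.
Definition omegab : op R J := fun a b => \sum_x ((p x)%:C)%C * omega1 x a b.
Definition law1 (x1 : X1) (x2 : X2) : Z1 -> R := out1 N th ph (copyG G) (x1, x2).
Definition law2 (x1 : X1) (x2 : X2) : Z2 -> R := out2 N th ph (copyG G) (x1, x2).

Lemma omega1E x a b : omega1 x a b = (a.2 == b.2)%:R * G a.2 (chout N th ph x) a.1 b.1.
Proof. exact: copyG_sum. Qed.

Lemma law1_pmf x1 x2 : is_pmf (law1 x1 x2).
Proof.
have pp := prob_out_pmf HN Hth Hph HC (x1, x2); split=> [y|].
  by apply: sumr_ge0 => z _; exact: pp.1.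
by rewrite -pp.2 /law1 /out1 pair_big; apply: eq_bigr => -[].
Qed.

Lemma law2_pmf x1 x2 : is_pmf (law2 x1 x2).
Proof.
have pp := prob_out_pmf HN Hth Hph HC (x1, x2); split=> [y|].
  by apply: sumr_ge0 => z _; exact: pp.1.
by rewrite -pp.2 /law2 /out2 exchange_big pair_big; apply: eq_bigr => -[].
Qed.

Lemma p_ge0 x : 0 <= p x.
Proof. exact: inputP_ge0. Qed.

Lemma sum_inputP (F : X1 * X2 -> R) :
  \sum_x p x * F x = \sum_u \sum_x1 \sum_x2 PU u * P1 u x1 * P2 u x2 * F (x1, x2).
Proof.
under eq_bigr do rewrite /p /inputP mulr_suml; rewrite exchange_big.
by apply: eq_bigr => u _; rewrite pair_big; apply: eq_bigr => -[].
Qed.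

(* The eigenbases are chosen compatible with the decomposition along the
   classical outcome register, so that overlaps between different outcomes vanish. *)
Lemma single_spectra : exists (w : X1 * X2 -> J -> J -> R[i]) (lam : X1 * X2 -> J -> R)
    (V : J -> J -> R[i]) (mu : J -> R),
  [/\ forall x, eigdec (omega1 x) (w x) (lam x), forall x k, 0 <= lam x k,
      eigdec omegab V mu, forall l, 0 <= mu l &
      (forall x k l, k.2 != l.2 -> dot (V l) (w x k) = 0) /\
      (forall x z, prob_out N th ph (copyG G) z x = \sum_b lam x (b, z))].
Proof.
have pG x z : psd (G z (chout N th ph x)) by exact: inst_psd.
have /choice[wl wlP] (q : (X1 * X2) * (Z1 * Z2)) : exists wl : (Bb -> Bb -> R[i]) * (Bb -> R),
    eigdec (G q.2 (chout N th ph q.1)) wl.1 wl.2 /\ forall k, 0 <= wl.2 k.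
  by have [w [lam [e l0 _]]] := spectral_op (pG q.1 q.2); exists (w, lam).
pose rb z : op R Bb := fun b b' => \sum_x ((p x)%:C)%C * G z (chout N th ph x) b b'.
have prb z : psd (rb z).
  apply: (psd_sum (X := fun x b b' => ((p x)%:C)%C * G z (chout N th ph x) b b')) => x _.
  have [w [lam [e l0 _]]] := spectral_op (pG x z).
  by apply: (eigdec_psd (eigdecZ (p x) e)) => k; rewrite mulr_ge0 ?p_ge0.
have /choice[Vm VmP] z : exists Vm : (Bb -> Bb -> R[i]) * (Bb -> R),
    eigdec (rb z) Vm.1 Vm.2 /\ forall k, 0 <= Vm.2 k.
  by have [w [lam [e l0 _]]] := spectral_op (prb z); exists (w, lam).
pose h (a : J) : (Z1 * Z2) * Bb := (a.2, a.1).
have bh : bijective h by exists (fun a => (a.2, a.1)) => -[].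
exists (fun x k a => (k.2 == a.2)%:R * (wl (x, k.2)).1 k.1 a.1), (fun x k => (wl (x, k.2)).2 k.1),
  (fun k a => (k.2 == a.2)%:R * (Vm k.2).1 k.1 a.1), (fun k => (Vm k.2).2 k.1).
split.
- move=> x; have := eigdec_reindex bh (eigdec_block (fun z => (wlP (x, z)).1)).
  congr eigdec; apply/funext => a; apply/funext => b; by rewrite omega1E.
- by move=> x k; exact: (wlP _).2.
- have := eigdec_reindex bh (eigdec_block (fun z => (VmP z).1)).
  congr eigdec; apply/funext => a; apply/funext => b.
  rewrite /omegab /= mulr_sumr; apply: eq_bigr => x _; rewrite omega1E; ring.
- by move=> l; exact: (VmP _).2.
split=> [x k l kl|x z].
  rewrite /dot big1 // => a _; have [la|_] := eqVneq l.2 a.2; last by rewrite mul0r conjc0 mul0r.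
  by rewrite -la (negbTE kl) mul0r mulr0.
by rewrite /prob_out copyG_trace (eigdec_trace (wlP (x, z)).1).
Qed.

Lemma omega1_trace x : trace (omega1 x) = 1.
Proof. exact: outstate_trace. Qed.

Section Spectra.
Variables (w : X1 * X2 -> J -> J -> R[i]) (lam : X1 * X2 -> J -> R)
  (V : J -> J -> R[i]) (mu : J -> R).
Hypotheses (ed : forall x, eigdec (omega1 x) (w x) (lam x))
  (lam0 : forall x k, 0 <= lam x k) (eb : eigdec omegab V mu)
  (mu0 : forall l, 0 <= mu l)
  (orth : forall x k l, k.2 != l.2 -> dot (V l) (w x k) = 0)
  (probE : forall x z, prob_out N th ph (copyG G) z x = \sum_b lam x (b, z)).

Lemma lam_sum x : \sum_k lam x k = 1.
Proof. by apply: (@complexI R); rewrite -(eigdec_trace (ed x)) omega1_trace. Qed.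

Lemma omega_noU_E a b : qcl_omega_noU N PU P1 P2 th ph G a b =
  (a.1 == b.1)%:R * (((p a.1)%:C)%C * omega1 a.1 a.2 b.2).
Proof.
rewrite /qcl_omega_noU /qcl_omega /= /p /inputP rc_sum mulr_suml mulr_sumr.
apply: eq_bigr => u _; rewrite omega1E xpair_eqE eqxx /= /chout.
by case: a b => [[x1 x2] ja] [xb jb] /=; rewrite -mulnb natrM; ring.
Qed.

(** The state is classical on the inputs, so its eigenvalues are the products [p x * lam x k]. The
    entropy of [p] cancels against that of the input marginal, leaving the Holevo form, converted
    from nats to bits. *)
Lemma qMI_single : qMI (qcl_omega_noU N PU P1 P2 th ph G) =
  (entB mu - entC PU P1 P2 lam) / ln 2.
Proof.
have eA : eigdec (qcl_omega_noU N PU P1 P2 th ph G)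
    (fun k a => (k.1 == a.1)%:R * w k.1 k.2 a.2) (fun k => p k.1 * lam k.1 k.2).
  have := eigdec_block (fun x => eigdecZ (p x) (ed x)).
  by congr eigdec; apply/funext => a; apply/funext => b; rewrite omega_noU_E.
have eX : eigdec (trR (qcl_omega_noU N PU P1 P2 th ph G)) (fun k a => (k == a)%:R) p.
  have := eigdec_diag p; congr eigdec; apply/funext => x; apply/funext => x'.
  rewrite /trR; under eq_bigr do rewrite omega_noU_E /=.
  rewrite -!mulr_sumr -[\sum_i _]/(trace (omega1 x)) omega1_trace mulr1 //.
have eB : eigdec (trL (qcl_omega_noU N PU P1 P2 th ph G)) V mu.
  move: eb; congr eigdec; apply/funext => a; apply/funext => b.
  by rewrite /trL /omegab; apply: eq_bigr => x _; rewrite omega_noU_E /= eqxx mul1r.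
rewrite /qMI (vnS_eig eX p_ge0) (vnS_eig eB mu0) (vnS_eig eA); last first.
  by move=> k; rewrite mulr_ge0 ?p_ge0.
have log2E (T : finType) (q : T -> R) : \sum_t q t * log2 (q t) = (\sum_t q t * ln (q t)) / ln 2.
  by rewrite mulr_suml; apply: eq_bigr => t _; rewrite /log2 mulrA.
rewrite !log2E /entB /entC.
have -> : \sum_(k : (X1 * X2) * J) p k.1 * lam k.1 k.2 * ln (p k.1 * lam k.1 k.2) =
  \sum_x p x * ln (p x) + \sum_(k : (X1 * X2) * J) p k.1 * lam k.1 k.2 * ln (lam k.1 k.2).
  have -> : \sum_x p x * ln (p x) = \sum_(k : (X1 * X2) * J) p k.1 * lam k.1 k.2 * ln (p k.1).
    rewrite -(pair_big xpredT xpredT (fun x k => p x * lam x k * ln (p x))) /=.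
    by apply: eq_bigr => x _; rewrite -mulr_suml -mulr_sumr lam_sum mulr1.
  rewrite -big_split; apply: eq_bigr => -[x k] _ /=.
  have [->|nz] := eqVneq (p x * lam x k) 0; first by rewrite !mul0r addr0.
  have /andP[px lx] : (0 < p x) && (0 < lam x k).
    by move: nz; rewrite mulf_eq0 negb_or !lt0r p_ge0 lam0 !andbT.
  by rewrite lnM ?posrE // mulrDr.
rewrite /p; ring.
Qed.

Lemma mu_overlap l : mu l = \sum_x p x * \sum_k lam x k * sqn (dot (V l) (w x k)).
Proof.
rewrite (quad_avg ed eb) // (bigD1 l) //= eb.1.1 eqxx /sqn conjc1 mulr1 mulr1.
by rewrite big1 ?addr0 // => l' ne; rewrite eb.1.1 (negbTE ne) mulr0 mulr0.
Qed.

(** Both entropies are averaged over one joint law, that of an input with an eigenvector of its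
    state and one of the average state (a Nussbaum-Szkola law). This is the right-hand side of
    [coarse_info_le]. *)
Lemma entropy_gap : entB mu - entC PU P1 P2 lam =
  \sum_x p x * \sum_k \sum_l lam x k * sqn (dot (V l) (w x k)) * (ln (lam x k) - ln (mu l)).
Proof.
have cl x k : \sum_l sqn (dot (V l) (w x k)) = 1.
  by rewrite -(parseval _ eb.1) (onb_nrm2 _ (ed x).1).
have -> : entC PU P1 P2 lam = - \sum_x p x * \sum_k \sum_l
    lam x k * sqn (dot (V l) (w x k)) * ln (lam x k).
  rewrite /entC -(pair_big xpredT xpredT (fun x k => p x * lam x k * ln (lam x k))) /=.
  congr (- _); apply: eq_bigr => x _; rewrite mulr_sumr; apply: eq_bigr => k _.
  by rewrite -mulr_suml -mulr_sumr cl mulr1 mulrA.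
have -> : entB mu = - \sum_x p x * \sum_k \sum_l
    lam x k * sqn (dot (V l) (w x k)) * ln (mu l).
  congr (- _); transitivity (\sum_l \sum_x p x * \sum_k
      lam x k * sqn (dot (V l) (w x k)) * ln (mu l)).
    apply: eq_bigr => l _; rewrite {1}mu_overlap mulr_suml; apply: eq_bigr => x _.
    by rewrite -mulr_suml mulrA.
  rewrite exchange_big; apply: eq_bigr => x _; rewrite -mulr_sumr.
  by congr (_ * _); exact: exchange_big.
rewrite opprK addrC -sumrB; apply: eq_bigr => x _; rewrite -mulrBr; congr (_ * _).
rewrite -sumrB; apply: eq_bigr => k _; rewrite -sumrB; apply: eq_bigr => l _; ring.
Qed.

Lemma sqn0 : sqn (0 : R[i]) = 0.
Proof. by rewrite /sqn mulr0. Qed.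

(** I(X1; Z2 | U X2) is at most I(X1 X2; Bb Z1 Z2): data processing with side information
    [s = (u, x2)]. The outcome can be read off the eigenvector index because overlaps across
    different outcomes vanish. *)
Lemma info2_le : info2 PU P1 P2 law2 <= entB mu - entC PU P1 P2 lam.
Proof.
pose A (s : U * X2) := PU s.1 * P2 s.1 s.2; pose Bx (s : U * X2) := P1 s.1.
pose la (s : U * X2) x1 := lam (x1, s.2).
pose c (s : U * X2) x1 k l := sqn (dot (V l) (w (x1, s.2) k)).
have swap (F : X1 * X2 -> R) : \sum_x p x * F x = \sum_s \sum_x1 A s * Bx s x1 * F (x1, s.2).
  rewrite sum_inputP -(pair_big xpredT xpredT (fun u x2 => \sum_x1 A (u, x2) * Bx (u, x2) x1 * F (x1, x2))) /=.
  apply: eq_bigr => u _; rewrite exchange_big; apply: eq_bigr => x2 _.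
  by apply: eq_bigr => x1 _; rewrite /A /Bx /=; ring.
have coarseE s x1 y : coarse la (fun k : J => k.2.2) s x1 y = law2 x1 s.2 y.
  rewrite /coarse /law2 /out2; under [RHS]eq_bigr do rewrite probE.
  rewrite pair_big (reindex_onto (fun q : Z1 * Bb => (q.2, (q.1, y))) (fun k : J => (k.2.1, k.1))) /=.
    by apply: eq_big => [[z b]|[z b]] //=; rewrite !eqxx.
  by move=> [b [z1 z2]] /= /eqP ->.
have coarseF s : coarse la (fun k : J => k.2.2) s = fun x1 => law2 x1 s.2.
  by apply/funext => x1; apply/funext => y; exact: coarseE.
have h : \sum_s \sum_x A s * Bx s x * (\sum_y coarse la (fun k : J => k.2.2) s x y *
    (ln (coarse la (fun k : J => k.2.2) s x y) -
     ln (outdist (Bx s) (coarse la (fun k : J => k.2.2) s) y))) <=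
  \sum_s \sum_x A s * Bx s x * (\sum_k \sum_l la s x k * c s x k l *
    (ln (la s x k) - ln (mu l))).
  apply: coarse_info_le.
  - split=> [s|]; first by rewrite mulr_ge0 ?pU.1 ?(pP2 _).1.
    rewrite -(pair_big xpredT xpredT (fun u x2 => PU u * P2 u x2)) /= -pU.2.
    by apply: eq_bigr => u _; rewrite -mulr_sumr (pP2 u).2 mulr1.
  - by move=> s; exact: pP1.
  - by move=> s x k; exact: lam0.
  - by move=> s x; exact: lam_sum.
  - by move=> s x k l; exact: sqn_ge0.
  - by move=> s x k; rewrite /c -(parseval _ eb.1) (onb_nrm2 _ (ed _).1).
  - move=> s x l; rewrite /c; under eq_bigr do rewrite dot_conj sqn_conj.
    by rewrite -(parseval _ (ed _).1) (onb_nrm2 _ eb.1).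
  - move=> s x k l kl; rewrite /c orth ?sqn0 //.
    by apply: contraNneq kl => ->.
  - by move=> l; rewrite mu_overlap (swap (fun x => \sum_k lam x k * sqn (dot (V l) (w x k)))).
move: h; rewrite -(swap (fun x => \sum_k \sum_l lam x k *
   sqn (dot (V l) (w x k)) * (ln (lam x k) - ln (mu l)))) -entropy_gap.
apply: le_trans; rewrite le_eqVlt; apply/orP; left; apply/eqP.
rewrite /info2 sum_quad.
rewrite -(pair_big xpredT xpredT (fun u x2 => \sum_x A (u, x2) * Bx (u, x2) x *
  (\sum_y coarse la (fun k : J => k.2.2) (u, x2) x y *
    (ln (coarse la (fun k : J => k.2.2) (u, x2) x y) -
     ln (outdist (Bx (u, x2)) (coarse la (fun k : J => k.2.2) (u, x2)) y))))) /=.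
apply: eq_bigr => u _; rewrite exchange_big; apply: eq_bigr => x2 _.
apply: eq_bigr => x1 _; rewrite mulr_sumr; apply: eq_bigr => y _.
by rewrite coarseF /A /Bx /=; ring.
Qed.

Lemma info1_le : info1 PU P1 P2 law1 <= entB mu - entC PU P1 P2 lam.
Proof.
pose A (s : U * X1) := PU s.1 * P1 s.1 s.2; pose Bx (s : U * X1) := P2 s.1.
pose la (s : U * X1) x2 := lam (s.2, x2).
pose c (s : U * X1) x2 k l := sqn (dot (V l) (w (s.2, x2) k)).
have swap (F : X1 * X2 -> R) : \sum_x p x * F x = \sum_s \sum_x2 A s * Bx s x2 * F (s.2, x2).
  rewrite sum_inputP -(pair_big xpredT xpredT (fun u x1 => \sum_x2 A (u, x1) * Bx (u, x1) x2 * F (x1, x2))) /=.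
  by apply: eq_bigr.
have coarseE s x2 y : coarse la (fun k : J => k.2.1) s x2 y = law1 s.2 x2 y.
  rewrite /coarse /law1 /out1; under [RHS]eq_bigr do rewrite probE.
  rewrite pair_big (reindex_onto (fun q : Z2 * Bb => (q.2, (y, q.1))) (fun k : J => (k.2.2, k.1))) /=.
    by apply: eq_big => [[z b]|[z b]] //=; rewrite !eqxx.
  by move=> [b [z1 z2]] /= /eqP ->.
have coarseF s : coarse la (fun k : J => k.2.1) s = law1 s.2.
  by apply/funext => x2; apply/funext => y; exact: coarseE.
have h : \sum_s \sum_x A s * Bx s x * (\sum_y coarse la (fun k : J => k.2.1) s x y *
    (ln (coarse la (fun k : J => k.2.1) s x y) -
     ln (outdist (Bx s) (coarse la (fun k : J => k.2.1) s) y))) <=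
  \sum_s \sum_x A s * Bx s x * (\sum_k \sum_l la s x k * c s x k l *
    (ln (la s x k) - ln (mu l))).
  apply: coarse_info_le.
  - split=> [s|]; first by rewrite mulr_ge0 ?pU.1 ?(pP1 _).1.
    rewrite -(pair_big xpredT xpredT (fun u x1 => PU u * P1 u x1)) /= -pU.2.
    by apply: eq_bigr => u _; rewrite -mulr_sumr (pP1 u).2 mulr1.
  - by move=> s; exact: pP2.
  - by move=> s x k; exact: lam0.
  - by move=> s x; exact: lam_sum.
  - by move=> s x k l; exact: sqn_ge0.
  - by move=> s x k; rewrite /c -(parseval _ eb.1) (onb_nrm2 _ (ed _).1).
  - move=> s x l; rewrite /c; under eq_bigr do rewrite dot_conj sqn_conj.
    by rewrite -(parseval _ (ed _).1) (onb_nrm2 _ eb.1).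
  - move=> s x k l kl; rewrite /c orth ?sqn0 //.
    by apply: contraNneq kl => ->.
  - by move=> l; rewrite mu_overlap (swap (fun x => \sum_k lam x k * sqn (dot (V l) (w x k)))).
move: h; rewrite -(swap (fun x => \sum_k \sum_l lam x k *
   sqn (dot (V l) (w x k)) * (ln (lam x k) - ln (mu l)))) -entropy_gap.
apply: le_trans; rewrite le_eqVlt; apply/orP; left; apply/eqP.
rewrite /info1 sum_quad.
rewrite -(pair_big xpredT xpredT (fun u x1 => \sum_x A (u, x1) * Bx (u, x1) x *
  (\sum_y coarse la (fun k : J => k.2.1) (u, x1) x y *
    (ln (coarse la (fun k : J => k.2.1) (u, x1) x y) -
     ln (outdist (Bx (u, x1)) (coarse la (fun k : J => k.2.1) (u, x1)) y))))) /=.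
apply: eq_bigr => u _; apply: eq_bigr => x1 _.
apply: eq_bigr => x2 _; rewrite mulr_sumr; apply: eq_bigr => y _.
by rewrite coarseF /A /Bx /=; ring.
Qed.

End Spectra.

Lemma cCMI_info2 : cCMI (qcl_pmf N PU P1 P2 th ph G)
    (fun t : (U * X1 * X2 * Z1 * Z2)%type => t.1.1.1.2) (fun t => t.2)
    (fun t => (t.1.1.1.1, t.1.1.2)) = info2 PU P1 P2 law2 / ln 2.
Proof.
rewrite (cCMI_channel (PU := PU) (PV := P2) (P := P1) (W := law2) pU.1 pP2 pP1 law2_pmf).
  congr (_ / _); rewrite /info2 sum_quad; apply: eq_bigr => u _.
  by rewrite exchange_big.
apply/funext => -[[x1 z2] [u x2]]; rewrite /marg.
rewrite (reindex_onto (fun z1 => (u, x1, x2, z1, z2)) (fun t => t.1.2)) /=.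
  rewrite /law2 /out2 mulr_sumr; apply: eq_big => z1; first by rewrite !eqxx.
  by move=> _; rewrite /prob_out copyG_trace.
by move=> [[[[u' x1'] x2'] z1'] z2'] /= /eqP[-> -> -> ->].
Qed.

Lemma cCMI_info1 : cCMI (qcl_pmf N PU P1 P2 th ph G)
    (fun t : (U * X1 * X2 * Z1 * Z2)%type => t.1.1.2) (fun t => t.1.2)
    (fun t => (t.1.1.1.1, t.1.1.1.2)) = info1 PU P1 P2 law1 / ln 2.
Proof.
rewrite (cCMI_channel (PU := PU) (PV := P1) (P := P2) (W := fun x2 x1 => law1 x1 x2)
  pU.1 pP1 pP2 (fun x2 x1 => law1_pmf x1 x2)).
  congr (_ / _); rewrite /info1 sum_quad; apply: eq_bigr => u _.
  apply: eq_bigr => x1 _; apply: eq_bigr => x2 _; apply: eq_bigr => y _ /=.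
  by rewrite [PU u * P2 u x2 * _]mulrAC.
apply/funext => -[[x2 z1] [u x1]]; rewrite /marg.
rewrite (reindex_onto (fun z2 => (u, x1, x2, z1, z2)) (fun t => t.2)) /=.
  rewrite /law1 /out1 mulr_sumr; apply: eq_big => z2; first by rewrite !eqxx.
  by move=> _; rewrite /prob_out copyG_trace /chout /=; ring.
by move=> [[[[u' x1'] x2'] z1'] z2'] /= /eqP[-> -> -> ->].
Qed.

End SingleLetter.

(** * Achievability *)

Lemma pmf_witness (R : realType) (T : finType) (P : T -> R) : is_pmf P -> exists t : T, true.
Proof.
move=> [_ P1]; case: (pickP (@predT T)) => [t _|none]; first by exists t.
by move/eqP: P1; rewrite big_pred0 // eq_sym oner_eq0.
Qed.

Lemma exists_inj (T : finType) (M : nat) : (M <= #|T|)%N ->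
  exists f : 'I_M -> T, injective f.
Proof.
move=> le; exists (fun i => enum_val (widen_ord le i)) => i j /enum_val_inj e.
by apply: val_inj; have := congr1 val e.
Qed.

Section Achievability.
Context {R : realType} {A1 A2 B Bb U X1 X2 Z1 Z2 : finType}.
Variables (N : op R (A1 * A2)%type -> op R B) (PU : U -> R) (P1 : U -> X1 -> R)
  (P2 : U -> X2 -> R) (th : X1 -> op R A1) (ph : X2 -> op R A2)
  (G : (Z1 * Z2)%type -> op R B -> op R Bb).
Hypotheses (HN : qchannel N) (pU : is_pmf PU) (pP1 : forall u, is_pmf (P1 u))
  (pP2 : forall u, is_pmf (P2 u)) (Hth : forall x, qdensity (th x))
  (Hph : forall x, qdensity (ph x)) (HG : qinstrument G).
Variables (w : X1 * X2 -> Bb * (Z1 * Z2) -> Bb * (Z1 * Z2) -> R[i])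
  (lam : X1 * X2 -> Bb * (Z1 * Z2) -> R)
  (V : Bb * (Z1 * Z2) -> Bb * (Z1 * Z2) -> R[i]) (mu : Bb * (Z1 * Z2) -> R).
Hypotheses (ed : forall x, eigdec (omega1 N th ph G x) (w x) (lam x))
  (lam0 : forall x k, 0 <= lam x k) (eb : eigdec (omegab N PU P1 P2 th ph G) V mu)
  (mu0 : forall l, 0 <= mu l).
Let i1 := info1 PU P1 P2 (law1 N th ph G).
Let i2 := info2 PU P1 P2 (law2 N th ph G).
Let i12 := entB mu - entC PU P1 P2 lam.

(** Each user's message is embedded in a string of [nb] block messages over an alphabet of size
    [k1.+1] or [k2.+1]; [k1] and [k2] count the competitors in one block. *)
Lemma code_exists (eta : R) : 0 < eta -> exists q : R, 0 <= q < 1 /\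
  forall (l r nb k1 k2 M1 M2 : nat), (0 < M1)%N -> (0 < M2)%N ->
  (M1 <= k1.+1 ^ nb)%N -> (M2 <= k2.+1 ^ nb)%N ->
  exists c : fb_code R A1 A2 B (Bb * (Z1 * Z2))%type Z1 Z2 (nb.+1 * l.+1 + r) M1 M2,
    is_fb_code c /\ fb_error N c <=
      nb.+1%:R * (19 * q ^+ l.+1 + k2%:R * expR (- (l.+1%:R * (i1 - eta))) +
        k1%:R * expR (- (l.+1%:R * (i2 - eta))) +
        4 * ((k1.+1 * k2.+1).-1%:R * expR (- (l.+1%:R * (i12 - 2 * eta))))).
Proof.
move=> eta0; have HC := copyG_qinstrument HG.
have [q [q01 Hq]] := iid_code pU pP1 pP2 (law1_pmf HN Hth Hph HG) (law2_pmf HN Hth Hph HG)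
  ed lam0 (lam_sum HN Hth Hph HG ed) eb mu0 (fun _ _ => erefl) eta0.
exists q; split=> // l r nb k1 k2 M1 M2 M10 M20 le1 le2.
have [e1 inj1] := @exists_inj {ffun 'I_nb -> 'I_k1.+1} M1
  ltac:(by rewrite card_ffun !card_ord).
have [e2 inj2] := @exists_inj {ffun 'I_nb -> 'I_k2.+1} M2
  ltac:(by rewrite card_ffun !card_ord).
have [u _] := pmf_witness pU; have [x01 _] := pmf_witness (pP1 u).
have [x02 _] := pmf_witness (pP2 u).
have [[z01 z02] _] := pmf_witness (prob_out_pmf HN Hth Hph HC (x01, x02)).
pose m0 := (Ordinal M10, Ordinal M20).
pose T := (('I_M1 * 'I_M2) * 'I_nb.+1)%type.
(* Uniform over messages but unnormalised over blocks: [random_code] then bounds the sum of the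
   block errors averaged over the messages, with total weight [nb.+1]. *)
pose nu (p : T) : R := (M1 * M2)%:R^-1.
pose k (p : T) := key ord0 ord0 e1 e2 p.1 p.2.
pose m (p : T) := msg ord0 ord0 e1 e2 p.1 p.2.
have nu0 p : 0 <= nu p by rewrite invr_ge0 ler0n.
have nuS : \sum_p nu p = nb.+1%:R.
  have nz : (M1 * M2)%:R != 0 :> R by rewrite pnatr_eq0 muln_eq0 negb_or -!lt0n M10.
  by rewrite sumr_const !card_prod !card_ord -[LHS]mulr_natl natrM mulrAC (divff nz) mul1r.
have [x1 [x2 [d1 [d2 [D [pD hD]]]]]] := Hq l.+1 _ _ _ nu k m ord0 ord0 nu0.
exists (bmcode th ph (copyG G) z01 z02 x01 x02 ord0 ord0 r x1 x2 d1 d2 D e1 e2 m0).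
split; first exact: bmcodeP.
apply: le_trans (block_markov_error HN Hth Hph HC z01 z02 x01 x02 ord0 ord0 r x1 x2 d1 d2 pD inj1 inj2 m0) _.
by move: hD; rewrite nuS !card_ord.
Qed.

End Achievability.

(** * Message set sizes and choice of parameters *)

Lemma msize_gt0 (R : realType) n (r : R) : (0 < msize n r)%N.
Proof. by rewrite /msize absz_gt0 gt_eqF // ceil_gt0 powR_gt0. Qed.

Lemma msize_lt (R : realType) n (r : R) :
  (msize n r)%:R < expR (n%:R * r * ln 2) + 1.
Proof.
rewrite /msize natr_absz ger0_norm; last by rewrite ltW // ceil_gt0 powR_gt0.
have := gt_pred_ceil (2 `^ (n%:R * r) : R).
by rewrite intrB ltrBlDr /powR pnatr_eq0.
Qed.

(** Only [nb] of at most [nb.+2] block lengths carry messages, at rate [r - d / 2] instead of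
    [r - d]. The slack [nb%:R * d / 2] per symbol of a block covers the two idle lengths, costing
    [2 * r], and one bit for the ceiling. *)
Lemma msize_le_pow (R : realType) (n L nb : nat) (r d : R) : 0 < d -> (0 < L)%N ->
  (n <= nb.+2 * L)%N -> 4 * `|r| + 2 <= nb%:R * d ->
  (msize n (r - d) <= (Num.truncn (expR (L%:R * (ln 2 * (r - d / 2))))).+1 ^ nb)%N.
Proof.
move=> d0 L0 nL nbd; have c0 : 0 < ln 2 :> R by rewrite ln_gt0 // ltr1n.
have := msize_lt n (r - d); set M := msize _ _; set K := (Num.truncn _).+1.
(* At nonpositive rate the ceiling leaves a single message, and no rate comparison is made. *)
have [rd|rd] := leP (r - d) 0.
  move=> ltM; suff : (M < 2)%N by rewrite ltnS => /leq_trans; apply; rewrite expn_gt0.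
  rewrite -(ltr_nat R); apply: lt_le_trans ltM _.
  rewrite -[2%:R]/(1 + 1 : R) lerD2r -[leRHS]expR0 ler_expR.
  by rewrite mulr_le0_ge0 ?(ltW c0) // mulr_ge0_le0.
move=> ltM; rewrite -(ler_nat R) natrX; apply: (le_trans (ltW ltM)).
have Kge : expR (L%:R * (ln 2 * (r - d / 2))) <= K%:R by exact: ltW (truncnS_gt _).
apply: (@le_trans _ _ (expR (L%:R * (ln 2 * (r - d / 2))) ^+ nb)); last first.
  by rewrite lerXn2r ?nnegrE ?expR_ge0.
have y1 : 1 <= expR (n%:R * (r - d) * ln 2).
  by rewrite -[leLHS]expR0 ler_expR !mulr_ge0 // ltW.
(* The added 1 of the ceiling is absorbed into a factor 2, since the exponential is at least 1
   here. *)
apply: (@le_trans _ _ (expR (n%:R * (r - d) * ln 2) * expR (ln 2))).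
  by rewrite lnK ?posrE //; lra.
rewrite -expRD -expRM_natl ler_expR.
have nLr : n%:R <= (nb%:R + 2) * L%:R :> R.
  by rewrite -natrD -natrM ler_nat addn2.
have L1 : 1 <= L%:R :> R by rewrite ler1n.
have h1 : n%:R * (r - d) <= (nb%:R + 2) * L%:R * (r - d) by rewrite ler_pM2r.
have h2 : L%:R * (4 * `|r| + 2) <= L%:R * (nb%:R * d) by rewrite ler_wpM2l.
have h3 : L%:R * r <= L%:R * `|r| by rewrite ler_wpM2l // ler_norm.
have h4 : 0 <= L%:R * d by rewrite mulr_ge0 // ltW.
suff h : n%:R * (r - d) + 1 <= nb%:R * L%:R * (r - d / 2).
  have := ler_wpM2l (ltW c0) h; lra.
by nra.
Qed.

Lemma geom_small (R : realType) (q e : R) : 0 <= q < 1 -> 0 < e ->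
  exists L1 : nat, forall L, (L1 <= L)%N -> q ^+ L <= e.
Proof.
move=> /andP[q0 q1] e0; have /cvgrPdist_le/(_ e e0)[L1 _ h] := @cvg_expr R q
  ltac:(by rewrite ger0_norm).
exists L1 => L LL; have := h L LL.
by rewrite /= sub0r normrN ger0_norm // exprn_ge0.
Qed.

Lemma exp_rate_le (R : realType) (L : nat) (k a b eta : R) :
  k <= expR (L%:R * a) -> a - b <= - eta ->
  k * expR (- (L%:R * b)) <= expR (- eta) ^+ L.
Proof.
move=> ka ab; apply: (@le_trans _ _ (expR (L%:R * a) * expR (- (L%:R * b)))).
  by rewrite ler_wpM2r ?expR_ge0.
by rewrite -expRD -expRM_natl ler_expR -mulrBr ler_wpM2l.
Qed.

(* The two feedback links swap roles: [i2] is what transmitter 2 learns about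
   message 1.  The rates may be negative, so the sum-rate bound alone does not
   control [k1] and [k2] separately; hence the hypotheses [i1, i2 <= i12]. *)
Lemma error_terms_le (R : realType) (L k1 k2 : nat) (q r1 r2 d i1 i2 i12 : R) :
  let eta := d / 8 in 0 < d -> r1 <= i2 -> r2 <= i1 -> r1 + r2 <= i12 ->
  i1 <= i12 -> i2 <= i12 ->
  k1%:R <= expR (L%:R * (r1 - d / 2)) -> k2%:R <= expR (L%:R * (r2 - d / 2)) ->
  19 * q ^+ L + k2%:R * expR (- (L%:R * (i1 - eta))) +
    k1%:R * expR (- (L%:R * (i2 - eta))) +
    4 * ((k1.+1 * k2.+1).-1%:R * expR (- (L%:R * (i12 - 2 * eta)))) <=
  19 * q ^+ L + 14 * expR (- eta) ^+ L.
Proof.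
move=> eta d0 h1 h2 h12 le1 le2 k1a k2a.
have etaE : d = 8 * eta by rewrite /eta; field.
have b1 : k2%:R * expR (- (L%:R * (i1 - eta))) <= expR (- eta) ^+ L.
  by apply: (exp_rate_le k2a); lra.
have b2 : k1%:R * expR (- (L%:R * (i2 - eta))) <= expR (- eta) ^+ L.
  by apply: (exp_rate_le k1a); lra.
have b3 : k1%:R * expR (- (L%:R * (i12 - 2 * eta))) <= expR (- eta) ^+ L.
  by apply: (exp_rate_le k1a); lra.
have b4 : k2%:R * expR (- (L%:R * (i12 - 2 * eta))) <= expR (- eta) ^+ L.
  by apply: (exp_rate_le k2a); lra.
have b5 : k1%:R * k2%:R * expR (- (L%:R * (i12 - 2 * eta))) <= expR (- eta) ^+ L.
  apply: (@exp_rate_le _ _ _ (r1 - d / 2 + (r2 - d / 2))); last by lra.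
  by rewrite mulrDr expRD ler_pM.
(* A wrong key may differ from the true one in both components or in only one, which gives the three
   products. With the two feedback terms the constant is 14 = 1 + 1 + 4 times 3. *)
have -> : (k1.+1 * k2.+1).-1%:R = k1%:R * k2%:R + k1%:R + k2%:R :> R.
  by rewrite mulSn mulnS addSn /= !natrD natrM; ring.
lra.
Qed.

(* C_cl-fb(N) contains R_QCL(N): every rate pair of R_QCL(N), i.e. every pair
   satisfying the three bounds for some choice of (U,X1,X2,p,theta,phi,Gamma),
   lies in the feedback capacity region. *)
Theorem theorem1 (R : realType) (A1 A2 B : finType)
  (N : op R (A1 * A2)%type -> op R B) (HN : qchannel N)
  (U X1 X2 Z1 Z2 Bb : finType)
  (pU : U -> R) (pX1 : U -> X1 -> R) (pX2 : U -> X2 -> R)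
  (HpU : is_pmf pU) (HpX1 : forall u, is_pmf (pX1 u)) (HpX2 : forall u, is_pmf (pX2 u))
  (th : X1 -> op R A1) (ph : X2 -> op R A2)
  (Hth : forall x1, qdensity (th x1)) (Hph : forall x2, qdensity (ph x2))
  (G : (Z1 * Z2)%type -> op R B -> op R Bb) (HG : qinstrument G)
  (R1 R2 : R) :
  qcl_rates N pU pX1 pX2 th ph G R1 R2 ->
  cap_region_fb N (R1, R2).
Proof.
move=> rates; apply: subset_closure => /= eps d eps0 d0.
have c0 : 0 < ln 2 :> R by rewrite ln_gt0 // ltr1n.
have [w [lam [V [mu [ed lam0 eb mu0 [orth probE]]]]]] :=
  single_spectra HN HpU HpX1 HpX2 Hth Hph HG.
move: rates; rewrite /qcl_rates cCMI_info1 // cCMI_info2 //.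
rewrite (qMI_single HN HpU HpX1 HpX2 Hth Hph HG ed lam0 eb mu0).
have le1 := info1_le HN HpU HpX1 HpX2 Hth Hph HG ed lam0 eb orth probE.
have le2 := info2_le HN HpU HpX1 HpX2 Hth Hph HG ed lam0 eb orth probE.
set i1 := info1 _ _ _ _ in le1 *; set i2 := info2 _ _ _ _ in le2 *.
set i12 := entB mu - _ in le1 le2 *.
rewrite !ler_pdivlMr // => -[r1 [r2 r12]].
(* The factor [ln 2] converts bits to nats. Block rates lie [d / 2], that is [4 * eta], below the
   target, enough for a typicality loss of at most [2 * eta] and a decay rate [eta]. *)
pose eta := ln 2 * d / 8.
have eta0 : 0 < eta by rewrite divr_gt0 // mulr_gt0.
have [q [q01 Hcode]] := code_exists HN HpU HpX1 HpX2 Hth Hph HG ed lam0 eb mu0 eta0.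
(* Fixed before the blocklength, so the factor [nb.+1] in the error is a constant; [nb] is large
   enough for [msize_le_pow] at both rates. *)
pose nb := (Num.truncn ((4 * (`|R1| + `|R2|) + 2) / d)).+1.
have nbd : 4 * (`|R1| + `|R2|) + 2 <= nb%:R * d.
  by rewrite -ler_pdivrMr // ltW // truncnS_gt.
pose rho := Num.max q (expR (- eta)).
have rho01 : 0 <= rho < 1.
  case/andP: q01 => q0 q1; rewrite le_max q0 gt_max q1 /=.
  by rewrite -[ltRHS]expR0 ltr_expR oppr_lt0.
(* 33 = 19 + 14, the constants of the error bound once both geometric rates are replaced by their
   maximum [rho]. *)
have e0 : 0 < eps / (nb.+1%:R * 33) by rewrite divr_gt0 // mulr_gt0.
have [L1 HL1] := geom_small rho01 e0.
(* Block lengths of at least [L1] make the error small; lengths of at least [nb.+1] let the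
   remainder [r] and the final use without feedback fit into one more block length. *)
exists (maxn L1 nb.+1 * nb.+1).+1 => n'; rewrite ltnS => n'ge.
have Lge : (maxn L1 nb.+1 <= n' %/ nb.+1)%N by rewrite leq_divRL.
pose l := (n' %/ nb.+1).-1; pose r := (n' %% nb.+1)%N.
have lE : l.+1 = (n' %/ nb.+1)%N.
  by rewrite prednK // (leq_trans _ Lge) // leq_max orbT.
have nE : n' = (nb.+1 * l.+1 + r)%N by rewrite lE mulnC; exact: divn_eq.
have rlt : (r < nb.+1)%N by rewrite ltn_pmod.
rewrite -lE geq_max in Lge; case/andP: Lge => LL1 Lnb.
have nle : (n'.+1 <= nb.+2 * l.+1)%N.
  rewrite nE [X in (_ <= X)%N]mulSn -addnS [X in (X <= _)%N]addnC leq_add2r.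
  exact: leq_trans rlt Lnb.
have nbd1 : 4 * `|R1| + 2 <= nb%:R * d by apply: le_trans nbd; have := normr_ge0 R2; lra.
have nbd2 : 4 * `|R2| + 2 <= nb%:R * d by apply: le_trans nbd; have := normr_ge0 R1; lra.
have m1 := msize_le_pow d0 (ltn0Sn l) nle nbd1.
have m2 := msize_le_pow d0 (ltn0Sn l) nle nbd2.
(* A block alphabet of size [k.+1] leaves [k] competitors, and the truncation [k] stays below the
   exponential even when the exponent is negative. *)
have tr x : (Num.truncn (expR x : R))%:R <= expR x by rewrite truncn_le expR_ge0.
have [c [cP cE]] := Hcode l r nb _ _ _ _ (msize_gt0 _ _) (msize_gt0 _ _) m1 m2.
have {}cE : fb_error N c <= eps.
  apply: le_trans cE _; apply: (@le_trans _ _ (nb.+1%:R * (33 * rho ^+ l.+1))); last first.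
    by rewrite mulrA mulrC -ler_pdivlMr ?mulr_gt0 // HL1.
  rewrite ler_wpM2l //; apply: le_trans (error_terms_le (d := ln 2 * d) (r1 := ln 2 * R1)
    (r2 := ln 2 * R2) q _ _ _ _ le1 le2 _ _) _.
  - by rewrite mulr_gt0.
  - by rewrite mulrC.
  - by rewrite mulrC.
  - by rewrite -mulrDr mulrC.
  - by rewrite -mulrA -mulrBr; exact: tr.
  - by rewrite -mulrA -mulrBr; exact: tr.
  have q0 : 0 <= q by case/andP: q01.
  have bq : q ^+ l.+1 <= rho ^+ l.+1.
    by rewrite lerXn2r ?nnegrE // ?le_max ?lexx ?q0.
  have be : expR (- eta) ^+ l.+1 <= rho ^+ l.+1.
    by rewrite lerXn2r ?nnegrE ?expR_ge0 // ?le_max ?lexx ?orbT ?q0.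
  rewrite -/eta; lra.
(* The type of [c] contains the decomposed number of rounds, so the code is generalised before
   rewriting it back to [n']. *)
move: c cP cE; rewrite -nE => c cP cE.
by exists (Bb * (Z1 * Z2))%type, Z1, Z2, c.
Qed.
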